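(* Let $\gamma\in(0,2)$ and let $\chi=\chi(\gamma)$ be the distance exponent defined in the context. There is a constant $c=c(\gamma)>0$ such that for each $u>0$, $$\mathbb P\left[\operatorname{diam}\left(\mathcal G^\epsilon|_{(0,1]}\right)\le\epsilon^{-\chi-u}\right]\ge1-O_\epsilon\left(e^{-cu^2(\log\epsilon^{-1})^2}\right)\quad\text{as }\epsilon\to0.$$ Furthermore, for $s,t\in[0,1]$ with $s<t$, let $x_s^\epsilon$ (resp. $x_t^\epsilon$) be the element of $(0,1]\cap\epsilon\mathbb Z$ closest to $s$ (resp. $t$). Then for each $u>0$, $$\mathbb P\left[\operatorname{dist}\left(x_s^\epsilon,x_t^\epsilon;\mathcal G^\epsilon|_{(0,1]}\right)\ge\epsilon^{-\chi+u}\right]\ge\epsilon^{o_\epsilon(1)},$$ i.e., for each $\zeta>0$ there exists $\epsilon_0>0$ such that this probability is at least $\epsilon^\zeta$ for each $\epsilon\in(0,\epsilon_0]$.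
   Context: Fix $\gamma\in(0,2)$. Let $Z=(L,R)$ be a two-sided correlated two-dimensional Brownian motion with $Z_0=0$ and $\operatorname{Var}L_t=\operatorname{Var}R_t=\alpha|t|$, $\operatorname{Cov}(L_t,R_t)=-\alpha\cos(\pi\gamma^2/4)|t|$ for $t\in\mathbb R$, where $\alpha=\alpha(\gamma)>0$ is a deterministic constant depending only on $\gamma$ (its value does not affect the graphs below in law). For $\epsilon>0$, the LQG structure graph (mated-CRT map) $\mathcal G^\epsilon$ is the random graph with vertex set $\epsilon\mathbb Z$ in which $x_1<x_2$ are joined by an edge if and only if $$\Big(\inf_{s\in[x_1-\epsilon,x_1]}L_s\Big)\vee\Big(\inf_{s\in[x_2-\epsilon,x_2]}L_s\Big)\le\inf_{s\in[x_1,x_2-\epsilon]}L_s$$ or the same holds with $R$ in place of $L$. For $A\subset\mathbb R$, $\mathcal G^\epsilon|_A$ is the induced subgraph of $\mathcal G^\epsilon$ on the vertex set $\epsilon\mathbb Z\cap A$. For a graph $G$, $\operatorname{dist}(x,y;G)$ is the graph distance and $\operatorname{diam}(G)$ is the supremum of graph distances over pairs of vertices. The exponent is $\chi:=\lim_{\epsilon\to0}\log\mathbb E[\operatorname{diam}(\mathcal G^\epsilon|_{(0,1]})]/\log\epsilon^{-1}$ (this limit exists). The implicit constant in $O_\epsilon(\cdot)$ may depend on $u$ and $\gamma$; the rate of the $o_\epsilon(1)$ may depend on $u,s,t,\gamma$. *)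

(* Defs.v *)
From HB Require Import structures.
From mathcomp Require Import all_boot all_order all_algebra.
From mathcomp Require Import all_classical all_reals all_analysis.

Set Implicit Arguments.
Unset Strict Implicit.
Unset Printing Implicit Defensive.

Import Order.TTheory GRing.Theory Num.Theory.
Import numFieldNormedType.Exports.

Local Open Scope classical_set_scope.
Local Open Scope ring_scope.

Record graph (V : eqType) := Graph {
  vertices : set V;
  adjacent : rel V
}.

Definition induced_subgraph (V : eqType) (G : graph V) (A : set V) : graph V :=
  Graph (vertices G `&` A) (@adjacent V G).

(* The walk of [G] starting at [x] and then visiting the items of [p]; its
   length is [size p]. *)
Definition is_walk (V : eqType) (G : graph V) (x : V) (p : seq V) : Prop :=
  (forall z, z \in x :: p -> vertices G z) /\ path (@adjacent V G) x p.

(* [+oo] when [x] and [y] are not connected in [G] *)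
Definition graph_dist (R : realType) (V : eqType) (G : graph V) (x y : V)
    : \bar R :=
  ereal_inf [set (size p)%:R%:E | p in [set p | is_walk G x p /\ last x p = y]].

Definition graph_diam (R : realType) (V : eqType) (G : graph V) : \bar R :=
  ereal_sup [set graph_dist R G xy.1 xy.2 |
             xy in [set xy | vertices G xy.1 /\ vertices G xy.2]].

Section MatedCRTMap.
Variable R : realType.

Definition lattice (eps : R) : set R := [set k%:~R * eps | k in [set: int]].

Definition inf_on (f : R -> R) (a b : R) : R := inf (f @` `[a, b]).

Definition crt_adjacent (f : R -> R) (eps x1 x2 : R) : bool :=
  Num.max (inf_on f (x1 - eps) x1) (inf_on f (x2 - eps) x2)
    <= inf_on f x1 (x2 - eps).

Definition mated_crt_lt_adjacent (z : R -> R * R) (eps x1 x2 : R) : bool :=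
  (x1 < x2) && (crt_adjacent (fun s => (z s).1) eps x1 x2
             || crt_adjacent (fun s => (z s).2) eps x1 x2).

(* The mated-CRT map is a deterministic function of the path [z = (L, R)]. *)
Definition mated_crt_map (z : R -> R * R) (eps : R) : graph R :=
  Graph (lattice eps)
    (fun x y => mated_crt_lt_adjacent z eps x y
             || mated_crt_lt_adjacent z eps y x).

Definition mated_crt_map01 (z : R -> R * R) (eps : R) : graph R :=
  induced_subgraph (mated_crt_map z eps) `]0, 1].

Definition closest_vertex (eps s x : R) : Prop :=
  (lattice eps `&` `]0, 1]) x /\
  (forall y, (lattice eps `&` `]0, 1]) y -> `|x - s| <= `|y - s|).

(* [normal_prob m 0] is not a Dirac mass in the library. *)
Definition centered_normal (v : R) (A : set R) : \bar R :=
  if v == 0 then \d_(0 : R) A else normal_prob 0 (Num.sqrt v) A.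

(* (X, Y) is a centered Gaussian vector, i.e. every linear combination of its
   coordinates is a centered normal variable. *)
Definition centered_gaussian_pair d (T : measurableType d)
    (P : probability T R) (X Y : T -> R) (varX varY covXY : R) : Prop :=
  forall (a b : R) (A : set (measurableTypeR R)), measurable A ->
    P [set w | A (a * X w + b * Y w)] =
    centered_normal (a ^+ 2 * varX + b ^+ 2 * varY + 2 * a * b * covXY) A.

Definition increment (T : Type) (Z : R -> T -> R * R) (s t : R) (w : T) : R * R :=
  Z t w - Z s w.

Definition independent_increments d (T : measurableType d)
    (P : probability T R) (Z : R -> T -> R * R) : Prop :=
  forall (n : nat) (t : nat -> R)
      (A : nat -> set (measurableTypeR R * measurableTypeR R)),
    (forall i, t i <= t i.+1) -> (forall i, measurable (A i)) ->
    P (\bigcap_(i < n) [set w | A i (increment Z (t i) (t i.+1) w)]) =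
    (\prod_(i < n) P [set w | A i (increment Z (t i) (t i.+1) w)])%E.

(* Indexing by all of [R], the independence of the increments includes that of
   the two sides [(Z_t)_(t >= 0)] and [(Z_(-t))_(t >= 0)]. *)
Record mated_crt_brownian_motion (gamma alpha : R) d (T : measurableType d)
    (P : probability T R) (Z : R -> T -> R * R) : Prop := {
  bm_measurable : forall t,
    measurable_fun [set: T]
      (Z t : T -> measurableTypeR R * measurableTypeR R);
  bm_start : forall w, Z 0 w = 0;
  bm_continuous : forall w, continuous (fun t => Z t w);
  bm_independent : independent_increments P Z;
  bm_gaussian : forall s t, s <= t ->
    centered_gaussian_pair P
      (fun w => (increment Z s t w).1) (fun w => (increment Z s t w).2)
      (alpha * (t - s)) (alpha * (t - s))
      (- alpha * cos (pi * gamma ^+ 2 / 4) * (t - s))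
}.

(* [chi] is the limit defining the distance exponent. The law of the mated-CRT
   map depends only on [gamma], whence the quantification over all scalings
   [alpha] and all realisations [Z]. *)
Definition is_distance_exponent (gamma chi : R) : Prop :=
  forall (alpha : R) (d : measure_display) (T : measurableType d)
    (P : probability T R) (Z : R -> T -> R * R),
  0 < alpha -> mated_crt_brownian_motion gamma alpha P Z ->
  (lne (\int[P]_w graph_diam R (mated_crt_map01 (Z ^~ w) eps))
     / (ln eps^-1)%:E)%E @[eps --> 0^'+] --> chi%:E.

End MatedCRTMap.

(* Main.v *)
(* By scaling, the graph on (0, 1] becomes the graph of the unit blocks of [0, N),
   where N is the integer part of 1/eps; its restrictions to disjoint intervals
   are independent, and they are stationary. The law of the whole increment
   process is determined by its Gaussian marginals (Cramer-Wold), so a single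
   realisation of Z serves as a reference for all of them.

   Upper bound. Cut [0, N) into m intervals of length b. If an interval has
   diameter more than A with probability q, then fewer than k of them do outside
   an event of probability (m q)^k. As diameters are subadditive,
     P[diam_N > m (A + 1) + k l] <= (m q)^k + m P[diam_b > l].
   Markov's inequality bounds q, and iterating over about 8/u scales, with k of
   order u log N, brings the bound l from the trivial N down to N^(chi + u).

   Lower bound. By the upper bound the mean of diam_n, of order n^(chi + o(1)),
   is not carried by rare large values, so diam_n >= n^(chi - a) with probability
   at least n^(- 3 a). Put n = m^Q. By the triangle inequality through the
   multiples of M = m^(Q - 1), some interval [0, i M] has endpoints that far apart
   with probability at least m^(-2). Place such an interval between s and t, and
   ask that both coordinates drop quickly just inside each of its ends while, on
   the outside, they stay above their values at the ends up to a smaller height.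
   Then edges enter and leave the interval only through short windows at its ends,
   whose diameters are negligible, so the distance from s to t is of order
   n^(chi - a). Staying above at all scales from m^(Q/2 - 5) to m^(Q/2) costs a power of m
   that does not depend on Q, hence an arbitrarily small power of n. *)

Require Import Defs.
From HB Require Import structures.
From mathcomp Require Import all_boot all_order all_algebra.
From mathcomp Require Import all_classical all_reals all_analysis.
From mathcomp Require Import measurable_realfun.
From mathcomp Require Import ring lra zify.

Set Implicit Arguments.
Unset Strict Implicit.
Unset Printing Implicit Defensive.

Import Order.TTheory GRing.Theory Num.Theory.
Import numFieldNormedType.Exports.

Local Open Scope classical_set_scope.
Local Open Scope ring_scope.

(** * Bounded multipliers and the Cramer-Wold theorem *)

(** Two obstacles shape the lower bound. Distances are not monotone in the interval: a walk may
    leave a subinterval and bypass it along long edges, so a large diameter of a subinterval says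
    nothing about (0, 1] by itself. Pinching excludes such edges. Its windows have length m^(Q - 2):
    long enough that failing to drop by a height of order m^(Q/2 - 5) has probability of order
    m^(-4), below the m^(-2) of the far ends, and short enough that their diameter stays below
    m^((chi + a) (Q - 1)).

    In the upper bound the square of the logarithm arises because an interval is bad with a
    probability that beats the number m of intervals by a power N^(-u/8), and k of order u log N
    independent bad intervals are excluded at once.

    All events are sets of arbitrary functions on the line, in the sigma-algebra generated by the
    increments over dyadic times of an interval. Law and independence are then transferred by
    pi-lambda arguments; continuity of the paths only serves to identify the dyadic comparisons with
    those of infima. *)

Section bounded_functions.
Variables (R : realType) (d : measure_display) (X : measurableType d).

Definition bounded_mfun (F : X -> R) :=
  measurable_fun [set: X] F /\ exists M, forall x, `|F x| <= M.

Lemma bounded_mfun_cst c : bounded_mfun (cst c).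
Proof. by split => //; exists `|c|. Qed.

Lemma bounded_mfunD F G :
  bounded_mfun F -> bounded_mfun G -> bounded_mfun (fun x => F x + G x).
Proof.
move=> [mF [M hM]] [mG [N hN]]; split; first exact: measurable_funD.
by exists (M + N) => x; apply: le_trans (ler_normD _ _) (lerD _ _).
Qed.

Lemma bounded_mfunM F G :
  bounded_mfun F -> bounded_mfun G -> bounded_mfun (fun x => F x * G x).
Proof.
move=> [mF [M hM]] [mG [N hN]]; split; first exact: measurable_funM.
by exists (M * N) => x; rewrite normrM ler_pM.
Qed.

Lemma bounded_mfunZ c F : bounded_mfun F -> bounded_mfun (fun x => c * F x).
Proof. exact/bounded_mfunM/bounded_mfun_cst. Qed.

Lemma bounded_mfun_cvg (G : nat -> X -> R) (F : X -> R) (M : R) :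
  (forall n, measurable_fun setT (G n)) -> (forall n x, `|G n x| <= M) ->
  (forall x, G n x @[n --> \oo] --> F x) -> bounded_mfun F.
Proof.
move=> mG hG GF; split; first by apply: (measurable_fun_cvg mG) => x _.
exists M => x; rewrite -(cvg_lim _ (cvg_norm (GF x)))//.
apply: limr_le; last by near=> n.
by apply: is_cvg_norm; apply/cvg_ex; exists (F x).
Unshelve. all: by end_near. Qed.

Lemma bounded_mfun_integrable (mu : {measure set X -> \bar R}) F :
  (mu setT < +oo)%E -> bounded_mfun F -> mu.-integrable setT (EFin \o F).
Proof.
move=> mufin [mF [M hM]]; apply: measurable_bounded_integrable => //.
exists M; split; first exact: num_real.
by move=> x Mx y _ /=; rewrite (le_trans (hM _))// ltW.
Qed.

Lemma bounded_cvg_integral (mu : {measure set X -> \bar R})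
    (G : nat -> X -> R) (F : X -> R) (M : R) : (mu setT < +oo)%E ->
  (forall n, measurable_fun setT (G n)) -> (forall n x, `|G n x| <= M) ->
  (forall x, G n x @[n --> \oo] --> F x) ->
  (\int[mu]_x (G n x)%:E @[n --> \oo] --> \int[mu]_x (F x)%:E)%E.
Proof.
move=> mufin mG hG GF; have [mF _] := bounded_mfun_cvg mG hG GF.
have [] := @dominated_convergence _ _ _ mu setT measurableT
  (fun n x => (G n x)%:E) (fun x => (F x)%:E) (fun=> M%:E) => //.
- by move=> n; exact/measurable_EFinP.
- exact/measurable_EFinP.
- by apply/aeW => x _; apply/cvg_EFin; [exact: nearW|exact: GF].
- exact/bounded_mfun_integrable/bounded_mfun_cst.
- by apply/aeW => x n _ /=; rewrite lee_fin.
Qed.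

End bounded_functions.

Section multiplicative_class.
Variables (R : realType) (d : measure_display) (X : measurableType d).
Variables (mu1 mu2 : {measure set X -> \bar R}).
Hypotheses (mu1_fin : (mu1 setT < +oo)%E) (mu2_fin : (mu2 setT < +oo)%E).
Variable (base : set (X -> R)).

Let same (F : X -> R) :=
  (\int[mu1]_x (F x)%:E = \int[mu2]_x (F x)%:E)%E.

(* [agreeing] is a module over [multiplier], and both contain the
   bounded limits of their elements. *)
Definition agreeing (F : X -> R) :=
  bounded_mfun F /\ forall g, base g -> same (fun x => F x * g x).

Definition multiplier (G : X -> R) :=
  bounded_mfun G /\ forall F, agreeing F -> agreeing (fun x => F x * G x).

Hypothesis base_bounded : forall g, base g -> bounded_mfun g.

Lemma agreeingD F G : agreeing F -> agreeing G -> agreeing (fun x => F x + G x).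
Proof.
move=> [bF hF] [bG hG]; split; first exact: bounded_mfunD.
move=> g bg; have bbg := base_bounded bg; rewrite /same.
under eq_integral do rewrite mulrDl EFinD.
under [RHS]eq_integral do rewrite mulrDl EFinD.
rewrite !integralD//; try by apply: bounded_mfun_integrable => //; exact: bounded_mfunM.
by rewrite (hF _ bg) (hG _ bg).
Qed.

Lemma agreeingZ c F : agreeing F -> agreeing (fun x => c * F x).
Proof.
move=> [bF hF]; split; first exact: bounded_mfunZ.
move=> g bg; have bbg := base_bounded bg; rewrite /same.
under eq_integral do rewrite -mulrA EFinM.
under [RHS]eq_integral do rewrite -mulrA EFinM.
rewrite !integralZl//; try by apply: bounded_mfun_integrable => //; exact: bounded_mfunM.
by rewrite (hF _ bg).
Qed.

Lemma agreeing_cvg (G : nat -> X -> R) (F : X -> R) (M : R) :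
  (forall n, agreeing (G n)) -> (forall n x, `|G n x| <= M) ->
  (forall x, G n x @[n --> \oo] --> F x) -> agreeing F.
Proof.
move=> hG GM GF; have mG n : measurable_fun setT (G n) by have [[]] := hG n.
split; first exact: (bounded_mfun_cvg mG GM GF).
move=> g bg; have [mg [N hN]] := base_bounded bg; rewrite /same.
have h (mu : {measure set X -> \bar R}) : (mu setT < +oo)%E ->
    (\int[mu]_x (G n x * g x)%:E @[n --> \oo] --> \int[mu]_x (F x * g x)%:E)%E.
  move=> mufin; apply: (@bounded_cvg_integral _ _ _ mu _ _ (M * N)) => //.
  - by move=> n; exact: measurable_funM.
  - by move=> n x; rewrite normrM ler_pM.
  - by move=> x; apply: cvgM => //; exact: cvg_cst.
have := h _ mu1_fin; under eq_cvg => n.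
  rewrite (_ : (\int[mu1]_x _)%E = (\int[mu2]_x (G n x * g x)%:E)%E); last first.
    by have [_] := hG n; exact.
  over.
by move=> h1; apply: (cvg_unique _ h1 (h _ mu2_fin)).
Qed.

Lemma multiplier_cst c : multiplier (cst c).
Proof.
split; first exact: bounded_mfun_cst.
move=> F /(agreeingZ c); congr agreeing.
by apply/funext => x; rewrite mulrC.
Qed.

Lemma multiplierD F G :
  multiplier F -> multiplier G -> multiplier (fun x => F x + G x).
Proof.
move=> [bF hF] [bG hG]; split; first exact: bounded_mfunD.
move=> H hH; have := agreeingD (hF _ hH) (hG _ hH).
by congr agreeing; apply/funext => x; rewrite mulrDr.
Qed.

Lemma multiplierM F G :
  multiplier F -> multiplier G -> multiplier (fun x => F x * G x).
Proof.
move=> [bF hF] [bG hG]; split; first exact: bounded_mfunM.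
move=> H hH; have := hG _ (hF _ hH).
by congr agreeing; apply/funext => x; rewrite mulrA.
Qed.

Lemma multiplierZ c F : multiplier F -> multiplier (fun x => c * F x).
Proof. exact/multiplierM/multiplier_cst. Qed.

Lemma multiplier_cvg (G : nat -> X -> R) (F : X -> R) (M : R) :
  (forall n, multiplier (G n)) -> (forall n x, `|G n x| <= M) ->
  (forall x, G n x @[n --> \oo] --> F x) -> multiplier F.
Proof.
move=> hG GM GF; have mG n : measurable_fun setT (G n) by have [[]] := hG n.
split; first exact: (bounded_mfun_cvg mG GM GF).
move=> H hH; have [[mH [N hN]] _] := hH.
apply: (@agreeing_cvg (fun n x => H x * G n x) _ (N * M)).
- by move=> n; have [_] := hG n; exact.
- by move=> n x; rewrite normrM ler_pM.
- by move=> x; apply: cvgM => //; exact: cvg_cst.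
Qed.

(** Indicators of complements and finite unions are polynomials in indicators, and countable unions
    are bounded limits of finite ones. *)
Lemma multiplier_sigma_algebra :
  sigma_algebra [set: X] [set A | multiplier (\1_A : X -> R)].
Proof.
split => /=.
- by rewrite indic0; exact: multiplier_cst.
- move=> A hA; have := multiplierD (multiplier_cst 1) (multiplierZ (-1) hA).
  congr multiplier; apply/funext => x /=.
  by rewrite !indicE in_setD in_setT mulN1r; case: (x \in A) => /=; lra.
- move=> A hA.
  have hU n : multiplier (\1_(\bigcup_(k < n) A k) : X -> R).
    elim: n => [|n IH]; first by rewrite bigcup_mkord big_ord0 indic0; exact: multiplier_cst.
    have := multiplierD (multiplierD IH (hA n)) (multiplierZ (-1) (multiplierM IH (hA n))).
    congr multiplier; apply/funext => x /=; rewrite !bigcup_mkord big_ord_recr/=.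
    rewrite !indicE in_setU mulN1r.
    by case: (x \in A n); case: (x \in _) => /=; lra.
  apply: (@multiplier_cvg _ _ 1 hU).
    by move=> n x; rewrite indicE; case: (_ \in _); rewrite ?normr1 ?normr0.
  move=> x; have [[n _ Anx]|nx] := pselect ((\bigcup_k A k) x).
    apply: cvg_near_cst; exists n.+1 => // m /= nm; rewrite !indicE !mem_set//.
      by exists n.
    by exists n.
  apply: cvg_near_cst; near=> n; rewrite !indicE !memNset//.
  by move=> [k _ Ak]; apply: nx; exists k.
Unshelve. all: by end_near. Qed.

(** The multiplier acts on the agreeing function 1, and the product is tested against the element 1
    of [base]. *)
Lemma eq_measure_multiplier A : base (cst 1) -> agreeing (cst 1) ->
  measurable A -> multiplier (\1_A : X -> R) -> mu1 A = mu2 A.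
Proof.
move=> b1 h1 mA [_ /(_ _ h1)[_ /(_ _ b1)]]; rewrite /same.
under eq_integral do rewrite /= mul1r mulr1.
under [RHS]eq_integral do rewrite /= mul1r mulr1.
by rewrite !integral_indic// !setIT.
Qed.

End multiplicative_class.

Section cubic_sign.
Variable R : realType.

(* An odd cubic fixing [-1, 0, 1] whose iterates converge to the sign
   function on [-1, 1]. *)
Definition cubic_step (y : R) := 3 / 2 * y - 1 / 2 * y ^+ 3.

Lemma cubic_step_itv y : 0 <= y <= 1 -> y <= cubic_step y <= 1.
Proof.
move=> /andP[y0 y1]; rewrite /cubic_step; apply/andP; split.
  rewrite -subr_ge0 (_ : _ - y = 1 / 2 * (y * ((1 - y) * (1 + y)))); last by field.
  by rewrite !mulr_ge0// ?subr_ge0// ?addr_ge0//; lra.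
rewrite -subr_ge0 (_ : 1 - _ = 1 / 2 * ((1 - y) ^+ 2 * (2 + y))); last by field.
by rewrite !mulr_ge0// ?sqr_ge0//; lra.
Qed.

Lemma cubic_stepN y : cubic_step (- y) = - cubic_step y.
Proof. by rewrite /cubic_step; ring. Qed.

Lemma iter_cubic_stepN n y : iter n cubic_step (- y) = - iter n cubic_step y.
Proof. by elim: n => //= n ->; rewrite cubic_stepN. Qed.

Lemma iter_cubic_step_itv n y : 0 <= y <= 1 -> y <= iter n cubic_step y <= 1.
Proof.
move=> /andP[y0 y1]; elim: n => [|n /andP[h1 h2]] /=; first by rewrite lexx.
have /cubic_step_itv/andP[h3 ->] : 0 <= iter n cubic_step y <= 1.
  by rewrite h2 (le_trans y0).
by rewrite (le_trans h1).
Qed.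

Lemma iter_cubic_step_norm n y : `|y| <= 1 -> `|iter n cubic_step y| <= 1.
Proof.
have h z : 0 <= z <= 1 -> `|iter n cubic_step z| <= 1.
  move=> hz; have /andP[h1 h2] := iter_cubic_step_itv n hz.
  by rewrite ger0_norm// (le_trans _ h1)//; case/andP: hz.
rewrite ler_norml => /andP[y1 y2]; have [y0|y0] := leP 0 y; first by apply: h; lra.
by rewrite -[y]opprK iter_cubic_stepN normrN; apply: h; lra.
Qed.

Lemma iter_cubic_step_cvg1 y : 0 < y <= 1 -> iter n cubic_step y @[n --> \oo] --> (1 : R).
Proof.
move=> /andP[y0 y1]; have y01 : 0 <= y <= 1 by rewrite y1 ltW.
(* A step from z multiplies the gap 1 - z by 1 - z/2 - z^2/2, which is at most 1 - y/2 because the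
   iterates stay above y. *)
have bnd n : 1 - (1 - y / 2) ^+ n <= iter n cubic_step y.
  elim: n => [|n IH]; first by rewrite expr0 subrr ltW.
  rewrite iterS exprS; set z := iter n cubic_step y in IH *.
  have /andP[yz z1] : y <= z <= 1 := iter_cubic_step_itv n y01.
  have : (1 - y / 2) * (1 - z) <= (1 - y / 2) * (1 - y / 2) ^+ n.
    by apply: ler_wpM2l; lra.
  rewrite /cubic_step => IH'; rewrite lerBlDr -lerBlDl; apply: le_trans IH'.
  rewrite -subr_ge0.
  have -> : (1 - y / 2) * (1 - z) - (1 - (3 / 2 * z - 1 / 2 * z ^+ 3)) =
    (1 - z) * ((z - y) / 2 + z ^+ 2 / 2) by field.
  by have := sqr_ge0 z; move=> ?; rewrite mulr_ge0//; lra.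
apply: (squeeze_cvgr (f := fun n => 1 - (1 - y / 2) ^+ n) (h := cst 1)); last exact: cvg_cst.
  apply: nearW => n; rewrite bnd /=.
  by have /andP[] := iter_cubic_step_itv n y01.
rewrite -[X in _ --> X]subr0; apply: cvgB; first exact: cvg_cst.
by apply: cvg_expr; rewrite ger0_norm; lra.
Qed.

Lemma iter_cubic_step_cvg_sg y : `|y| <= 1 ->
  iter n cubic_step y @[n --> \oo] --> (Num.sg y : R).
Proof.
rewrite ler_norml => /andP[y1 y2].
have [y0|y0|->] := ltrgt0P y.
- by rewrite gtr0_sg//; apply: iter_cubic_step_cvg1; rewrite y0.
- rewrite ltr0_sg// -[y]opprK.
  rewrite (_ : (fun n => _) = (fun n => - iter n cubic_step (- y))); last first.
    by apply/funext => n; rewrite iter_cubic_stepN.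
  by apply: cvgN; apply: iter_cubic_step_cvg1; lra.
- rewrite sgr0 (_ : (fun n => _) = cst 0); first exact: cvg_cst.
  apply/funext; elim=> //= n ->.
  by rewrite /cubic_step expr0n/= !mulr0 subr0.
Qed.

End cubic_sign.

Section plane_measure.
Variable R : realType.
Notation RR := (measurableTypeR R * measurableTypeR R)%type.

Definition lin_form (a b : R) (z : RR) : R := a * z.1 + b * z.2.

Lemma measurable_lin_form a b : measurable_fun [set: RR] (lin_form a b).
Proof.
by apply: measurable_funD; apply: measurable_funM.
Qed.

Definition plane_wave (a b t : R) (z : RR) : R := cos (lin_form a b z + t).

Lemma measurable_cos : measurable_fun [set: R] (@cos R).
Proof. apply: continuous_measurable_fun; exact: continuous_cos. Qed.

Lemma plane_wave_bounded a b t : bounded_mfun (plane_wave a b t).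
Proof.
split; last by exists 1 => x; rewrite ler_norml cos_geN1 cos_le1.
apply: measurableT_comp; first exact: measurable_cos.
by apply: measurable_funD => //; exact: measurable_lin_form.
Qed.

Variables (mu1 mu2 : {measure set RR -> \bar R}).
Hypotheses (mu1_fin : (mu1 setT < +oo)%E) (mu2_fin : (mu2 setT < +oo)%E).
Hypothesis mu12 : forall a b (A : set (measurableTypeR R)), measurable A ->
  mu1 (lin_form a b @^-1` A) = mu2 (lin_form a b @^-1` A).

Let base := [set g : RR -> R | exists a b t, g = plane_wave a b t].

Let base_bounded g : base g -> bounded_mfun g.
Proof. by move=> [a [b [t ->]]]; exact: plane_wave_bounded. Qed.

Let good := multiplier mu1 mu2 base.

(** A plane wave depends on one linear form only, and by [mu12] the two measures have the same image
    under it. *)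
Lemma integral_plane_wave a b t :
  (\int[mu1]_x (plane_wave a b t x)%:E = \int[mu2]_x (plane_wave a b t x)%:E)%E.
Proof.
pose f (x : measurableTypeR R) := (cos (x + t))%:E.
have mf : measurable_fun setT f.
  apply/measurable_EFinP; apply: measurableT_comp; first exact: measurable_cos.
  exact: measurable_funD.
have ml : measurable_fun setT (lin_form a b : RR -> measurableTypeR R) := measurable_lin_form a b.
have h (mu : {measure set RR -> \bar R}) : (mu setT < +oo)%E ->
    (\int[mu]_x (plane_wave a b t x)%:E = \int[pushforward mu (lin_form a b : RR -> measurableTypeR R)]_y f y)%E.
  move=> mufin; rewrite (@integral_pushforward _ _ _ _ _ _ ml mu setT f)//=.
  apply: (bounded_mfun_integrable mufin (plane_wave_bounded a b t)).
rewrite !h//; apply: eq_measure_integral => A mA _; exact: mu12.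
Qed.

Let agree1 : agreeing mu1 mu2 base (cst 1).
Proof.
split; first exact: bounded_mfun_cst.
move=> g [a [b [t ->]]] /=; under eq_integral do rewrite mul1r.
by under [RHS]eq_integral do rewrite mul1r; exact: integral_plane_wave.
Qed.

(** By the product-to-sum formula, the product of two plane waves is half the sum of two plane
    waves, to which the agreement applies again. *)
Lemma multiplier_plane_wave a b t : good (plane_wave a b t).
Proof.
split; first exact: plane_wave_bounded.
move=> F hF; have [bF _] := hF.
split; first by apply: bounded_mfunM => //; exact: plane_wave_bounded.
move=> g [a' [b' [t' ->]]] /=.
have [bH hH] := agreeingZ mu1_fin mu2_fin base_bounded (2^-1) hF.
have E x : F x * plane_wave a b t x * plane_wave a' b' t' x =
    2^-1 * F x * plane_wave (a + a') (b + b') (t + t') x +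
    2^-1 * F x * plane_wave (a - a') (b - b') (t - t') x.
  rewrite -mulrDr /plane_wave.
  rewrite (_ : lin_form (a + a') _ _ + _ = (lin_form a b x + t) + (lin_form a' b' x + t')); last by rewrite /lin_form; ring.
  rewrite (_ : lin_form (a - a') _ _ + _ = (lin_form a b x + t) - (lin_form a' b' x + t')); last by rewrite /lin_form; ring.
  move: (lin_form a b x + t) (lin_form a' b' x + t') => p q.
  by rewrite cosD cosB; field.
under eq_integral do rewrite E EFinD.
under [RHS]eq_integral do rewrite E EFinD.
have bint (mu : {measure set RR -> \bar R}) u v w : (mu setT < +oo)%E ->
    mu.-integrable setT (fun x => (2^-1 * F x * plane_wave u v w x)%:E).
  move=> mufin; apply: bounded_mfun_integrable => //.
  by apply: bounded_mfunM => //; exact: plane_wave_bounded.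
rewrite !integralD//; try exact: bint.
by rewrite !hH//; [exists (a - a'), (b - b'), (t - t')|exists (a + a'), (b + b'), (t + t')].
Qed.

Lemma multiplier_sin a b t : good (fun z => sin (lin_form a b z + t)).
Proof.
have := multiplier_plane_wave a b (t - pi / 2); congr good.
by apply/funext => z; rewrite /plane_wave addrA cosBpihalf.
Qed.

(** The iterates of the cubic at a sine are polynomials in a multiplier, bounded by 1, and converge
    to the sign. *)
Lemma multiplier_sg_sin a b t : good (fun z => Num.sg (sin (lin_form a b z + t))).
Proof.
have s1 x : `|sin x : R| <= 1 by rewrite ler_norml sin_geN1 sin_le1.
apply: (multiplier_cvg mu1_fin mu2_fin base_bounded
  (G := fun n z => iter n (@cubic_step R) (sin (lin_form a b z + t))) (M := 1)).
- elim=> [|n IH]; first exact: multiplier_sin.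
  have Z := multiplierZ mu1_fin mu2_fin base_bounded.
  have M := multiplierM (mu1 := mu1) (mu2 := mu2) (base := base).
  have := multiplierD mu1_fin mu2_fin base_bounded (Z (3 / 2) _ IH)
     (Z (- (1 / 2)) _ (M _ _ IH (M _ _ IH IH))).
  congr good; apply/funext => z /=; rewrite [RHS]/cubic_step.
  by move: (iter n _ _) => y; ring.
- by move=> n z; exact: iter_cubic_step_norm.
- by move=> z; exact: iter_cubic_step_cvg_sg.
Qed.

(** For large n the argument lies in (-pi, pi), where the sine has the sign of its argument. This
    removes the periodicity of the waves. *)
Lemma cvg_sg_sin (y : R) : Num.sg (sin (y / n.+1%:R)) @[n --> \oo] --> (Num.sg y : R).
Proof.
have pos z : 0 < z -> \forall n \near \oo, Num.sg (sin (z / n.+1%:R)) = 1 :> R.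
  move=> z0; near=> n; apply: gtr0_sg; apply: sin_gt0_pi; rewrite divr_gt0//=.
  rewrite ltr_pdivrMr//; apply: lt_trans (_ : n.+1%:R < _).
    apply: lt_trans (_ : n%:R < _); last by rewrite ltr_nat.
    by near: n; exact: nbhs_infty_gtr.
  by rewrite -[ltLHS]mul1r ltr_pM2r// (lt_le_trans _ (pi_ge2 R))// ltr1n.
have [y0|y0|->] := ltrgt0P y.
- by rewrite gtr0_sg//; apply: cvg_near_cst; exact: pos.
- rewrite ltr0_sg//; apply: cvg_near_cst.
  have /pos : 0 < - y by rewrite oppr_gt0.
  move=> P; near=> n.
  have : Num.sg (sin (- y / n.+1%:R)) = 1 by near: n; exact: P.
  by rewrite mulNr sinN sgrN => /eqP; rewrite eqr_oppLR => /eqP.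
- rewrite sgr0 (_ : (fun n => _) = cst 0); first exact: cvg_cst.
  by apply/funext => n; rewrite mul0r sin0 sgr0.
Unshelve. all: by end_near. Qed.

Lemma multiplier_sg a b t : good (fun z => Num.sg (lin_form a b z + t)).
Proof.
apply: (multiplier_cvg mu1_fin mu2_fin base_bounded
  (G := fun n z => Num.sg (sin ((lin_form a b z + t) / n.+1%:R))) (M := 1)).
- move=> n; have := multiplier_sg_sin (a / n.+1%:R) (b / n.+1%:R) (t / n.+1%:R).
  congr good; apply/funext => z; congr (Num.sg (sin _)); rewrite /lin_form.
  by rewrite !mulrDl -!(mulrAC _ _ (n.+1%:R^-1)).
- by move=> n z; rewrite normr_sg; case: eqP => //=; rewrite ler01.
- by move=> z; exact: cvg_sg_sin.
Qed.

Lemma multiplier_halfplane a b t :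
  good (\1_[set z : RR | 0 < lin_form a b z + t]).
Proof.
have h := multiplier_sg a b t.
have Z := multiplierZ mu1_fin mu2_fin base_bounded.
(* The indicator of y > 0 is (sg y + (sg y)^2) / 2. *)
have := multiplierD mu1_fin mu2_fin base_bounded (Z (1 / 2) _ h)
     (Z (1 / 2) _ (multiplierM h h)).
congr good; apply/funext => z; rewrite indicE /=.
have [y0|y0|y0] := ltrgt0P (lin_form a b z + t).
- by rewrite mem_set// gtr0_sg//=; lra.
- by rewrite memNset /= ?ltr0_sg//=; [lra|apply/negP; rewrite -leNgt ltW].
- by rewrite memNset /= y0 ?sgr0 ?ltxx//; lra.
Qed.

(* The Cramer-Wold theorem: the bounded functions whose products with cosines
   have equal integrals form an algebra closed under bounded limits, which
   contains the cosines, hence the indicators of half-planes. *)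
Lemma plane_measure_unique A : measurable A -> mu1 A = mu2 A.
Proof.
have base1 : base (cst 1).
  exists 0, 0, 0; apply/funext => z.
  by rewrite /plane_wave /lin_form !mul0r !addr0 cos0.
move=> mA; apply: (@eq_measure_multiplier _ _ _ mu1 mu2 base) => //.
have SA := multiplier_sigma_algebra mu1_fin mu2_fin base_bounded.
set S := [set B | _] in SA.
have proj (p : RR -> R) a b : p = lin_form a b ->
    forall B : set (measurableTypeR R), measurable B -> S (p @^-1` B).
  move=> -> B; rewrite [X in X B -> _]RGenOInfty.measurableE.
  suff : <<s @RGenOInfty.G R >> `<=` [set B | S (lin_form a b @^-1` B)] by apply.
  apply: smallest_sub.
    have [S0 SC SU] := SA; split => /=.
    - by rewrite preimage_set0.
    - by move=> C /SC; rewrite !setTD preimage_setC.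
    - by move=> C hC; rewrite preimage_bigcup; exact: SU.
  move=> _ [x ->] /=; have := multiplier_halfplane a b (- x).
  congr good; congr (\1_ _); apply/seteqP; split => z /=;
    by rewrite in_itv/= andbT subr_gt0.
suff : <<s preimage_set_system setT (fst : RR -> _) measurable `|`
          preimage_set_system setT (snd : RR -> _) measurable >> `<=` S by apply.
apply: smallest_sub => //; rewrite subUset; split => [] _ [B mB <-]; rewrite setTI.
- by apply: (proj _ 1 0) => //; apply/funext => z; rewrite /lin_form mul1r mul0r addr0.
- by apply: (proj _ 0 1) => //; apply/funext => z; rewrite /lin_form mul1r mul0r add0r.
Qed.

End plane_measure.

(** * Events of planar paths *)

Lemma measure_compl (R : realType) d (T : measurableType d)
    (m : {measure set T -> \bar R}) (A : set T) : measurable A ->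
  (m setT < +oo)%E -> m (~` A) = (m setT - m A)%E.
Proof. by move=> mA mT; rewrite -setTD measureD// setTI. Qed.

Section pi_lambda.
Variables (R : realType) (U : Type) (G : set (set U)).
Hypothesis setIG : setI_closed G.

Lemma measurable_preimage_gen d (T : measurableType d) (X : T -> U)
    (H : set (set U)) : (forall E, H E -> measurable (X @^-1` E)) ->
  forall E, <<s H >> E -> measurable (X @^-1` E).
Proof.
move=> mH; suff : <<s H >> `<=` [set E | measurable (X @^-1` E)] by [].
apply: smallest_sub => //; split => /=.
- by rewrite preimage_set0.
- by move=> A mA; rewrite setTD -preimage_setC; exact: measurableC.
- by move=> A mA; rewrite preimage_bigcup; exact: bigcupT_measurable.
Qed.

(** The target U is a bare type, since the path space carries a different sigma-algebra for each
    interval and level. *)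
Lemma eq_measure_pi_lambda d d' (T : measurableType d) (T' : measurableType d')
    (m : {measure set T -> \bar R}) (m' : {measure set T' -> \bar R})
    (X : T -> U) (X' : T' -> U) :
  (forall E, G E -> measurable (X @^-1` E)) ->
  (forall E, G E -> measurable (X' @^-1` E)) ->
  m setT = m' setT -> (m setT < +oo)%E ->
  (forall E, G E -> m (X @^-1` E) = m' (X' @^-1` E)) ->
  forall E, <<s G >> E -> m (X @^-1` E) = m' (X' @^-1` E).
Proof.
move=> mX mX' mm' mfin eqG E GE.
have sX := measurable_preimage_gen mX; have sX' := measurable_preimage_gen mX'.
suff : <<s G >> `<=` [set E | <<s G >> E /\ m (X @^-1` E) = m' (X' @^-1` E)].
  by move/(_ _ GE) => [].
have [s0 sC sU] := smallest_sigma_algebra setT G.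
apply: (lambda_system_subset setIG) => //.
- apply/dynkin_lambda_system; split => /=.
  + by split; [have := sC _ s0; rewrite setD0|rewrite !preimage_setT].
  + move=> A [sA eA]; split; first by rewrite -setTD; exact: sC.
    have mXA : measurable (X @^-1` A) by exact: sX.
    have mXA' : measurable (X' @^-1` A) by exact: sX'.
    have mfin' : (m' setT < +oo)%E by rewrite -mm'.
    by rewrite -!preimage_setC !measure_compl// eA mm'.
  + move=> F tF hF; split; first by apply: sU => n; have [] := hF n.
    have tX V (Y : V -> U) : trivIset setT (fun n => Y @^-1` F n).
      apply/trivIsetP => i k _ _ ik; rewrite -preimage_setI.
      by move/trivIsetP : tF => /(_ _ _ _ _ ik) ->//; rewrite preimage_set0.
    rewrite !preimage_bigcup !measure_bigcup//; first last.
      by move=> i _; apply: sX; have [] := hF i.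
      by move=> i _; apply: sX'; have [] := hF i.
    by apply: eq_eseriesr => n _; have [_] := hF n.
- by move=> A GA; split; [exact: sub_sigma_algebra|exact: eqG].
Qed.

Lemma eq_probability_pi_lambda d d' (T : measurableType d) (T' : measurableType d')
    (P : probability T R) (P' : probability T' R) (X : T -> U) (X' : T' -> U) :
  (forall E, G E -> measurable (X @^-1` E)) ->
  (forall E, G E -> measurable (X' @^-1` E)) ->
  (forall E, G E -> P (X @^-1` E) = P' (X' @^-1` E)) ->
  forall E, <<s G >> E -> P (X @^-1` E) = P' (X' @^-1` E).
Proof.
move=> mX mX'; apply: eq_measure_pi_lambda => //.
  exact: etrans (probability_setT P) (esym (probability_setT P')).
exact: le_lt_trans (probability_le1 P measurableT) (ltry 1).
Qed.

(** As functions of E, the two sides are the restriction of P to F and the multiple of P by the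
    constant P F: two finite measures of equal total mass that agree on the pi-system. *)
Lemma independent_pi_lambda d (T : measurableType d) (P : probability T R)
    (X : T -> U) (F : set T) : measurable F ->
  (forall E, G E -> measurable (X @^-1` E)) ->
  (forall E, G E -> P (X @^-1` E `&` F) = P (X @^-1` E) * P F)%E ->
  forall E, <<s G >> E -> P (X @^-1` E `&` F) = (P (X @^-1` E) * P F)%E.
Proof.
move=> mF mX hG E GE.
have PF0 : 0 <= fine (P F) by rewrite fine_ge0.
have PFE : P F = (fine (P F))%:E by rewrite fineK// fin_num_measure.
pose r : {nonneg R} := NngNum PF0.
have rE : (r%:num)%:E = P F by rewrite PFE.
have PT : P setT = 1%E := probability_setT P.
suff : mrestr P mF (X @^-1` E) = mscale r P (X @^-1` E).
  by rewrite /mrestr /mscale rE [RHS]muleC.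
apply: (eq_measure_pi_lambda mX mX) GE.
- change (P (setT `&` F) = (r%:num)%:E * P setT)%E.
  by rewrite rE setTI PT mule1.
- change (P (setT `&` F) < +oo)%E.
  by rewrite setTI; apply: le_lt_trans (probability_le1 P mF) (ltry _).
- move=> E' GE'.
  change (P (X @^-1` E' `&` F) = (r%:num)%:E * P (X @^-1` E'))%E.
  by rewrite hG// rE muleC.
Qed.

End pi_lambda.

Lemma independent_generated (R : realType) (U : Type) (G1 G2 : set (set U)) d
    (T : measurableType d) (P : probability T R) (X : T -> U) :
  setI_closed G1 -> setI_closed G2 ->
  (forall E, G1 E -> measurable (X @^-1` E)) ->
  (forall E, G2 E -> measurable (X @^-1` E)) ->
  (forall E F, G1 E -> G2 F ->
     P (X @^-1` E `&` X @^-1` F) = P (X @^-1` E) * P (X @^-1` F))%E ->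
  forall E F, <<s G1 >> E -> <<s G2 >> F ->
     P (X @^-1` E `&` X @^-1` F) = (P (X @^-1` E) * P (X @^-1` F))%E.
Proof.
move=> I1 I2 m1 m2 h E F sE sF.
apply: (independent_pi_lambda I1) sE => //.
  exact: (measurable_preimage_gen m2).
move=> E' G1E'; rewrite setIC muleC.
apply: (independent_pi_lambda I2) sF => //; first exact: m1.
by move=> F' G2F'; rewrite setIC muleC; exact: h.
Qed.

Section path_events.
Variable R : realType.
Notation RR := (measurableTypeR R * measurableTypeR R)%type.

Definition planar_path := R -> RR.

Definition dyadic (j i : nat) : R := i%:R / 2 ^+ j.

Lemma dyadicS j i : dyadic j.+1 i.*2 = dyadic j i.
Proof. by rewrite /dyadic exprSr -muln2 natrM -mulf_div divff ?mulr1. Qed.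

Lemma dyadic_nat j i : dyadic j (i * 2 ^ j) = i%:R.
Proof. by rewrite /dyadic natrM natrX mulfK. Qed.

Lemma ler_dyadic j i k : (i <= k)%N -> dyadic j i <= dyadic j k.
Proof. by move=> ik; rewrite /dyadic ler_pM2r ?invr_gt0// ler_nat. Qed.

Definition dyadic_step (j i : nat) (z : planar_path) : RR :=
  z (dyadic j i.+1) - z (dyadic j i).

Definition dyadic_range (j a b : nat) : pred nat :=
  fun i => (a * 2 ^ j <= i < b * 2 ^ j)%N.

Definition dyadic_box (j a b : nat) (A : nat -> set RR) : set planar_path :=
  [set z | forall i, dyadic_range j a b i -> A i (dyadic_step j i z)].

Definition dyadic_boxes (j a b : nat) : set (set planar_path) :=
  [set dyadic_box j a b A | A in [set A | forall i, measurable (A i)]].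

Definition path_level j a b := <<s dyadic_boxes j a b >>.

(* The events depending on the increments between the dyadic times of [a, b]. *)
Definition path_sigma a b := <<s \bigcup_j path_level j a b >>.

Lemma dyadic_boxes_setI j a b : setI_closed (dyadic_boxes j a b).
Proof.
move=> _ _ [A mA <-] [B mB <-]; exists (fun i => A i `&` B i).
  by move=> i; exact: measurableI.
apply/seteqP; split => z /= h; first by split => i /h[].
by move=> i hi; split; [exact: h.1|exact: h.2].
Qed.

Lemma path_level_step j a b i (A : set RR) : dyadic_range j a b i ->
  measurable A -> path_level j a b [set z | A (dyadic_step j i z)].
Proof.
move=> hi mA; apply: sub_sigma_algebra.
exists (fun k => if k == i then A else setT); first by move=> k; case: ifP.
apply/seteqP; split => z /=; first by move=> /(_ i hi); rewrite eqxx.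
by move=> Az k _; case: eqP => // ->.
Qed.

Lemma measurable_addRR d (T : measurableType d) (f g : T -> RR) :
  measurable_fun setT f -> measurable_fun setT g ->
  measurable_fun setT (fun x => f x + g x : RR).
Proof.
move=> /measurable_fun_pairP[f1 f2] /measurable_fun_pairP[g1 g2].
apply/measurable_fun_pairP; split.
  exact: (@measurable_funD _ _ R setT (fst \o f) (fst \o g)).
exact: (@measurable_funD _ _ R setT (snd \o f) (snd \o g)).
Qed.

Lemma measurable_subRR d (T : measurableType d) (f g : T -> RR) :
  measurable_fun setT f -> measurable_fun setT g ->
  measurable_fun setT (fun x => f x - g x : RR).
Proof.
move=> /measurable_fun_pairP[f1 f2] /measurable_fun_pairP[g1 g2].
apply/measurable_fun_pairP; split.
  exact: (@measurable_funB _ _ R setT (fst \o f) (fst \o g)).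
exact: (@measurable_funB _ _ R setT (snd \o f) (snd \o g)).
Qed.

Lemma dyadic_stepS j i z :
  dyadic_step j i z = dyadic_step j.+1 i.*2 z + dyadic_step j.+1 i.*2.+1 z.
Proof.
rewrite /dyadic_step dyadicS -doubleS dyadicS.
by rewrite [RHS]addrC addrA subrK.
Qed.

Lemma path_level_sub1 j a b : path_level j a b `<=` path_level j.+1 a b.
Proof.
apply: smallest_sub; first exact: smallest_sigma_algebra.
move=> _ [A mA <-].
pose T := g_sigma_algebraType (dyadic_boxes j.+1 a b).
have mstep i : dyadic_range j.+1 a b i ->
    measurable_fun setT (dyadic_step j.+1 i : T -> RR).
  by move=> hi _ B mB; rewrite setTI; exact: path_level_step.
have -> : dyadic_box j a b A = \bigcap_i
    [set z | dyadic_range j a b i -> A i (dyadic_step j i z)].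
  by apply/seteqP; split => z /= h i; [move=> _; exact: h|exact: h].
apply: (@bigcapT_measurable _ T) => i.
have [hi|/negP hi] := boolP (dyadic_range j a b i); last first.
  by rewrite (_ : [set _ | _] = setT)//; apply/seteqP; split => z.
have [h1 h2] : dyadic_range j.+1 a b i.*2 /\ dyadic_range j.+1 a b i.*2.+1.
  by move: hi; rewrite /dyadic_range !expnS; lia.
have := measurable_addRR (mstep _ h1) (mstep _ h2).
move=> /(_ measurableT _ (mA i)); rewrite setTI; congr measurable.
by apply/seteqP; split => z /=; [rewrite -dyadic_stepS|move=> /(_ isT); rewrite dyadic_stepS].
Qed.

Lemma path_level_sub j k a b : (j <= k)%N ->
  path_level j a b `<=` path_level k a b.
Proof.
move=> /subnK <-; elim: (k - j)%N => [//|n IH].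
by apply: (subset_trans IH); rewrite addSn; exact: path_level_sub1.
Qed.

(** The levels are nested, so their union is a pi-system generating [path_sigma]. *)
Lemma path_levels_setI a b : setI_closed (\bigcup_j path_level j a b).
Proof.
move=> E F [j _ hE] [k _ hF]; exists (maxn j k) => //.
have hE' := path_level_sub (leq_maxl j k) hE.
have hF' := path_level_sub (leq_maxr j k) hF.
exact: (@measurableI _ (g_sigma_algebraType (dyadic_boxes (maxn j k) a b))).
Qed.

Lemma path_sigma_level j a b E : path_level j a b E -> path_sigma a b E.
Proof. by move=> hE; apply: sub_sigma_algebra; exists j. Qed.

Lemma path_sigma_sub a b a' b' : (a' <= a)%N -> (b <= b')%N ->
  path_sigma a b `<=` path_sigma a' b'.
Proof.
move=> ha hb; apply: smallest_sub; first exact: smallest_sigma_algebra.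
move=> E [j _ jE]; apply: (path_sigma_level (j := j)); move: E jE.
apply: smallest_sub; first exact: smallest_sigma_algebra.
move=> _ [A mA <-]; apply: sub_sigma_algebra.
exists (fun i => if dyadic_range j a b i then A i else setT).
  by move=> i; case: ifP.
apply/seteqP; split => z /= h i hi; last by case: ifP => // /h.
have := h i; rewrite hi; apply; move: hi; rewrite /dyadic_range => /andP[h1 h2].
by rewrite (leq_trans _ h1) ?(leq_trans h2)// leq_mul2r ?ha ?hb orbT.
Qed.

(** The path space with [path_sigma a b] as its measurable sets, so that the closure properties of
    measurable sets and functions apply to events. *)
Definition path_type a b := g_sigma_algebraType (\bigcup_j path_level j a b).

Lemma measurable_dyadic_diff a b j k i l : (a * 2 ^ j <= i <= b * 2 ^ j)%N ->
  (a * 2 ^ k <= l <= b * 2 ^ k)%N ->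
  measurable_fun setT (fun z : path_type a b => z (dyadic j i) - z (dyadic k l) : RR).
Proof.
have base j' i' : (a * 2 ^ j' <= i' <= b * 2 ^ j')%N ->
    measurable_fun setT (fun z : path_type a b => z (dyadic j' i') - z a%:R : RR).
  move=> /andP[/subnK <-]; elim: (i' - _)%N => [|n IH] hn.
    rewrite add0n dyadic_nat (_ : (fun _ => _) = cst 0)//.
    by apply/funext => z; rewrite subrr.
  rewrite (_ : (fun _ => _) = fun z : path_type a b =>
     dyadic_step j' (n + a * 2 ^ j') z + (z (dyadic j' (n + a * 2 ^ j')) - z a%:R)).
    apply: measurable_addRR; last by apply: IH; exact: ltnW.
    move=> _ B mB; rewrite setTI; apply: (path_sigma_level (j := j')).
    by apply: path_level_step => //; rewrite /dyadic_range leq_addl.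
  by apply/funext => z; rewrite /dyadic_step addSn addrA subrK.
move=> /base h1 /base h2; have := measurable_subRR h1 h2; congr measurable_fun.
by apply/funext => z; rewrite opprB addrA subrK.
Qed.

End path_events.

(** * The law of the Brownian path *)

Section brownian_paths.
Variable R : realType.
Notation RR := (measurableTypeR R * measurableTypeR R)%type.
Variables gamma alpha : R.

Lemma continuous_path1 (z : R -> R * R) :
  continuous z -> continuous (fun t => (z t).1).
Proof. by move=> cz t; apply: (cvg_comp _ _ (cz t)); exact: cvg_fst. Qed.

Lemma continuous_path2 (z : R -> R * R) :
  continuous z -> continuous (fun t => (z t).2).
Proof. by move=> cz t; apply: (cvg_comp _ _ (cz t)); exact: cvg_snd. Qed.

Lemma continuous_pair (f g : R -> R) :
  continuous f -> continuous g -> continuous (fun t => (f t, g t)).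
Proof.
move=> cf cg t.
apply: (@cvg_pair _ _ _ (nbhs t) (nbhs (f t)) (nbhs (g t))); [exact: cf|exact: cg].
Qed.

Definition pair_scale (k : R) (z : RR) : RR := (k * z.1, k * z.2).

Lemma measurable_pair_scale k : measurable_fun [set: RR] (pair_scale k).
Proof.
by apply: measurable_fun_pair; apply: measurable_funM.
Qed.

Section one.
Context d (T : measurableType d) (P : probability T R) (Z : R -> T -> R * R).
Hypothesis bmZ : mated_crt_brownian_motion gamma alpha P Z.

Lemma bm_measurable_increment s t :
  measurable_fun setT (increment Z s t : T -> RR).
Proof. by apply: measurable_subRR; exact: bm_measurable bmZ _. Qed.

Lemma bm_measurable_box j a b E : dyadic_boxes j a b E ->
  measurable ((fun w => Z ^~ w : planar_path R) @^-1` E).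
Proof.
move=> [A mA <-].
rewrite (_ : _ @^-1` _ = \bigcap_i [set w | dyadic_range j a b i ->
    A i (increment Z (dyadic R j i) (dyadic R j i.+1) w)]).
  apply: bigcapT_measurable => i.
  have [hi|/negP hi] := boolP (dyadic_range j a b i); last first.
    by rewrite (_ : [set _ | _] = setT)//; apply/seteqP; split => z.
  have := bm_measurable_increment (dyadic R j i) (dyadic R j i.+1) measurableT (mA i).
  rewrite setTI; congr measurable.
  by apply/seteqP; split => w //=; exact.
by apply/seteqP; split => w /= h i; [move=> _; exact: h|exact: h].
Qed.

Lemma bm_measurable_level j a b E : path_level j a b E ->
  measurable ((fun w => Z ^~ w : planar_path R) @^-1` E).
Proof. by apply: measurable_preimage_gen => F; exact: bm_measurable_box. Qed.

Lemma bm_measurable_event a b E : path_sigma a b E ->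
  measurable ((fun w => Z ^~ w : planar_path R) @^-1` E).
Proof.
apply: measurable_preimage_gen => F [j _]; exact: bm_measurable_level.
Qed.

Lemma bm_box j a b (A : nat -> set RR) : (forall i, measurable (A i)) ->
  P ((fun w => Z ^~ w : planar_path R) @^-1` dyadic_box j a b A) =
  (\prod_(a * 2 ^ j <= i < b * 2 ^ j)
     P [set w | A i (increment Z (dyadic R j i) (dyadic R j i.+1) w)])%E.
Proof.
move=> mA; set n := (b * 2 ^ j - a * 2 ^ j)%N.
have /(_ n (fun i => dyadic R j (a * 2 ^ j + i)%N) (fun i => A (a * 2 ^ j + i)%N)) :=
  bm_independent bmZ.
move=> /(_ _ (fun i => mA _)); rewrite -/n => h.
rewrite -[X in (\prod_(X <= _ < _) _)%E]add0n big_addn big_mkord -/n.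
transitivity (\prod_(i < n) P [set w | A (a * 2 ^ j + i)%N
  (increment Z (dyadic R j (a * 2 ^ j + i)) (dyadic R j (a * 2 ^ j + i.+1)) w)])%E; last first.
  by apply: eq_bigr => i _; rewrite addnS addnC.
rewrite -h; last by move=> i; apply: ler_dyadic; rewrite leq_add2l.
congr (P _); apply/seteqP; split => w /=.
  by move=> h' i ilt; rewrite addnS; apply: h'; rewrite /dyadic_range leq_addr/= -ltn_subRL.
move=> h' i /andP[ai ib].
have := h' (i - a * 2 ^ j)%N; rewrite /= addnS subnKC//; apply.
by rewrite ltn_sub2r// (leq_ltn_trans ai).
Qed.

Lemma bm_independent_events a b c E F : (a <= b <= c)%N ->
  path_sigma a b E -> path_sigma b c F ->
  (P ((fun w => Z ^~ w : planar_path R) @^-1` E `&` (fun w => Z ^~ w : planar_path R) @^-1` F) =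
   P ((fun w => Z ^~ w : planar_path R) @^-1` E) * P ((fun w => Z ^~ w : planar_path R) @^-1` F))%E.
Proof.
move=> /andP[ab bc]; apply: independent_generated.
- exact: path_levels_setI.
- exact: path_levels_setI.
- by move=> G [j _]; exact: bm_measurable_level.
- by move=> G [j _]; exact: bm_measurable_level.
move=> {}E {}F [j _ hE] [k _ hF].
have {}hE := path_level_sub (leq_maxl j k) hE.
have {}hF := path_level_sub (leq_maxr j k) hF.
move: {j k} (maxn j k) hE hF => j; apply: independent_generated.
- exact: dyadic_boxes_setI.
- exact: dyadic_boxes_setI.
- by move=> G; exact: bm_measurable_box.
- by move=> G; exact: bm_measurable_box.
move=> _ _ [A mA <-] [B mB <-].
(* Boxes over the adjacent intervals [a, b] and [b, c] glue to a single box over [a, c], whose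
   probability is a product over the increments. *)
pose C i := if (i < b * 2 ^ j)%N then A i else B i.
have ab' : (a * 2 ^ j <= b * 2 ^ j)%N by rewrite leq_mul2r ab orbT.
have bc' : (b * 2 ^ j <= c * 2 ^ j)%N by rewrite leq_mul2r bc orbT.
rewrite -preimage_setI.
rewrite (_ : _ `&` _ = dyadic_box j a c C); last first.
  apply/seteqP; split => z /=.
    move=> [h1 h2] i /andP[ai ic]; rewrite /C; case: ltnP => ib.
      by apply: h1; rewrite /dyadic_range ai.
    by apply: h2; rewrite /dyadic_range ib.
  move=> h; split => i /andP[ai ib].
    by have := h i; rewrite /C ib; apply; rewrite /dyadic_range ai (leq_trans ib).
  have := h i; rewrite /C ltnNge ai /=; apply.
  by rewrite /dyadic_range (leq_trans ab' ai).
rewrite !bm_box//; last by move=> i; rewrite /C; case: ifP.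
rewrite (big_cat_nat ab' bc')/=; congr (_ * _)%E; apply: eq_big_nat => i /andP[h1 h2].
  by rewrite /C h2.
by rewrite /C ltnNge h1.
Qed.

(** Treats at once the time shift, the normalisation of alpha and Brownian scaling, which is the
    case k^2 c = 1. *)
Lemma bm_affine (t0 c k : R) : 0 < c ->
  mated_crt_brownian_motion gamma (k ^+ 2 * c * alpha) P
    (fun t w => pair_scale k (increment Z t0 (t0 + c * t) w)).
Proof.
move=> c0.
have incE s t w : increment (fun t w => pair_scale k (increment Z t0 (t0 + c * t) w)) s t w
    = pair_scale k (increment Z (t0 + c * s) (t0 + c * t) w).
  rewrite /increment /pair_scale /=; congr (_, _); rewrite /=; ring.
have le_aff s t : s <= t -> t0 + c * s <= t0 + c * t.
  by move=> st; rewrite lerD2l ler_pM2l.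
split.
- move=> t; apply: measurableT_comp; first exact: measurable_pair_scale.
  exact: bm_measurable_increment.
- move=> w; rewrite mulr0 addr0 /increment subrr /pair_scale /= !mulr0.
  by [].
- move=> w; rewrite /increment /pair_scale /=.
  have cZ : continuous (fun s => Z (t0 + c * s) w).
    move=> t; apply: (@continuous_comp _ _ _ (fun s => t0 + c * s) (fun s => Z s w));
      last exact: (bm_continuous bmZ).
    by apply: cvgD; [exact: cvg_cst|apply: cvgM; [exact: cvg_cst|exact: cvg_id]].
  apply: continuous_pair => t; apply: cvgM; try exact: cvg_cst.
    by apply: cvgB; [exact: continuous_path1 cZ t|exact: cvg_cst].
  by apply: cvgB; [exact: continuous_path2 cZ t|exact: cvg_cst].
- move=> n t A tle mA.
  have /(_ n (fun i => t0 + c * t i) (fun i => pair_scale k @^-1` A i)) :=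
    bm_independent bmZ.
  move=> /(_ (fun i => le_aff _ _ (tle i))) => h.
  transitivity (P (\bigcap_(i < n) [set w | (pair_scale k @^-1` A i)
     (increment Z (t0 + c * t i) (t0 + c * t i.+1) w)])).
    by congr (P _); apply: eq_bigcapr => i _; apply/funext => w; rewrite /mkset incE.
  rewrite h; last by move=> i; rewrite -[_ @^-1` _]setTI; exact: measurable_pair_scale.
  by apply: eq_bigr => i _; congr (P _); apply/funext => w; rewrite /mkset incE.
- move=> s t st a b A mA.
  have /(_ (a * k) (b * k) A mA) := bm_gaussian bmZ (le_aff _ _ st).
  rewrite (_ : t0 + c * t - _ = c * (t - s)); last by ring.
  move=> h; transitivity (P [set w | A (a * k * (increment Z (t0 + c * s) (t0 + c * t) w).1 +
      b * k * (increment Z (t0 + c * s) (t0 + c * t) w).2)]).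
    congr (P _); apply/funext => w; rewrite /mkset incE /pair_scale /=; congr A; ring.
  by rewrite h; congr (centered_normal _ _); ring.
Qed.

(** Combined with [bm_affine] this gives time reversal about an arbitrary time. *)
Lemma bm_opp : mated_crt_brownian_motion gamma alpha P (fun t w => Z (- t) w).
Proof.
have incE s t w : increment (fun t w => Z (- t) w) s t w = - increment Z (- t) (- s) w.
  by rewrite /increment opprB.
split.
- by move=> t; exact: bm_measurable bmZ _.
- by move=> w; rewrite oppr0; exact: bm_start bmZ _.
- move=> w t; apply: (@continuous_comp _ _ _ -%R (fun s => Z s w));
    last exact: (bm_continuous bmZ).
  exact: opp_continuous.
- move=> n t A tle mA.
  have mN (B : set RR) : measurable B -> measurable (-%R @^-1` B : set RR).
    move=> mB; rewrite -[_ @^-1` _]setTI; move: B mB; rewrite -/(measurable_fun _ _).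
    have -> : (-%R : RR -> RR) = pair_scale (-1).
      by apply/funext => -[x y]; rewrite /pair_scale /= !mulN1r.
    exact: measurable_pair_scale.
  have /(_ n (fun i => - t (n - i)%N) (fun i => -%R @^-1` A (n - i.+1)%N)) :=
    bm_independent bmZ.
  (* Truncated subtraction makes the reversed times constant from index n on, so they are monotone
     over all indices. *)
  have tle' i : - t (n - i)%N <= - t (n - i.+1)%N.
    rewrite lerN2; have [ni|ni] := leqP n i.
      by rewrite (eqP ni) (eqP (leqW ni)).
    by rewrite -[in leRHS](subnSK ni).
  move=> /(_ tle' (fun i => mN _ (mA _))) h.
  transitivity (P (\bigcap_(i < n) [set w | (-%R @^-1` A (n - i.+1)%N)
     (increment Z (- t (n - i)%N) (- t (n - i.+1)%N) w)])).
    congr (P _); apply/seteqP; split => w hw i ilt.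
      have := hw (n - i.+1)%N; rewrite /mkset incE subnSK//; apply.
      by move: ilt => /=; lia.
    have := hw (n - i.+1)%N; rewrite /mkset incE.
    have -> : (n - (n - i.+1).+1 = i)%N by move: ilt => /=; lia.
    have -> : (n - (n - i.+1) = i.+1)%N by move: ilt => /=; lia.
    by apply; move: ilt => /=; lia.
  rewrite h (reindex_inj rev_ord_inj); apply: eq_bigr => /= i _.
  congr (P _); apply/funext => w; rewrite /mkset incE.
  have -> : (n - (n - i.+1).+1 = i)%N by have := ltn_ord i; lia.
  by have -> : (n - (n - i.+1) = i.+1)%N by have := ltn_ord i; lia.
- move=> s t st a b A mA.
  have st' : - t <= - s by rewrite lerN2.
  have /(_ (- a) (- b) A mA) := bm_gaussian bmZ st'.
  rewrite opprK (addrC (- s)) => h.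
  transitivity (P [set w | A (- a * (increment Z (- t) (- s) w).1 +
      - b * (increment Z (- t) (- s) w).2)]).
    congr (P _); apply/funext => w; rewrite /mkset incE /=; congr A; ring.
  by rewrite h; congr (centered_normal _ _); ring.
Qed.

End one.

Section two.
Context d d' (T : measurableType d) (T' : measurableType d').
Variables (P : probability T R) (P' : probability T' R).
Variables (Z : R -> T -> R * R) (Z' : R -> T' -> R * R).
Hypothesis bmZ : mated_crt_brownian_motion gamma alpha P Z.
Hypothesis bmZ' : mated_crt_brownian_motion gamma alpha P' Z'.

Lemma bm_increment_law s t s' t' (A : set RR) : s <= t -> s' <= t' ->
  t - s = t' - s' -> measurable A ->
  P [set w | A (increment Z s t w)] = P' [set w | A (increment Z' s' t' w)].
Proof.
move=> st st' e mA.
have mX := bm_measurable_increment bmZ s t.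
have mX' := bm_measurable_increment bmZ' s' t'.
apply: (@plane_measure_unique _ (pushforward P (increment Z s t : T -> RR))
  (pushforward P' (increment Z' s' t' : T' -> RR))) => //.
- exact: le_lt_trans (probability_le1 P measurableT) (ltry 1).
- exact: le_lt_trans (probability_le1 P' measurableT) (ltry 1).
- move=> a b B mB.
  have h := bm_gaussian bmZ st a b mB.
  have h' := bm_gaussian bmZ' st' a b mB.
  by rewrite e in h; exact: etrans h (esym h').
Qed.

(** Two passes of the pi-lambda argument: from boxes to a dyadic level, and from the union of the
    levels to [path_sigma]. *)
Lemma bm_law a b E : path_sigma a b E ->
  P ((fun w => Z ^~ w : planar_path R) @^-1` E) =
  P' ((fun w => Z' ^~ w : planar_path R) @^-1` E).
Proof.
apply: eq_probability_pi_lambda.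
- exact: path_levels_setI.
- by move=> F [j _]; exact: (bm_measurable_level bmZ).
- by move=> F [j _]; exact: (bm_measurable_level bmZ').
move=> {}E [j _]; apply: eq_probability_pi_lambda.
- exact: dyadic_boxes_setI.
- by move=> F; exact: (bm_measurable_box bmZ).
- by move=> F; exact: (bm_measurable_box bmZ').
move=> _ [A mA <-]; rewrite !bm_box//; apply: eq_bigr => i _.
by apply: bm_increment_law => //; exact: ler_dyadic.
Qed.

End two.
End brownian_paths.

(** * Distances in the graph of the blocks of a path *)

Section block_graph.
Local Open Scope nat_scope.
Variables c1 c2 : rel nat.

(* [c i k] compares the infima over the [i]th and [k]th blocks of one
   coordinate of the path. *)
Definition block_dominated (c : rel nat) (i j : nat) : bool :=
  all (fun k => c i k && c j k) (index_iota i.+1 j).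

Definition block_lt_adj (i j : nat) : bool :=
  (i < j) && (block_dominated c1 i j || block_dominated c2 i j).

Definition block_adj : rel nat :=
  fun i j => block_lt_adj i j || block_lt_adj j i.

(** Walks of at most n steps whose vertices after x lie in [a, b); x itself is not constrained.
    Being boolean and finite, it yields events that are finite combinations of block comparisons. *)
Fixpoint reach (a b n x y : nat) : bool :=
  (x == y) || (if n is n'.+1 then
    has (fun z => block_adj x z && reach a b n' z y) (index_iota a b) else false).

Definition diam_le (a b n : nat) : bool :=
  all (fun x => all (reach a b n x) (index_iota a b)) (index_iota a b).

Lemma block_adjC x y : block_adj x y = block_adj y x.
Proof. by rewrite /block_adj orbC. Qed.

Lemma block_adjS x : block_adj x x.+1.
Proof.
by rewrite /block_adj /block_lt_adj ltnSn /block_dominated /index_iota subnn.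
Qed.

Lemma reach_refl a b n x : reach a b n x x.
Proof. by case: n => [|n] /=; rewrite eqxx. Qed.

Lemma reachS a b n x z y : a <= z < b -> block_adj x z -> reach a b n z y ->
  reach a b n.+1 x y.
Proof.
move=> hz xz zy /=; apply/orP; right; apply/hasP; exists z.
  by rewrite mem_index_iota.
by rewrite xz zy.
Qed.

Lemma reachP a b n x y : reach a b n x y ->
  x = y \/ exists2 z, a <= z < b /\ block_adj x z &
    exists2 n', n = n'.+1 & reach a b n' z y.
Proof.
case: n => [|n] /=; first by rewrite orbF => /eqP; left.
case/orP => [/eqP|/hasP[z]]; first by left.
by rewrite mem_index_iota => hz /andP[xz zy]; right; exists z => //; exists n.
Qed.

Lemma reach_leq a b m n x y : m <= n -> reach a b m x y -> reach a b n x y.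
Proof.
elim: m n x => [|m IH] [|n] x mn /reachP[->|[z [hz xz] [n' //]]];
  try exact: reach_refl.
by move=> [<-] zy; apply: (reachS hz xz); exact: IH.
Qed.

Lemma reach_sub a b a' b' n x y : a' <= a -> b <= b' ->
  reach a b n x y -> reach a' b' n x y.
Proof.
move=> ha hb; elim: n x => [|n IH] x /reachP[->|[z [hz xz] [n' //]]];
  try exact: reach_refl.
move=> [<-] zy; apply: (reachS _ xz); last exact: IH.
by case/andP: hz => h1 h2; rewrite (leq_trans ha h1) (leq_trans h2).
Qed.

Lemma reach_trans a b n1 n2 x y z :
  reach a b n1 x y -> reach a b n2 y z -> reach a b (n1 + n2) x z.
Proof.
move=> + yz; elim: n1 x => [|n1 IH] x /reachP[->|[u [hu xu] [n' //]]].
- by [].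
- by apply: reach_leq yz; rewrite leq_addl.
- by move=> [<-] uy; rewrite addSn; apply: (reachS hu xu); exact: IH.
Qed.

Lemma reach_sym a b n x y : a <= x < b -> reach a b n x y -> reach a b n y x.
Proof.
elim: n x => [|n IH] x hx /reachP[->|[z [hz xz] [n' //]]]; try exact: reach_refl.
move=> [<-] zy; rewrite -addn1; apply: (reach_trans (IH _ hz zy)).
by apply: (reachS hx); [rewrite block_adjC|exact: reach_refl].
Qed.

Lemma reach_line a b x k : a <= x -> x + k < b -> reach a b k x (x + k).
Proof.
elim: k x => [|k IH] x ax xb; first by rewrite addn0 reach_refl.
apply: (reachS (z := x.+1)); [by rewrite leqW//=; lia|exact: block_adjS|].
by rewrite -addSnnS; apply: IH; lia.
Qed.

Lemma diam_leP a b n : reflect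
  (forall x y, a <= x < b -> a <= y < b -> reach a b n x y) (diam_le a b n).
Proof.
apply: (iffP allP) => [h x y hx hy|h x].
  have := h x; rewrite mem_index_iota hx => /(_ isT)/allP/(_ y).
  by rewrite mem_index_iota hy; exact.
rewrite mem_index_iota => hx; apply/allP => y; rewrite mem_index_iota.
exact: h.
Qed.

Lemma diam_le_wlog a b n :
  (forall x y, a <= x -> x <= y -> y < b -> reach a b n x y) -> diam_le a b n.
Proof.
move=> h; apply/diam_leP => x y /andP[x1 x2] /andP[y1 y2].
have [xy|/ltnW yx] := leqP x y; first exact: h.
by apply: reach_sym; [rewrite y1|exact: h].
Qed.

Lemma diam_le_leq a b m n : m <= n -> diam_le a b m -> diam_le a b n.
Proof.
by move=> mn /diam_leP h; apply/diam_leP => x y hx hy; apply: reach_leq (h _ _ hx hy).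
Qed.

Lemma diam_le_length a b n : b <= a + n -> diam_le a b n.
Proof.
move=> ban; apply: diam_le_wlog => x y ax xy yb.
rewrite -(subnKC xy); apply: reach_leq (reach_line _ _) => //.
  by lia.
by rewrite subnKC.
Qed.

Lemma diam_le_cat a b c m n : a <= b <= c ->
  diam_le a b m -> diam_le b c n -> diam_le a c (m + n).+1.
Proof.
move=> /andP[ab bc] /diam_leP h1 /diam_leP h2.
apply: diam_le_wlog => x y ax xy yc.
have [yb|by_] := ltnP y b.
  apply: (@reach_leq _ _ m); first by lia.
  by apply: (reach_sub (leqnn a) bc); apply: h1; lia.
have [xb|bx] := ltnP x b; last first.
  apply: (@reach_leq _ _ n); first by lia.
  by apply: (reach_sub ab (leqnn c)); apply: h2; lia.
(* The extra step is the edge from b - 1 to b, which is always present. *)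
rewrite -addnS; apply: (@reach_trans _ _ _ _ _ b.-1).
  by apply: (reach_sub (leqnn a) bc); apply: h1; lia.
have b0 : 0 < b by lia.
apply: (@reachS _ _ _ _ b); first by lia.
  by rewrite -{2}(prednK b0) block_adjS.
by apply: (reach_sub ab (leqnn c)); apply: h2; lia.
Qed.

Lemma diam_le_bigcat (e d : nat -> nat) m : (forall i, e i <= e i.+1) ->
  (forall i, i < m -> diam_le (e i) (e i.+1) (d i)) ->
  diam_le (e 0) (e m) (\sum_(i < m) (d i).+1).
Proof.
move=> emon; have e0 k : e 0 <= e k by elim: k => // k /leq_trans; apply.
elim: m => [|m IH] h.
  by rewrite big_ord0; apply: diam_le_length; rewrite addn0.
rewrite big_ord_recr /= addnS; apply: (@diam_le_cat _ (e m)).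
- by rewrite e0 emon.
- by apply: IH => i im; apply: h; exact: ltnW.
- exact: h.
Qed.

(* A walk from the left of [a, b) to its right stays in [a, b) between its last
   visit to the left and the next visit to the right, and [a, b) can only be
   entered from the left, or left to the right, through a window of width w. *)
Lemma reach_pinched N a b w n d1 d2 x y : a + w <= b -> b <= N ->
  (forall u v, u < a -> a + w <= v -> ~~ block_adj u v) ->
  (forall u v, u < b - w -> b <= v < N -> ~~ block_adj u v) ->
  diam_le a (a + w) d1 -> diam_le (b - w) b d2 ->
  x < a -> b <= y -> reach 0 N n x y -> reach a b (n + d1 + d2) a b.-1.
Proof.
move=> awb bN Hl Hr /diam_leP D1 /diam_leP D2 xa hby.
(* One claim for walks that start to the left of [a, b), one for walks that start inside. An inside
   walk either crosses to the right directly, or returns to the left, where the first claim takes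
   over; this is the second alternative. *)
suff H : forall n, (forall x, x < a -> reach 0 N n x y ->
      reach a b (n + d1 + d2) a b.-1) /\
    (forall x, a <= x < b -> reach 0 N n x y ->
      reach a b (n + d2) x b.-1 \/ reach a b (n + d1 + d2) a b.-1).
  by have [H1 _] := H n; exact: H1.
move=> {n x xa}; elim=> [|n [IH1 IH2]].
  split => x hx /reachP[xy|[z _ [//]]]; first by lia.
  by lia.
have weak : reach a b (n + d1 + d2) a b.-1 -> reach a b (n.+1 + d1 + d2) a b.-1.
  by apply: reach_leq; lia.
split => x hx /reachP[xy|[z [hz xz] [n' [<-] zy]]]; try lia.
  have [za|az] := ltnP z a; first exact/weak/(IH1 z).
  have zaw : z < a + w.
    by rewrite ltnNge; apply/negP => /(Hl _ _ hx); rewrite xz.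
  have hz' : a <= z < b by rewrite az (leq_trans zaw).
  have [zb|] := IH2 _ hz' zy; last exact: weak.
  apply: (@reach_leq _ _ (d1 + (n + d2))); first by lia.
  apply: reach_trans zb; apply: (@reach_sub a (a + w)) => //.
  by apply: D1; lia.
have [za|az] := ltnP z a; first by right; apply/weak/(IH1 z).
have [zb|bz] := ltnP z b.
  have hz' : a <= z < b by rewrite az.
  have [zb'|] := IH2 _ hz' zy; last by right; exact: weak.
  by left; rewrite addSn; apply: reachS zb'.
have xbw : b - w <= x.
  rewrite leqNgt; apply/negP => xlt.
  by have := Hr x z xlt; rewrite bz xz => /(_ (andP hz).2).
left; apply: (@reach_leq _ _ d2); first by lia.
by apply: (@reach_sub (b - w) b); [lia|lia|apply: D2; lia].
Qed.

(** An edge can come from either coordinate, so each needs its own obstructing block between u and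
    v. *)
Lemma block_adj_cut u v k1 k2 : u < k1 < v -> u < k2 < v ->
  ~~ (c1 u k1 && c1 v k1) -> ~~ (c2 u k2 && c2 v k2) -> ~~ block_adj u v.
Proof.
move=> h1 h2 n1 n2; have uv : u < v by lia.
rewrite /block_adj /block_lt_adj uv ltnNge (ltnW uv) /= orbF negb_or.
apply/andP; split; apply/negP => /allP.
  by move=> /(_ k1); rewrite mem_index_iota h1 => /(_ isT) h; rewrite h in n1.
by move=> /(_ k2); rewrite mem_index_iota h2 => /(_ isT) h; rewrite h in n2.
Qed.

End block_graph.

Section block_graph_shift.
Local Open Scope nat_scope.
Variables (c1 c2 : rel nat) (s : nat).

Definition shift_rel (c : rel nat) : rel nat := fun i k => c (s + i) (s + k).

Lemma index_iota_shift a b : index_iota (s + a) (s + b) = map (addn s) (index_iota a b).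
Proof. by rewrite /index_iota subnDl iotaDl. Qed.

Lemma block_dominated_shift c i j :
  block_dominated (shift_rel c) i j = block_dominated c (s + i) (s + j).
Proof. by rewrite /block_dominated -addnS index_iota_shift all_map. Qed.

Lemma block_adj_shift i j : block_adj (shift_rel c1) (shift_rel c2) i j =
  block_adj c1 c2 (s + i) (s + j).
Proof. by rewrite /block_adj /block_lt_adj !block_dominated_shift !ltn_add2l. Qed.

Lemma reach_shift a b n x y : reach (shift_rel c1) (shift_rel c2) a b n x y =
  reach c1 c2 (s + a) (s + b) n (s + x) (s + y).
Proof.
elim: n x => [|n IH] x /=; first by rewrite eqn_add2l.
rewrite eqn_add2l index_iota_shift has_map; congr (_ || _).
by apply: eq_has => z /=; rewrite block_adj_shift IH.
Qed.

End block_graph_shift.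

(** * Comparison of infima through dyadic times *)

Section infima.
Variable R : realType.
Implicit Types f : R -> R.

(** The epsilon form of comparing the infima over [a, b] and [c, d], which survives the restriction
    to dyadic times. *)
Definition approx_below f (a b c d : R) := forall x e : R, c <= x <= d -> 0 < e ->
  exists2 y, a <= y <= b & f y < f x + e.

Lemma inf_on_lb f (a b x : R) : continuous f -> a <= x <= b -> inf_on f a b <= f x.
Proof.
move=> cf /andP[ax xb]; have ab : a <= b by exact: le_trans xb.
apply: ge_inf; last by exists x => //=; rewrite in_itv/= ax.
have [|c _ hc] := @EVT_min R f a b ab; first exact: continuous_subspaceT.
by exists (f c) => _ [y yab <-]; exact: hc.
Qed.

Lemma inf_on_le f (a b c d : R) : continuous f -> a <= b -> c <= d ->
  inf_on f a b <= inf_on f c d <-> approx_below f a b c d.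
Proof.
move=> cf ab cd; split.
  move=> h x e xcd e0.
  have : inf_on f a b < f x + e.
    by apply: le_lt_trans h _; rewrite (le_lt_trans (inf_on_lb cf xcd))// ltrDl.
  case/inf_lt; first by exists (f a), a => //=; rewrite in_itv/= lexx.
  by move=> _ [y yab <-] fy; exists y => //; move: yab; rewrite /= in_itv.
move=> h; apply: lb_le_inf; first by exists (f c), c => //=; rewrite in_itv/= lexx.
move=> _ [x /= + <-]; rewrite in_itv/= => xcd; rewrite leNgt; apply/negP => fx.
have [|y yab] := h x (inf_on f a b - f x) xcd; first by rewrite subr_gt0.
by rewrite subrKC ltNge inf_on_lb.
Qed.

Lemma dyadic_near f (a b : nat) (x c : R) : continuous f -> a%:R <= x <= b%:R ->
  f x < c -> exists j l, (a * 2 ^ j <= l <= b * 2 ^ j)%N /\ f (dyadic R j l) < c.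
Proof.
move=> cf /andP[ax xb] fx.
have x0 : 0 <= x by apply: le_trans ax.
have /nbhs_ballP[r /= r0 hr] : nbhs x [set y | f y < c].
  exact: (cf x _ (lt_nbhsl fx)).
have [j hj] : exists j : nat, (2 ^+ j)^-1 < r.
  have [n hn] : exists n : nat, r^-1 < n%:R.
    by exists (Num.truncn r^-1).+1; exact: truncnS_gt.
  exists n; rewrite invf_plt ?posrE// (lt_le_trans hn)//.
  by rewrite -natrX ler_nat ltnW// ltn_expl.
have p0 : 0 < 2 ^+ j :> R by [].
(* Rounding x down at level j does not leave [a, b], because the integer a is itself dyadic. *)
have := truncn_itv (mulr_ge0 x0 (ltW p0)).
set l := Num.truncn _ => /andP[l1 l2].
exists j, l; split.
  apply/andP; split.
    rewrite -ltnS -(ltr_nat R) (le_lt_trans _ l2)//.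
    by rewrite natrM natrX ler_pM2r.
  by rewrite -(ler_nat R) (le_trans l1)// natrM natrX ler_pM2r.
apply: hr; rewrite /ball/= /dyadic; apply: le_lt_trans hj.
have l1' : l%:R / 2 ^+ j <= x by rewrite ler_pdivrMr.
have l2' : x < l.+1%:R / 2 ^+ j by rewrite ltr_pdivlMr.
rewrite ger0_norm ?subr_ge0// lerBlDl ltW// (lt_le_trans l2')//.
by rewrite -natr1 mulrDl mul1r.
Qed.

Lemma dyadic_itv (a b j l : nat) : (a * 2 ^ j <= l <= b * 2 ^ j)%N ->
  a%:R <= dyadic R j l <= b%:R.
Proof.
by move=> /andP[h1 h2]; rewrite -!(dyadic_nat R j) !ler_dyadic.
Qed.

(* For a continuous path this compares the infima over [i, i.+1] and
   [k, k.+1]; the dyadic form is measurable on the space of all paths. *)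
Definition block_le f : rel nat := fun i k =>
  `[< forall j l n, (k * 2 ^ j <= l <= k.+1 * 2 ^ j)%N ->
      exists j' l', (i * 2 ^ j' <= l' <= i.+1 * 2 ^ j')%N /\
        f (dyadic R j' l') - f (dyadic R j l) < n.+1%:R^-1 >].

Lemma block_leP f i k : continuous f ->
  block_le f i k <-> approx_below f i%:R i.+1%:R k%:R k.+1%:R.
Proof.
move=> cf; split.
  move=> /asboolP h x e xk e0.
  have [j [l [hl fl]]] := @dyadic_near f k k.+1 x (f x + e / 2) cf xk ltac:(lra).
  have [n hn] : exists n : nat, (e / 2)^-1 < n%:R.
    by exists (Num.truncn (e / 2)^-1).+1; exact: truncnS_gt.
  have hn' : n.+1%:R^-1 < e / 2.
    rewrite invf_plt ?posrE//; last by rewrite divr_gt0.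
    by rewrite (lt_trans hn)// ltr_nat.
  have [j' [l' [hl' fl']]] := h j l n hl.
  exists (dyadic R j' l'); first exact: dyadic_itv.
  have {fl'}:= lt_trans fl' hn'; rewrite ltrBlDl => fl'.
  by apply: lt_trans fl' _; rewrite -ltrBrDr; apply: lt_le_trans fl _; lra.
move=> h; apply/asboolP => j l n hl.
have [|y yi fy] := h (dyadic R j l) (n.+1%:R^-1) (dyadic_itv hl); first by rewrite invr_gt0.
have [j' [l' [hl' fl']]] := @dyadic_near f i i.+1 y _ cf yi fy.
by exists j', l'; split => //; rewrite ltrBlDl.
Qed.

Lemma block_le_eq f g i k : (forall x y, f x - f y = g x - g y) ->
  block_le f i k = block_le g i k.
Proof.
move=> fg; apply: asbool_equiv_eq; split => h j l n hl;
  have [j' [l' [h1 h2]]] := h j l n hl; by exists j', l'; rewrite ?fg// -?fg.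
Qed.

Lemma block_le_shift f (s i k : nat) : continuous f ->
  block_le (fun t => f (s%:R + t)) i k = shift_rel s (block_le f) i k.
Proof.
move=> cf; have cfs : continuous (fun t : R => f (s%:R + t)).
  move=> t; apply: (@continuous_comp _ _ _ (fun t : R => s%:R + t) f); last exact: cf.
  by apply: cvgD; [exact: cvg_cst|exact: cvg_id].
apply/idP/idP => /(block_leP _ _ _) h; apply/block_leP => // x e.
  rewrite -addnS !natrD => /andP[x1 x2] e0.
  have [||y /andP[y1 y2]] := h cfs (x - s%:R) e; [by lra|by []|].
  rewrite subrKC => fy; exists (s%:R + y) => //.
  by rewrite -addnS !natrD; lra.
move=> /andP[x1 x2] e0.
have [||y /andP[y1 y2] fy] := h cf (s%:R + x) e; [|by []|].
  by rewrite -addnS !natrD; lra.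
exists (y - s%:R); last by rewrite subrKC.
by move: y1 y2; rewrite -addnS !natrD; lra.
Qed.

End infima.

Lemma measurable_lt_set (R : realType) (c : R) :
  measurable [set x : measurableTypeR R | x < c].
Proof.
have := @measurable_itv R `]-oo, c[.
by congr measurable; apply/seteqP; split => x /=; rewrite in_itv.
Qed.

(** * Measurability of distance events *)

Section path_graph_events.
Variable R : realType.
Implicit Types z : planar_path R.

Definition coord1 z : R -> R := fun t => (z t).1.
Definition coord2 z : R -> R := fun t => (z t).2.

Definition path_reach z := reach (block_le (coord1 z)) (block_le (coord2 z)).
Definition path_diam_le z := diam_le (block_le (coord1 z)) (block_le (coord2 z)).

Section events.
Variables a b : nat.
Let T := path_type R a b.

Lemma path_sigmaI (E F : set (planar_path R)) : path_sigma a b E -> path_sigma a b F ->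
  path_sigma a b (E `&` F).
Proof. exact: (@measurableI _ T). Qed.

Lemma path_sigmaU (E F : set (planar_path R)) : path_sigma a b E -> path_sigma a b F ->
  path_sigma a b (E `|` F).
Proof. exact: (@measurableU _ T). Qed.

Lemma path_sigmaC (E : set (planar_path R)) : path_sigma a b E -> path_sigma a b (~` E).
Proof. exact: (@measurableC _ T). Qed.

Lemma path_sigmaT : @path_sigma R a b setT.
Proof. exact: (@measurableT _ T). Qed.

Lemma path_sigma0 : @path_sigma R a b set0.
Proof. exact: (@measurable0 _ T). Qed.

Lemma path_sigma_bigcap (F : nat -> set (planar_path R)) :
  (forall i, path_sigma a b (F i)) -> path_sigma a b (\bigcap_i F i).
Proof. by move=> h; apply: (@bigcapT_measurable _ T). Qed.

Lemma path_sigma_bigcup (F : nat -> set (planar_path R)) :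
  (forall i, path_sigma a b (F i)) -> path_sigma a b (\bigcup_i F i).
Proof. by move=> h; apply: (@bigcupT_measurable _ T). Qed.

Lemma path_sigma_cond (p : bool) (F : set (planar_path R)) :
  (p -> path_sigma a b F) -> path_sigma a b [set z | p -> F z].
Proof.
case: p => h; first by have := h isT; congr path_sigma; apply/seteqP; split => z /=; [|exact].
by have := path_sigmaT; congr path_sigma; apply/seteqP; split.
Qed.

Lemma path_sigma_condA (p : bool) (F : set (planar_path R)) :
  (p -> path_sigma a b F) -> path_sigma a b [set z | p /\ F z].
Proof.
case: p => h; first by have := h isT; congr path_sigma; apply/seteqP; split => z /=; [|case].
by have := path_sigma0; congr path_sigma; apply/seteqP; split => z // [].
Qed.

Lemma path_sigma_all (I : eqType) (s : seq I) (p : I -> planar_path R -> bool) :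
  (forall i, i \in s -> path_sigma a b [set z | p i z]) ->
  path_sigma a b [set z | all (p^~ z) s].
Proof.
elim: s => [|i s IH] h.
  by have := path_sigmaT; congr path_sigma; apply/seteqP; split.
have h1 := h i (mem_head _ _).
have := path_sigmaI h1 (IH (fun j js => h j (mem_behead (s := i :: s) js))).
by congr path_sigma; apply/seteqP; split => z /=; [case=> -> ->|move/andP].
Qed.

Lemma path_sigmaCb (p : planar_path R -> bool) :
  path_sigma a b [set z | p z] -> path_sigma a b [set z | ~~ p z].
Proof.
move=> /path_sigmaC; congr path_sigma.
by apply/seteqP; split => z /= /negP.
Qed.

Lemma path_sigma_has (I : eqType) (s : seq I) (p : I -> planar_path R -> bool) :
  (forall i, i \in s -> path_sigma a b [set z | p i z]) ->
  path_sigma a b [set z | has (p^~ z) s].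
Proof.
move=> h; have := path_sigmaCb (path_sigma_all (fun i js => path_sigmaCb (h i js))).
congr path_sigma; apply/funext => z; rewrite /mkset.
by rewrite -[has _ _]negbK -all_predC.
Qed.

Lemma path_sigma_coord1 j i k l (B : set (measurableTypeR R)) :
  (a * 2 ^ j <= i <= b * 2 ^ j)%N -> (a * 2 ^ k <= l <= b * 2 ^ k)%N ->
  measurable B ->
  path_sigma a b [set z | B (coord1 z (dyadic R j i) - coord1 z (dyadic R k l))].
Proof.
move=> hi hl mB; have m := measurable_dyadic_diff (R := R) hi hl.
have := measurableT_comp (@measurable_fst _ _ _ _) m.
by move=> /(_ measurableT _ mB); rewrite setTI.
Qed.

Lemma path_sigma_coord2 j i k l (B : set (measurableTypeR R)) :
  (a * 2 ^ j <= i <= b * 2 ^ j)%N -> (a * 2 ^ k <= l <= b * 2 ^ k)%N ->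
  measurable B ->
  path_sigma a b [set z | B (coord2 z (dyadic R j i) - coord2 z (dyadic R k l))].
Proof.
move=> hi hl mB; have m := measurable_dyadic_diff (R := R) hi hl.
have := measurableT_comp (@measurable_snd _ _ _ _) m.
by move=> /(_ measurableT _ mB); rewrite setTI.
Qed.

Lemma path_sigma_block_le (co : planar_path R -> R -> R) i k :
  (forall j i k l (B : set (measurableTypeR R)),
    (a * 2 ^ j <= i <= b * 2 ^ j)%N -> (a * 2 ^ k <= l <= b * 2 ^ k)%N ->
    measurable B ->
    path_sigma a b [set z | B (co z (dyadic R j i) - co z (dyadic R k l))]) ->
  (a <= i < b)%N -> (a <= k < b)%N ->
  path_sigma a b [set z | block_le (co z) i k].
Proof.
move=> hco /andP[ai ib] /andP[ak kb].
rewrite (_ : [set _ | _] = \bigcap_j \bigcap_l \bigcap_n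
  [set z | (k * 2 ^ j <= l <= k.+1 * 2 ^ j)%N ->
    (\bigcup_j' \bigcup_l' [set z | (i * 2 ^ j' <= l' <= i.+1 * 2 ^ j')%N /\
       [set z | [set x : measurableTypeR R | x < n.+1%:R^-1]
         (co z (dyadic R j' l') - co z (dyadic R j l))] z]) z]).
  do 3!(apply: path_sigma_bigcap => ?); apply: path_sigma_cond => /andP[h1 h2].
  do 2!(apply: path_sigma_bigcup => ?); apply: path_sigma_condA => /andP[h3 h4].
  apply: hco.
  - by rewrite (leq_trans _ h3) ?leq_mul2r ?ai ?orbT// (leq_trans h4)// leq_mul2r ib orbT.
  - by rewrite (leq_trans _ h1) ?leq_mul2r ?ak ?orbT// (leq_trans h2)// leq_mul2r kb orbT.
  - exact: measurable_lt_set.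
apply/seteqP; split => z /=.
  move=> /asboolP h j _ l _ n _ hl; have [j' [l' [h1 h2]]] := h j l n hl.
  by exists j' => //; exists l'.
move=> h; apply/asboolP => j l n hl; have [j' _ [l' _ [h1 h2]]] := h j I l I n I hl.
by exists j', l'.
Qed.

Lemma path_sigma_block_le1 i k : (a <= i < b)%N -> (a <= k < b)%N ->
  path_sigma a b [set z | block_le (coord1 z) i k].
Proof. by apply: path_sigma_block_le => *; exact: path_sigma_coord1. Qed.

Lemma path_sigma_block_le2 i k : (a <= i < b)%N -> (a <= k < b)%N ->
  path_sigma a b [set z | block_le (coord2 z) i k].
Proof. by apply: path_sigma_block_le => *; exact: path_sigma_coord2. Qed.

Lemma path_sigmaIb (p q : planar_path R -> bool) :
  path_sigma a b [set z | p z] -> path_sigma a b [set z | q z] ->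
  path_sigma a b [set z | p z && q z].
Proof.
move=> hp hq; have := path_sigmaI hp hq; congr path_sigma.
by apply/seteqP; split => z /=; [move=> [-> ->]|move/andP].
Qed.

Lemma path_sigmaUb (p q : planar_path R -> bool) :
  path_sigma a b [set z | p z] -> path_sigma a b [set z | q z] ->
  path_sigma a b [set z | p z || q z].
Proof.
move=> hp hq; have := path_sigmaU hp hq; congr path_sigma.
by apply/seteqP; split => z /=; [move=> [] ->; rewrite ?orbT|move/orP].
Qed.

Lemma path_sigma_cst (p : bool) : @path_sigma R a b [set _ | p].
Proof.
case: p; [have := path_sigmaT|have := path_sigma0]; congr path_sigma;
  by apply/seteqP; split.
Qed.

Lemma path_sigma_block_adj i j : (a <= i < b)%N -> (a <= j < b)%N ->
  path_sigma a b
    [set z | block_adj (block_le (coord1 z)) (block_le (coord2 z)) i j].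
Proof.
have lt_adj i' j' : (a <= i' < b)%N -> (a <= j' < b)%N -> path_sigma a b
    [set z | block_lt_adj (block_le (coord1 z)) (block_le (coord2 z)) i' j'].
  move=> hi hj; apply: path_sigmaIb; first exact: path_sigma_cst.
  apply: path_sigmaUb; apply: path_sigma_all => k; rewrite mem_index_iota => hk;
    apply: path_sigmaIb;
    [apply: path_sigma_block_le1|apply: path_sigma_block_le1
    |apply: path_sigma_block_le2|apply: path_sigma_block_le2] => //; lia.
by move=> hi hj; apply: path_sigmaUb; exact: lt_adj.
Qed.

Lemma path_sigma_reach a' b' n x y : (a <= a')%N -> (b' <= b)%N -> (a <= x < b)%N ->
  path_sigma a b [set z | path_reach z a' b' n x y].
Proof.
move=> ha hb; elim: n x => [|n IH] x hx.
  by apply: path_sigmaUb; exact: path_sigma_cst.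
apply: path_sigmaUb; first exact: path_sigma_cst.
apply: path_sigma_has => k; rewrite mem_index_iota => hk.
apply: path_sigmaIb; last by apply: IH; lia.
by apply: path_sigma_block_adj => //; lia.
Qed.

Lemma path_sigma_diam a' b' n : (a <= a')%N -> (b' <= b)%N ->
  path_sigma a b [set z | path_diam_le z a' b' n].
Proof.
move=> ha hb; apply: path_sigma_all => x; rewrite mem_index_iota => hx.
by apply: path_sigma_all => y _; apply: path_sigma_reach => //; lia.
Qed.

End events.

Lemma path_reach_shift z (s : nat) c a b n x y : continuous z ->
  path_reach (fun t => z (s%:R + t) - c : R * R) a b n x y =
  path_reach z (s + a) (s + b) n (s + x) (s + y).
Proof.
move=> cz; rewrite /path_reach -reach_shift.
have E (co : planar_path R -> R -> R) : continuous (co z) ->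
    (forall x y, co (fun t => z (s%:R + t) - c : R * R) x - co (fun t => z (s%:R + t) - c : R * R) y =
      co z (s%:R + x) - co z (s%:R + y)) ->
    block_le (co (fun t => z (s%:R + t) - c : R * R)) = shift_rel s (block_le (co z)).
  move=> ccz h; apply/funext => i; apply/funext => k.
  rewrite -(block_le_shift _ _ _ ccz); exact: block_le_eq.
rewrite (E coord1); last 2 first.
- exact: continuous_path1.
- by move=> u v; rewrite /coord1 /=; ring.
rewrite (E coord2)//.
- exact: continuous_path2.
- by move=> u v; rewrite /coord2 /=; ring.
Qed.

Lemma path_diam_le_shift z (s : nat) c a b n : continuous z ->
  path_diam_le (fun t => z (s%:R + t) - c : R * R) a b n =
  path_diam_le z (s + a) (s + b) n.
Proof.
move=> cz; rewrite /path_diam_le /diam_le index_iota_shift all_map.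
apply: eq_all => x /=; rewrite all_map; apply: eq_all => y /=.
exact: path_reach_shift.
Qed.

End path_graph_events.

(** * The mated-CRT map on (0, 1] as a block graph *)

Section mated_crt_blocks.
Variable R : realType.

(** In the shape of [bm_affine] at time 0. Block i of the rescaled path corresponds to the vertex (i
    + 1) eps, whose own time interval is [i eps, (i + 1) eps]. *)
Definition rescale_path (k eps : R) (z : R -> R * R) : planar_path R :=
  fun t => pair_scale k (z (0 + eps * t) - z 0).

Section coordinate.
Variables (f : R -> R) (k eps c : R).
Hypotheses (cf : continuous f) (k0 : 0 < k) (eps0 : 0 < eps).

Let g (t : R) := k * (f (0 + eps * t) - c).

Lemma continuous_rescale_coord : continuous g.
Proof.
move=> t; apply: cvgM; first exact: cvg_cst.
apply: cvgB; last exact: cvg_cst.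
apply: (@continuous_comp _ _ _ (fun s : R => 0 + eps * s) f); last exact: cf.
by apply: cvgD; [exact: cvg_cst|apply: cvgM; [exact: cvg_cst|exact: cvg_id]].
Qed.

Lemma approx_below_rescale (a b a' b' : R) :
  approx_below g a b a' b' <->
  approx_below f (a * eps) (b * eps) (a' * eps) (b' * eps).
Proof.
have epsK (u : R) : eps * (u / eps) = u by rewrite mulrC divfK ?gt_eqF.
have gE (u w q : R) : (g u < g w + k * q) = (f (eps * u) < f (eps * w) + q).
  by rewrite /g -mulrDr ltr_pM2l// !add0r addrAC ltrD2r.
split=> h x e /andP[x1 x2] e0.
  have [||y /andP[y1 y2]] := h (x / eps) (k * e).
  - by rewrite ler_pdivlMr// ler_pdivrMr// x1.
  - exact: mulr_gt0.
  rewrite gE epsK => gy; exists (y * eps); first by rewrite !ler_pM2r// y1.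
  by rewrite [y * _]mulrC.
have [||y /andP[y1 y2] fy] := h (x * eps) (e / k).
- by rewrite !ler_pM2r// x1.
- exact: divr_gt0.
exists (y / eps); first by rewrite ler_pdivlMr// ler_pdivrMr// y1.
have -> : e = k * (e / k) by rewrite mulrC divfK ?gt_eqF.
by rewrite gE epsK [eps * x]mulrC.
Qed.

Lemma crt_adjacent_block i j : (i < j)%N ->
  crt_adjacent f eps (i.+1%:R * eps) (j.+1%:R * eps) =
  block_dominated (block_le g) i j.
Proof.
move=> ij; have cg := continuous_rescale_coord.
have natB n : n.+1%:R * eps - eps = n%:R * eps by rewrite -natr1; ring.
have blk n m : (block_le g n m) = (inf_on f (n%:R * eps) (n.+1%:R * eps) <=
    inf_on f (m%:R * eps) (m.+1%:R * eps)).
  have le_eps l : l%:R * eps <= l.+1%:R * eps by rewrite ler_pM2r// ler_nat.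
  apply/idP/idP.
    by move=> /(block_leP _ _ cg)/approx_below_rescale/(inf_on_le cf (le_eps n) (le_eps m)).
  by move=> /(inf_on_le cf (le_eps n) (le_eps m))/approx_below_rescale/(block_leP _ _ cg).
have sub n x : n%:R * eps <= x <= n.+1%:R * eps ->
    inf_on f (n%:R * eps) (n.+1%:R * eps) <= f x := @inf_on_lb _ f _ _ _ cf.
rewrite /crt_adjacent !natB.
have ij' : i.+1%:R * eps <= j%:R * eps by rewrite ler_pM2r// ler_nat.
apply/idP/idP.
  rewrite ge_max => /andP[h1 h2]; apply/allP => n; rewrite mem_index_iota => /andP[n1 n2].
  rewrite !blk.
  have h : inf_on f (i.+1%:R * eps) (j%:R * eps) <=
      inf_on f (n%:R * eps) (n.+1%:R * eps).
    apply/inf_on_le => //; first by rewrite ler_pM2r// ler_nat.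
    move=> x e /andP[x1 x2] e0; exists x; last by rewrite ltrDl.
    rewrite (le_trans _ x1) ?ler_pM2r ?ler_nat//=.
    by rewrite (le_trans x2)// ler_pM2r// ler_nat.
  by rewrite !(le_trans _ h).
move=> /allP h; apply: lb_le_inf.
  by exists (f (i.+1%:R * eps)), (i.+1%:R * eps) => //=; rewrite in_itv/= lexx.
move=> _ [x /= + <-]; rewrite in_itv/= => /andP[x1 x2].
have x0 : 0 <= x / eps.
  by rewrite divr_ge0 ?(ltW eps0)// (le_trans _ x1)// mulr_ge0// ltW.
have /andP[] := truncn_itv x0; rewrite ler_pdivlMr// ltr_pdivrMr//.
set n := Num.truncn _ => n1 n2.
have xn : n%:R * eps <= x <= n.+1%:R * eps by rewrite n1 ltW.
have i_n : (i < n)%N.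
  by rewrite -ltnS -(ltr_nat R) -(ltr_pM2r eps0) (le_lt_trans x1).
have [nj|jn] := ltnP n j.
  have := h n; rewrite mem_index_iota i_n nj !blk => /(_ isT)/andP[h1 h2].
  by rewrite ge_max (le_trans h1 (sub n _ xn)) (le_trans h2 (sub n _ xn)).
(* The point j eps is not interior to the blocks between i and j. It is the left end of block j; for
   the comparison with block i it is used as the right end of block j - 1, or of block i itself when
   j = i + 1. *)
have xj : x = j%:R * eps.
  apply/eqP; rewrite eq_le x2 (le_trans _ n1)// ler_pM2r// ler_nat//.
rewrite ge_max; apply/andP; split; last first.
  by apply: sub; rewrite xj lexx ler_pM2r// ler_nat leqnSn.
have [ji|ji] := eqVneq j i.+1.
  by apply: sub; rewrite xj ji lexx ler_pM2r// ler_nat leqnSn.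
have j0 : (0 < j)%N by exact: leq_ltn_trans ij.
have j1 : (i < j.-1 < j)%N.
  by rewrite ltn_predL j0 andbT ltn_neqAle -ltnS prednK// ij -(inj_eq succn_inj) prednK// eq_sym ji.
have := h j.-1; rewrite mem_index_iota j1 !blk => /(_ isT)/andP[h1 _].
apply: (le_trans h1); apply: sub.
have -> : j.-1.+1 = j by exact: prednK.
by rewrite xj lexx ler_pM2r// ler_nat leq_pred.
Qed.

End coordinate.

Section graph.
Variables (z : R -> R * R) (k eps : R).
Hypotheses (cz : continuous z) (k0 : 0 < k) (eps0 : 0 < eps).

Let z' := rescale_path k eps z.
Let N := Num.truncn eps^-1.
Let v (i : nat) : R := i.+1%:R * eps.
Let G := mated_crt_map01 z eps.
Let adj := block_adj (block_le (coord1 z')) (block_le (coord2 z')).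

Lemma lt_vertex i j : (v i < v j) = (i < j)%N.
Proof. by rewrite /v ltr_pM2r// ltr_nat. Qed.

Lemma vertex_inj : injective v.
Proof.
move=> i j /(mulIf (lt0r_neq0 eps0))/eqP; rewrite eqr_nat => /eqP ij.
exact: succn_inj ij.
Qed.

Lemma mated_adjacent_block i j : Defs.adjacent G (v i) (v j) = adj i j.
Proof.
have h i' j' : mated_crt_lt_adjacent z eps (v i') (v j') =
    block_lt_adj (block_le (coord1 z')) (block_le (coord2 z')) i' j'.
  rewrite /mated_crt_lt_adjacent /block_lt_adj lt_vertex.
  case: ltnP => //= ij.
  rewrite (@crt_adjacent_block (fun s => (z s).1) k eps (z 0).1)//; last exact: continuous_path1.
  by rewrite (@crt_adjacent_block (fun s => (z s).2) k eps (z 0).2)//; exact: continuous_path2.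
by rewrite /= /mated_crt_map /= !h.
Qed.

Lemma vertices_mated x : vertices G x <-> exists2 i, (i < N)%N & x = v i.
Proof.
have e0 : 0 <= eps^-1 by rewrite invr_ge0 ltW.
split.
  move=> [[n _ <-]] /=; rewrite in_itv/= => /andP[n0 n1].
  have {}n0 : (0 < n)%R by move: n0; rewrite pmulr_lgt0// ltr0z.
  have [m mE] : exists m : nat, n = m.+1%:Z.
    by exists `|n|%N.-1; rewrite prednK ?gez0_abs ?absz_gt0 ?gt_eqF ?ltW.
  rewrite {}mE in n1 n0 *; rewrite -pmulrn in n1.
  exists m; last by rewrite /v -pmulrn.
  rewrite truncn_ge_nat//; move: n1; rewrite -[X in _ <= X](@mulVf _ eps) ?gt_eqF//.
  by rewrite ler_pM2r.
move=> [i iN ->]; split; first by exists i.+1%:Z => //; rewrite -pmulrn.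
rewrite /= in_itv/= mulr_gt0//=.
move: iN; rewrite truncn_ge_nat// => h.
by rewrite -(@mulVf _ eps) ?gt_eqF// ler_pM2r.
Qed.

Lemma path_reach_walk n i j : (i < N)%N -> path_reach z' 0 N n i j ->
  exists2 p, is_walk G (v i) p /\ last (v i) p = v j & (size p <= n)%N.
Proof.
elim: n i => [|n IH] i iN /reachP[<-|[u [/= uN iu] [m //]]]; last first.
- move=> [<-] /IH -/(_ uN) [p [[pV pP] pl] ps]; exists (v u :: p) => //; split => //.
  split; last by apply/andP; split => //; exact: (etrans (mated_adjacent_block i u)).
  move=> x; rewrite inE => /orP[/eqP ->|]; last exact: pV.
  by apply/vertices_mated; exists i.
- exists [::] => //; do 2!split => //; move=> x; rewrite inE => /eqP ->.
  by apply/vertices_mated; exists i.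
- exists [::] => //; do 2!split => //; move=> x; rewrite inE => /eqP ->.
  by apply/vertices_mated; exists i.
Qed.

Lemma walk_path_reach p i j : is_walk G (v i) p -> last (v i) p = v j ->
  path_reach z' 0 N (size p) i j.
Proof.
elim: p i => [|x p IH] i [pV pP] pl.
  suff -> : i = j by rewrite /path_reach /= eqxx.
  exact: vertex_inj pl.
have /vertices_mated[u uN xE] : vertices G x.
  by apply: pV; rewrite !inE eqxx orbT.
move: pP => /= /andP[ix xp].
have iu : adj i u by rewrite -mated_adjacent_block -xE.
apply: (reachS (z := u)) => //; apply: IH; last by rewrite -xE.
rewrite -xE; split => // y yp; apply: pV.
by rewrite inE yp orbT.
Qed.

Lemma graph_dist_ge (i j : nat) (l : R) : (i < N)%N ->
  (l%:E <= graph_dist R G (v i) (v j))%E <->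
  (forall n, n%:R < l -> ~~ path_reach z' 0 N n i j).
Proof.
move=> iN; split.
  move=> h n nl; apply/negP => /(path_reach_walk iN)[p [pw pl] pn].
  have : (graph_dist R G (v i) (v j) <= (size p)%:R%:E)%E.
    by apply: ereal_inf_lbound; exists p.
  move=> /(le_trans h); rewrite lee_fin leNgt (le_lt_trans _ nl)//.
  by rewrite ler_nat.
move=> h; apply: le_ereal_inf_tmp => _ [p [pw pl] <-].
rewrite lee_fin leNgt; apply/negP => /h/negP; apply.
exact: walk_path_reach.
Qed.

Lemma graph_dist_ge0 x y : (0 <= graph_dist R G x y)%E.
Proof. by apply: le_ereal_inf_tmp => _ [p _ <-]; rewrite lee_fin. Qed.

Lemma graph_diam_le (l : R) : 0 <= l ->
  (graph_diam R G <= l%:E)%E <->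
  (exists2 n, n%:R <= l & path_diam_le z' 0 N n).
Proof.
move=> l0; split.
  move=> h; have /andP[t1 t2] := truncn_itv l0.
  exists (Num.truncn l) => //; apply/diam_leP => i j /= iN jN.
  have : (graph_dist R G (v i) (v j) < (Num.truncn l).+1%:R%:E)%E.
    apply: (@le_lt_trans _ _ l%:E); last by rewrite lte_fin.
    apply: le_trans h; apply: ereal_sup_ubound; exists (v i, v j) => //=.
    by split; apply/vertices_mated; [exists i|exists j].
  move=> /ereal_inf_lt[_ [p [pw pl] <-]]; rewrite lte_fin ltr_nat ltnS => pn.
  exact/(reach_leq pn)/walk_path_reach.
move=> [n nl /diam_leP h]; apply: ge_ereal_sup => _ [[x y] /= [xV yV] <-].
move/vertices_mated : xV => [i iN ->]; move/vertices_mated : yV => [j jN ->].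
have [p [pw pl] pn] := path_reach_walk iN (h i j iN jN).
apply: (@le_trans _ _ (size p)%:R%:E); first by apply: ereal_inf_lbound; exists p.
by rewrite lee_fin (le_trans _ nl)// ler_nat.
Qed.

(** A layer-cake formula: the diameter counts the n that it exceeds, all of them below N since
    consecutive blocks are adjacent. Its mean thus becomes a finite sum of tails. *)
Lemma graph_diam_sum : (0 < N)%N ->
  graph_diam R G = (\sum_(n < N) (~~ path_diam_le z' 0 N n)%:R)%:E.
Proof.
move=> N0.
have exn : exists n, path_diam_le z' 0 N n.
  by exists N; apply: diam_le_length.
pose n0 := ex_minn exn.
have [hn0 mn0] : path_diam_le z' 0 N n0 /\ forall m, path_diam_le z' 0 N m -> (n0 <= m)%N.
  by rewrite /n0; case: ex_minnP.
have n0N : (n0 <= N)%N by apply: mn0; exact: diam_le_length.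
have -> : \sum_(n < N) (~~ path_diam_le z' 0 N n)%:R = n0%:R :> R.
  rewrite -natr_sum; congr _%:R.
  rewrite -(big_mkord predT (fun n => (~~ path_diam_le z' 0 N n : nat))).
  rewrite (big_cat_nat (leq0n n0) n0N)/=.
  rewrite (@eq_big_nat _ _ _ 0 n0 _ (fun=> 1%N)); last first.
    move=> i /andP[_ i0]; case: (boolP (path_diam_le _ _ _ _)) => // /mn0.
    by rewrite leqNgt i0.
  rewrite [X in (_ + X)%N](@eq_big_nat _ _ _ n0 N _ (fun=> 0%N)); last first.
    move=> i /andP[n0i _].
    by have -> : path_diam_le z' 0 N i by exact: diam_le_leq hn0.
  by rewrite !sum_nat_const_nat muln0 muln1 addn0 subn0.
apply/le_anti/andP; split; first by apply/graph_diam_le => //; exists n0.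
have d0 : (0 <= graph_diam R G)%E.
  apply: le_trans (graph_dist_ge0 (v 0) (v 0)) _; apply: ereal_sup_ubound.
  by exists (v 0, v 0) => //=; split; apply/vertices_mated; exists 0%N.
rewrite leNgt; apply/negP.
case: (graph_diam R G) (graph_diam_le) d0 => [r h|_ _|_ //].
- rewrite lee_fin => r0; rewrite lte_fin => rn.
  have [n nr /mn0] := (h r r0).1 (lexx _).
  by rewrite leqNgt -(ltr_nat R) (le_lt_trans nr rn).
- by rewrite ltNge leey.
Qed.

End graph.

Lemma closest_vertex_index (eps s x : R) : 0 < eps <= 1 -> 0 <= s <= 1 ->
  closest_vertex eps s x ->
  exists i, [/\ (i < Num.truncn eps^-1)%N, x = i.+1%:R * eps & `|x - s| <= eps].
Proof.
move=> /andP[e0 e1] /andP[s0 s1] [xV hx].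
(* The vertex set is the same for all paths, so constant paths serve here. *)
have /(_ 0)/(vertices_mated 0 e0)[i iN xE] :
    forall z : R, vertices (mated_crt_map01 (cst (z, z)) eps) x by [].
exists i; split => //.
have [n nE] : exists n, n = Num.truncn (s / eps) by eexists.
have se0 : 0 <= s / eps by rewrite divr_ge0// ltW.
have := truncn_itv se0; rewrite -nE ler_pdivlMr// ltr_pdivrMr// => /andP[n1 n2].
case: n => [|n] in n1 n2 {nE}.
  (* For s < eps the multiple of eps below s is 0, which is not a vertex, so the competitor is
     eps. *)
  apply: le_trans (hx eps _) _.
    split; first by exists 1 => //; rewrite mul1r.
    by rewrite /= in_itv/= e0.
  by rewrite ger0_norm; lra.
apply: le_trans (hx (n.+1%:R * eps) _) _.
  split; first by exists n.+1%:Z => //; rewrite -pmulrn.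
  by rewrite /= in_itv/= mulr_gt0// (le_trans n1).
rewrite ler_norml; rewrite -[n.+2%:R]natr1 mulrDl mul1r in n2; lra.
Qed.

End mated_crt_blocks.

(** * The upper bound *)

Section real_probability.
Variables (R : realType) (d : measure_display) (T : measurableType d).
Variable P : probability T R.

Definition Pr (A : set T) : R := fine (P A).

Lemma PrE A : measurable A -> P A = (Pr A)%:E.
Proof. by move=> mA; rewrite /Pr fineK// fin_num_measure. Qed.

Lemma Pr_ge0 A : 0 <= Pr A.
Proof. exact/fine_ge0/measure_ge0. Qed.

Lemma Pr_le1 A : measurable A -> Pr A <= 1.
Proof. by move=> mA; rewrite -lee_fin -PrE//; exact: probability_le1. Qed.

Lemma Pr_setT : Pr setT = 1.
Proof. by rewrite /Pr probability_setT. Qed.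

Lemma Pr_set0 : Pr set0 = 0.
Proof. by rewrite /Pr measure0. Qed.

Lemma le_Pr A B : measurable A -> measurable B -> A `<=` B -> Pr A <= Pr B.
Proof. by move=> mA mB AB; rewrite -lee_fin -!PrE//; exact: le_measure (mem_set mA) (mem_set mB) AB. Qed.

Lemma Pr_setU A B : measurable A -> measurable B -> Pr (A `|` B) <= Pr A + Pr B.
Proof.
move=> mA mB; rewrite -lee_fin EFinD -!PrE//; last exact: measurableU.
exact: measureU2.
Qed.

Lemma Pr_setC A : measurable A -> Pr (~` A) = 1 - Pr A.
Proof.
move=> mA; apply: EFin_inj; rewrite EFinB -!PrE//; last exact: measurableC.
exact: probability_setC.
Qed.

Lemma Pr_setD A B : measurable A -> measurable B -> Pr A - Pr B <= Pr (A `\` B).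
Proof.
move=> mA mB; rewrite lerBlDr.
apply: le_trans (Pr_setU (measurableD mA mB) mB).
apply: le_Pr => //; first by apply: measurableU => //; exact: measurableD.
by move=> x Ax; have [Bx|nBx] := pselect (B x); [right|left].
Qed.

Lemma measurable_bigcup_lt (n : nat) (A : nat -> set T) :
  (forall i, (i < n)%N -> measurable (A i)) -> measurable (\bigcup_(i < n) A i).
Proof. by move=> mA; apply: bigcup_measurable => i; exact: mA. Qed.

Lemma Pr_bigcup n (A : nat -> set T) (r : R) :
  (forall i, (i < n)%N -> measurable (A i) /\ Pr (A i) <= r) ->
  Pr (\bigcup_(i < n) A i) <= n%:R * r.
Proof.
elim: n => [|n IH] h.
  rewrite (_ : \bigcup_(i < 0) A i = set0) ?Pr_set0 ?mul0r//.
  by apply/seteqP; split => x // -[].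
have -> : \bigcup_(i < n.+1) A i = \bigcup_(i < n) A i `|` A n.
  by rewrite !bigcup_mkord big_ord_recr.
have [mAn PAn] := h n (ltnSn n).
have hn i : (i < n)%N -> measurable (A i) /\ Pr (A i) <= r by move=> /ltnW; exact: h.
have mU : measurable (\bigcup_(i < n) A i).
  by apply: measurable_bigcup_lt => i /hn[].
apply: le_trans (Pr_setU mU mAn) _.
by rewrite -natr1 mulrDl mul1r lerD// IH.
Qed.

Lemma Pr_pigeonhole n (A : nat -> set T) (r : R) :
  (forall i, (i < n)%N -> measurable (A i)) ->
  n%:R * r < Pr (\bigcup_(i < n) A i) -> exists2 i, (i < n)%N & r < Pr (A i).
Proof.
move=> mA; apply: contraPP => /forall2NP h; apply/negP; rewrite -leNgt.
apply: Pr_bigcup => i iltn; split; first exact: mA.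
by have [/(_ iltn)|/negP] := h i; rewrite // -leNgt.
Qed.

End real_probability.

Section reference.
Variables (R : realType) (gamma : R).
Variables (d : measure_display) (T : measurableType d).
Variables (P : probability T R) (Z : R -> T -> R * R).
Hypothesis bmZ : mated_crt_brownian_motion gamma 1 P Z.

Let X : T -> planar_path R := fun w => Z ^~ w.

Definition path_prob (E : set (planar_path R)) : R := Pr P (X @^-1` E).
Notation pr := path_prob.

Lemma measurable_event a b E : path_sigma a b E -> measurable (X @^-1` E).
Proof. exact: bm_measurable_event bmZ _ _ _. Qed.

Lemma path_prob_indep a b c E F : (a <= b <= c)%N ->
  path_sigma a b E -> path_sigma b c F -> pr (E `&` F) = pr E * pr F.
Proof.
move=> abc sE sF; apply: EFin_inj; rewrite EFinM /path_prob -!PrE.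
- exact: (bm_independent_events bmZ abc sE sF).
- exact: measurable_event sF.
- exact: measurable_event sE.
- by rewrite preimage_setI; apply: measurableI; [exact: measurable_event sE|exact: measurable_event sF].
Qed.

Lemma bm_shift (a : nat) : mated_crt_brownian_motion gamma 1 P
  (fun t w => (Z (a%:R + t) w - Z a%:R w : R * R)).
Proof.
have := @bm_affine R gamma 1 d T P Z bmZ a%:R 1 1 ltr01.
rewrite !mulr1 expr1n; congr mated_crt_brownian_motion.
apply/funext => t; apply/funext => w; rewrite /increment /pair_scale !mul1r.
by case: (Z (a%:R + t) w - Z a%:R w).
Qed.

Lemma path_prob_shift (a b c : nat) E : path_sigma b c E ->
  pr [set z | E (fun t => z (a%:R + t) - z a%:R : R * R)] = pr E.
Proof. by move=> sE; rewrite /path_prob /Pr -(bm_law bmZ (bm_shift a) sE). Qed.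

Definition diam_tail (N n : nat) : R := pr [set z | ~~ path_diam_le z 0 N n].
Notation p := diam_tail.

Lemma path_sigma_diam_gt a b a' b' n : (a <= a')%N -> (b' <= b)%N ->
  path_sigma a b [set z : planar_path R | ~~ path_diam_le z a' b' n].
Proof. by move=> h1 h2; apply: path_sigmaCb; exact: path_sigma_diam. Qed.

Lemma diam_tail_shift a N n :
  pr [set z | ~~ path_diam_le z a (a + N) n] = p N n.
Proof.
rewrite /diam_tail -(path_prob_shift a (path_sigma_diam_gt n (leqnn 0) (leqnn N))).
congr (Pr P _); apply/funext => w; rewrite /mkset /preimage /mkset.
by rewrite path_diam_le_shift ?addn0//; exact: bm_continuous bmZ w.
Qed.

Lemma diam_tail_ge0 N n : 0 <= p N n. Proof. exact: Pr_ge0. Qed.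

Lemma diam_tail_le1 N n : p N n <= 1.
Proof. apply: Pr_le1; exact: measurable_event (path_sigma_diam_gt n (leqnn 0) (leqnn N)). Qed.

Lemma diam_tail_le N m n : (m <= n)%N -> p N n <= p N m.
Proof.
move=> mn; apply: le_Pr.
- exact: measurable_event (path_sigma_diam_gt n (leqnn 0) (leqnn N)).
- exact: measurable_event (path_sigma_diam_gt m (leqnn 0) (leqnn N)).
- by move=> w /=; apply: contra; exact: diam_le_leq.
Qed.

Lemma diam_tail_eq0 N n : (N <= n)%N -> p N n = 0.
Proof.
move=> Nn; rewrite /diam_tail /path_prob -(Pr_set0 P); congr (Pr P _).
apply/seteqP; split => w //= /negP; apply.
exact: diam_le_length.
Qed.

Section blocks.
Variables (e : nat -> nat) (A : nat) (q : R).
Hypothesis e0 : e 0 = 0%N.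
Hypothesis emon : forall i, (e i <= e i.+1)%N.
Hypothesis q0 : 0 <= q.

Let bad (i : nat) : set (planar_path R) :=
  [set z | ~~ path_diam_le z (e i) (e i.+1) A].

(** Split by the last interval, which is independent of the earlier ones: either k intervals before
    it are bad, or k - 1 are and it is bad too. *)
Fixpoint many_bad (m k : nat) : set (planar_path R) :=
  if k is k'.+1 then
    if m is m'.+1 then many_bad m' k `|` (many_bad m' k' `&` bad m') else set0
  else setT.

Lemma path_sigma_many_bad m k : path_sigma 0 (e m) (many_bad m k).
Proof.
elim: m k => [|m IH] [|k] /=; try exact: path_sigmaT; first exact: path_sigma0.
apply: path_sigmaU; first by apply: (path_sigma_sub (leqnn 0) (emon m)); exact: IH.
apply: path_sigmaI; first by apply: (path_sigma_sub (leqnn 0) (emon m)); exact: IH.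
exact: path_sigma_diam_gt.
Qed.

Lemma many_bad_prob m k :
  (forall i, (i < m)%N -> p (e i.+1 - e i) A <= q) ->
  pr (many_bad m k) <= (m%:R * q) ^+ k.
Proof.
elim: m k => [|m IH] [|k] hq.
- by rewrite expr0 /path_prob Pr_setT.
- by rewrite /path_prob Pr_set0 exprn_ge0// mul0r.
- by rewrite expr0 /path_prob Pr_setT.
have {}IH k' : pr (many_bad m k') <= (m%:R * q) ^+ k'.
  by apply: IH => i im; apply: hq; exact: ltnW.
have sb : path_sigma (e m) (e m.+1) (bad m) by exact: path_sigma_diam_gt.
have sk' k' : path_sigma 0 (e m.+1) (many_bad m k').
  by apply: (path_sigma_sub (leqnn 0) (emon m)); exact: path_sigma_many_bad.
have sb' : path_sigma 0 (e m.+1) (bad m).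
  by apply: (path_sigma_sub (leq0n (e m)) (leqnn _)).
rewrite /= /path_prob preimage_setU.
apply: le_trans (Pr_setU _ (measurable_event (sk' _)) (measurable_event (path_sigmaI (sk' _) sb'))) _.
rewrite -!/(pr _) (path_prob_indep _ (@path_sigma_many_bad m k) sb) ?emon//.
have -> : pr (bad m) = p (e m.+1 - e m) A.
  by rewrite -(diam_tail_shift (e m)) subnKC.
apply: (@le_trans _ _ ((m%:R * q) ^+ k.+1 + (m%:R * q) ^+ k * q)).
  by rewrite lerD// ler_pM// ?Pr_ge0// hq.
have -> : (m%:R * q) ^+ k.+1 + (m%:R * q) ^+ k * q =
    m.+1%:R * m%:R ^+ k * q ^+ k.+1 by rewrite -natr1 !exprMn !exprS; ring.
rewrite [leRHS]exprMn ler_wpM2r ?exprn_ge0// exprS ler_wpM2l//.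
by rewrite lerXn2r ?nnegrE// ler_nat.
Qed.

Lemma many_bad_count m k z : ~ many_bad m k z ->
  (\sum_(i < m) (~~ path_diam_le z (e i) (e i.+1) A : nat) < k)%N.
Proof.
elim: m k => [|m IH] [|k] //=; first by rewrite big_ord0.
move=> /not_orP[h1 h2]; rewrite big_ord_recr /=.
have := IH _ h1; case: (boolP (~~ _)) => /= hb; last by rewrite addn0.
move=> _; rewrite addn1 ltnS; apply: IH => h; exact: h2.
Qed.

End blocks.

Lemma diam_tail_rec N b m k A l (q r : R) : (N <= m * b)%N -> 0 <= q ->
  (forall N', (N' <= minn b N)%N -> p N' A <= q) ->
  (forall N', (N' <= minn b N)%N -> p N' l <= r) ->
  p N (m * A.+1 + k * l) <= (m%:R * q) ^+ k + m%:R * r.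
Proof.
(* The intervals are cut off at N, so some may be shorter than b or empty; hence bounds for all
   lengths up to [minn b N]. *)
move=> Nmb q0 hq hr; pose e i := minn (i * b) N.
have e0 : e 0 = 0%N by rewrite /e mul0n min0n.
have emon i : (e i <= e i.+1)%N by rewrite /e mulSn; lia.
have eb i : (e i.+1 - e i <= minn b N)%N by rewrite /e mulSn; lia.
have em : e m = N by rewrite /e; lia.
pose F i : set (planar_path R) := [set z | ~~ path_diam_le z (e i) (e i.+1) l].
have emono i j : (i <= j)%N -> (e i <= e j)%N.
  by move=> /subnK <-; elim: (j - i)%N => // n IHn; rewrite addSn (leq_trans IHn).
have sF i : (i < m)%N -> path_sigma 0 N (F i).
  by move=> im; apply: path_sigma_diam_gt => //; rewrite -em emono.
have sM : path_sigma 0 N (many_bad e A m k).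
  by rewrite -em; exact: path_sigma_many_bad.
have mF i : (i < m)%N -> measurable (X @^-1` F i) by move=> /sF/measurable_event.
apply: (@le_trans _ _ (Pr P (X @^-1` many_bad e A m k `|` \bigcup_(i < m) (X @^-1` F i)))).
  apply: le_Pr.
  - exact: measurable_event (path_sigma_diam_gt _ (leqnn 0) (leqnn N)).
  - apply: measurableU; [exact: measurable_event sM|exact: measurable_bigcup_lt].
  move=> w /=; apply: contraNP => /not_orP[nM nF].
  have hF i : (i < m)%N -> path_diam_le (X w) (e i) (e i.+1) l.
    move=> im; apply: contrapT => /negP h; apply: nF; exists i => //.
  pose dd i := if path_diam_le (X w) (e i) (e i.+1) A then A else l.
  have := @diam_le_bigcat (block_le (coord1 (X w))) (block_le (coord2 (X w))) e dd m emon.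
  rewrite e0 em => H; apply: diam_le_leq (H _); last first.
    by move=> i im; rewrite /dd; case: ifPn => // _; exact: hF.
  have cnt := many_bad_count nM.
  apply: (@leq_trans (\sum_(i < m) (A.+1 + (~~ path_diam_le (X w) (e i) (e i.+1) A) * l))).
    by apply: leq_sum => i _; rewrite /dd; case: ifP => _ /=; lia.
  rewrite big_split /= sum_nat_const card_ord leq_add2l -big_distrl /=.
  by rewrite leq_mul2r (ltnW cnt) orbT.
apply: le_trans (Pr_setU _ (measurable_event sM) (measurable_bigcup_lt mF)) _.
apply: lerD.
  apply: many_bad_prob => // i im; exact/hq/eb.
apply: Pr_bigcup => i im; split; first exact: mF.
have -> : Pr P (X @^-1` F i) = p (e i.+1 - e i) l.
  by rewrite -(diam_tail_shift (e i)) subnKC.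
exact/hr/eb.
Qed.

End reference.

(** * The iteration over scales *)

Section growth.
Variable R : realType.

Lemma expR_ge1 (x : R) : 0 <= x -> 1 <= expR x.
Proof. by move=> x0; rewrite -[leLHS]expR0 ler_expR. Qed.

Lemma poly_le_exp (a C : R) (Q : nat) : 0 < a ->
  exists L0 : R, 0 <= L0 /\ forall L, L0 <= L -> C * (1 + L) ^+ Q <= expR (a * L).
Proof.
(* One power more than Q: the spare factor 1 + L absorbs C as soon as L >= |C| / b^n. *)
move=> a0; pose n := Q.+1; pose b := Num.min 1 (a / n%:R).
have b0 : 0 < b by rewrite lt_min ltr01 divr_gt0.
exists (`|C| / b ^+ n); split; first by rewrite divr_ge0// exprn_ge0// ltW.
move=> L hL; have L0 : 0 <= L.
  by apply: le_trans hL; rewrite divr_ge0// exprn_ge0// ltW.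
have h1 : b * (1 + L) <= 1 + a * L / n%:R.
  rewrite mulrDr mulr1 lerD//; first by rewrite ge_min lexx.
  by rewrite mulrAC ler_wpM2r// ge_min lexx orbT.
have -> : expR (a * L) = expR (a * L / n%:R) ^+ n.
  by rewrite -expRM_natl mulrCA divff ?mulr1 ?pnatr_eq0.
apply: (@le_trans _ _ ((b * (1 + L)) ^+ n)); last first.
  rewrite lerXn2r ?nnegrE ?expR_ge0//.
    by rewrite mulr_ge0 ?addr_ge0// ltW.
  exact: le_trans h1 (expR_ge1Dx _).
rewrite exprMn [(1 + L) ^+ n]exprS mulrA ler_wpM2r ?exprn_ge0 ?addr_ge0//.
apply: le_trans (ler_norm C) _.
rewrite mulrC -ler_pdivrMr ?exprn_gt0//; apply: le_trans hL _.
by rewrite lerDr.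
Qed.

Lemma exp_ge_cst (a C : R) : 0 < a ->
  exists L0 : R, 0 <= L0 /\ forall L, L0 <= L -> C <= expR (a * L).
Proof.
move=> a0; have [L0 [h1 h2]] := @poly_le_exp a C 0 a0.
by exists L0; split => // L /h2; rewrite expr0 mulr1.
Qed.

Lemma ln_nat_ge (L0 : R) : exists N0 : nat, (0 < N0)%N /\
  forall N : nat, (N0 <= N)%N -> L0 <= ln (N%:R : R).
Proof.
exists (Num.truncn (expR L0)).+1; split => // N hN.
have h : expR L0 <= N%:R.
  by rewrite ltW// (lt_le_trans (truncnS_gt _))// ler_nat.
rewrite -[L0]expRK ler_ln// ?posrE ?expR_gt0//.
exact: lt_le_trans (expR_gt0 _) h.
Qed.

Lemma expR_ln_nat (N : nat) : (0 < N)%N -> expR (ln N%:R) = N%:R :> R.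
Proof. by move=> N0; rewrite lnK// posrE ltr0n. Qed.

Lemma truncn_exp (x : R) :
  expR x < (Num.truncn (expR x)).+1%:R /\ (Num.truncn (expR x)).+1%:R <= expR x + 1.
Proof.
split; first exact: truncnS_gt.
by rewrite -natr1 lerD2r truncn_le// expR_ge0.
Qed.

End growth.

Section tail_bound.
Variables (R : realType) (p : nat -> nat -> R) (chi : R).
Hypothesis p_ge0 : forall N n, 0 <= p N n.
Hypothesis p_le1 : forall N n, p N n <= 1.
Hypothesis p_le : forall N m n, (m <= n)%N -> p N n <= p N m.
Hypothesis p_eq0 : forall N n, (N <= n)%N -> p N n = 0.
Hypothesis p_rec : forall N b m k A l (q r : R), (N <= m * b)%N -> 0 <= q ->
  (forall N', (N' <= minn b N)%N -> p N' A <= q) ->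
  (forall N', (N' <= minn b N)%N -> p N' l <= r) ->
  p N (m * A.+1 + k * l) <= (m%:R * q) ^+ k + m%:R * r.

(** The expectation of the diameter of N blocks as a sum of its tails, which vanish from N on. *)
Definition mean_diam (N : nat) : R := \sum_(n < N) p N n.

Hypothesis chi_ge0 : 0 <= chi.
Hypothesis mean_le : forall a : R, 0 < a -> exists N0 : nat, forall N : nat,
  (N0 <= N)%N -> mean_diam N <= expR ((chi + a) * ln N%:R).

(** Markov's inequality in terms of tails: the first A + 1 of them are all at least [p N A]. *)
Lemma markov_diam N A : A.+1%:R * p N A <= mean_diam N.
Proof.
have [NA|AN] := leqP N A; first by rewrite p_eq0// mulr0 sumr_ge0.
rewrite /mean_diam -(big_mkord predT (fun n => p N n)) (big_cat_nat (leq0n A.+1) AN)/=.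
rewrite -[leLHS]addr0 lerD//; last by rewrite sumr_ge0.
rewrite -[X in X%:R * _]subn0 mulr_natl -sumr_const_nat.
by apply: ler_sum_nat => i /andP[_ iA]; exact: p_le.
Qed.

Lemma mean_diam_le N : mean_diam N <= N%:R.
Proof.
have -> : N%:R = \sum_(n < N) (1 : R) by rewrite sumr_const card_ord.
by apply: ler_sum => i _; exact: p_le1.
Qed.

Section iteration.
Variables (m k A N : nat) (q : R).
Hypotheses (m0 : (0 < m)%N) (k0 : (0 < k)%N) (q0 : 0 <= q).
Hypothesis hq : forall N', (N' <= N)%N -> p N' A <= q.

(** The threshold obtained for lengths up to m^(i + 1), starting from the trivial bound m for
    lengths up to m. Each scale costs only a factor k, of order log N, besides the common term m (A
    + 1). *)
Fixpoint diam_level (i : nat) : nat :=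
  if i is i'.+1 then (m * A.+1 + k * diam_level i')%N else m.

Lemma diam_level_le i : (diam_level i <= i.+1 * (k ^ i * (m * A.+1)))%N.
Proof.
elim: i => [|i IH] /=; first by rewrite mul1n expn0 mul1n leq_pmulr.
have h : (m * A.+1 <= k ^ i.+1 * (m * A.+1))%N.
  by rewrite leq_pmull// expn_gt0 k0.
apply: leq_trans (leq_add h (leq_mul (leqnn k) IH)) _.
by move: (m * A.+1)%N => M; rewrite [(k * _)%N]mulnCA [(k * _)%N]mulnA -expnS -mulSn.
Qed.

Lemma diam_level_tail i N' : (N' <= m ^ i.+1)%N -> (N' <= N)%N ->
  p N' (diam_level i) <= i%:R * m%:R ^+ i * (m%:R * q) ^+ k.
Proof.
elim: i N' => [|i IH] N' hN' N'N.
  by rewrite p_eq0 ?mul0r// -[leqRHS]expn1.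
have mq0 : 0 <= (m%:R * q) ^+ k by rewrite exprn_ge0// mulr_ge0.
apply: (le_trans (@p_rec N' (m ^ i.+1) m k A (diam_level i) q
    (i%:R * m%:R ^+ i * (m%:R * q) ^+ k) _ q0 _ _)).
- by rewrite -expnS.
- by move=> M; rewrite leq_min => /andP[_ h]; apply: hq; exact: leq_trans N'N.
- move=> M; rewrite leq_min => /andP[h1 h2]; apply: IH => //.
  exact: leq_trans N'N.
rewrite -natr1 mulrDl mul1r mulrDl addrC lerD//.
  by rewrite exprS !mulrA [m%:R * _]mulrC.
by rewrite ler_peMl// exprn_ege1// ler1n.
Qed.

End iteration.

Lemma diam_tail_bound (u : R) : 0 < u <= 1 ->
  exists N0 : nat, forall N : nat, (N0 <= N)%N -> forall l : nat,
    expR ((chi + u) * ln N%:R) < l.+1%:R ->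
    p N l <= expR (- (u ^+ 2 / 16 * ln N%:R ^+ 2)).
Proof.
move=> /andP[u0 u1].
have u8 : 0 < u / 8 by lra.
have [M0 hM0] := mean_le u8.
(* Lengths shrink by a factor m of order N^(u/8) at each scale, so more than 8 / u scales exhaust
   N. *)
pose Q := (Num.truncn (8 / u)).+1.
have [Q1 Q2] : 8 / u < Q%:R /\ Q%:R <= 8 / u + 1.
  by split; [exact: truncnS_gt|rewrite /Q -[leLHS]natr1 lerD2r truncn_le// divr_ge0// ltW].
have [L1 [L1_0 hL1]] := @exp_ge_cst R (u / 8) (M0%:R + 2) u8.
have [L2 [L2_0 hL2]] := @poly_le_exp R (u / 4) (4 * Q%:R) Q ltac:(lra).
have [L3 [L3_0 hL3]] := @exp_ge_cst R 1 (Q%:R * 2 ^+ Q) ltac:(lra).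
(* The constant 34 makes (1 + 9/8) L at most u^2 L^2 / 16: half of the exponent u^2 L^2 / 8 of (m
   q)^k pays for the prefactor Q m^Q. *)
have [N0 [N00 hN0]] := @ln_nat_ge R (L1 + L2 + L3 + 34 / u ^+ 2).
exists N0 => N hN l hl.
have N_gt0 : (0 < N)%N by exact: leq_trans hN.
have NE := @expR_ln_nat R N N_gt0.
have u2 : 0 < u ^+ 2 by rewrite exprn_gt0.
have u34 : 0 <= 34 / u ^+ 2 by rewrite divr_ge0// ltW.
have := hN0 N hN; move: NE hl; set L := ln _ => NE hl hL.
have LL1 : L1 <= L by lra. have LL2 : L2 <= L by lra.
have LL3 : L3 <= L by lra. have L34 : 34 / u ^+ 2 <= L by lra.
have L_0 : 0 <= L by lra.
pose m := (Num.truncn (expR (u / 8 * L))).+1.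
have [m1 m2] := truncn_exp (u / 8 * L); rewrite -/m in m1 m2.
have {}m2 : m%:R <= 2 * expR (u / 8 * L).
  apply: le_trans m2 _; rewrite [leRHS]mulr_natl mulr2n lerD2l.
  by apply: expR_ge1; rewrite mulr_ge0// ltW.
pose A := Num.truncn (expR ((chi + u / 2) * L)).
have [A1 A2] := truncn_exp ((chi + u / 2) * L); rewrite -/A in A1 A2.
have {}A2 : A.+1%:R <= 2 * expR ((chi + u / 2) * L).
  apply: le_trans A2 _; rewrite [leRHS]mulr_natl mulr2n lerD2l.
  by apply: expR_ge1; rewrite mulr_ge0// addr_ge0// ltW// divr_gt0.
pose k := (Num.truncn (u * L)).+1.
have uL0 : 0 <= u * L by rewrite mulr_ge0// ltW.
have [k1 k2] : u * L < k%:R /\ k%:R <= u * L + 1.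
  by split; [exact: truncnS_gt|rewrite /k -[leLHS]natr1 lerD2r truncn_le].
(* Markov's inequality with mean at most N^(chi + u/8) and threshold N^(chi + u/2). The margin 3 u /
   8 beats m twice over, so that m q <= N^(-u/8) in spite of rounding. *)
pose q := expR (- (3 / 8 * u * L)).
have hq N' : (N' <= N)%N -> p N' A <= q.
  move=> N'N; have N'E : mean_diam N' <= expR ((chi + u / 8) * L).
    have [MN|NM] := leqP M0 N'.
      have [->|N'0] := posnP N'; first by rewrite /mean_diam big_ord0 expR_ge0.
      apply: le_trans (hM0 _ MN) _; rewrite ler_expR; apply: ler_wpM2l; first by rewrite addr_ge0// ltW.
      by rewrite ler_ln ?posrE ?ltr0n// ler_nat.
    apply: le_trans (mean_diam_le _) _.
    apply: (@le_trans _ _ (expR (u / 8 * L))).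
      have := hL1 L LL1; apply: le_trans.
      by rewrite -[leLHS]addr0 lerD// ler_nat ltnW.
    by rewrite ler_expR ler_wpM2r// lerDr.
  have A10 : 0 < expR ((chi + u / 2) * L) := expR_gt0 _.
  rewrite -(ler_pM2l A10) -expRD.
  apply: (@le_trans _ _ (mean_diam N')).
    by apply: le_trans (markov_diam N' A); rewrite ler_wpM2r// ltW.
  by apply: le_trans N'E _; rewrite ler_expR; lra.
have mq : m%:R * q <= expR (- (u / 8 * L)).
  apply: (@le_trans _ _ (expR (u / 8 * L) * expR (u / 8 * L) * q)).
    rewrite ler_wpM2r ?expR_ge0//; apply: le_trans m2 _.
    rewrite ler_wpM2r ?expR_ge0//; have := hL1 L LL1; apply: le_trans.
    by rewrite lerDr.
  by rewrite -!expRD ler_expR; lra.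
have NmQ : (N <= m ^ Q)%N.
  rewrite -(ler_nat R) -NE natrX.
  apply: (@le_trans _ _ (expR (u / 8 * L) ^+ Q)); last by rewrite lerXn2r ?nnegrE ?expR_ge0// ltW.
  rewrite -expRM_natl ler_expR mulrA -[leLHS]mul1r ler_wpM2r//.
  by rewrite mulrC -ler_pdivrMl// mulr1 invf_div ltW.
have Qlvl : (diam_level m k A Q.-1 <= l)%N.
  rewrite -ltnS -(ltr_nat R); apply: le_lt_trans hl.
  apply: (@le_trans _ _ (Q%:R * (k%:R ^+ Q * (m%:R * A.+1%:R)))).
    rewrite -natrX -!natrM ler_nat; apply: leq_trans (diam_level_le m A _ _) _ => //.
    by rewrite leq_mul2l leq_mul2r leq_pexp2l ?orbT// leq_pred.
  have mA : m%:R * A.+1%:R <= 4 * expR ((chi + 5 / 8 * u) * L).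
    have -> : 4 * expR ((chi + 5 / 8 * u) * L) =
      2 * expR (u / 8 * L) * (2 * expR ((chi + u / 2) * L)).
      rewrite mulrACA -expRD -natrM; congr (_ * expR _); lra.
    by rewrite ler_pM.
  apply: (@le_trans _ _ (expR (u / 4 * L) * expR ((chi + 5 / 8 * u) * L))); last first.
    by rewrite -expRD ler_expR; nra.
  apply: (@le_trans _ _ (4 * Q%:R * (1 + L) ^+ Q * expR ((chi + 5 / 8 * u) * L))); last first.
    by rewrite ler_wpM2r ?expR_ge0// hL2.
  have kL : k%:R ^+ Q <= (1 + L) ^+ Q.
    rewrite lerXn2r ?nnegrE// ?addr_ge0//; apply: le_trans k2 _.
    by rewrite addrC lerD2l ler_piMl.
  apply: (@le_trans _ _ (Q%:R * ((1 + L) ^+ Q * (4 * expR ((chi + 5 / 8 * u) * L))))).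
    by rewrite ler_wpM2l// ler_pM// ?exprn_ge0// mulr_ge0.
  by rewrite le_eqVlt; apply/orP; left; apply/eqP; ring.
apply: le_trans (p_le N Qlvl) _.
have q0 : 0 <= q by exact: expR_ge0.
have m_gt0 : (0 < m)%N by [].
have := diam_level_tail k m_gt0 q0 hq (i := Q.-1) NmQ (leqnn N).
move=> /le_trans; apply.
apply: (@le_trans _ _ (Q%:R * m%:R ^+ Q * expR (- (u / 8 * L)) ^+ k)).
  apply: ler_pM; rewrite ?mulr_ge0 ?exprn_ge0 ?mulr_ge0 ?expR_ge0//.
    by rewrite ler_pM// ?ler_nat// ler_weXn2l// ler1n.
  by rewrite lerXn2r ?nnegrE ?mulr_ge0 ?expR_ge0.
apply: (@le_trans _ _ (expR L * expR (9 / 8 * L) * expR (- (u / 8 * L) * (u * L)))).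
  apply: ler_pM; rewrite ?mulr_ge0 ?exprn_ge0 ?expR_ge0//; last first.
    by rewrite -expRM_natl ler_expR [leLHS]mulrC ler_wnM2l ?oppr_le0 ?mulr_ge0 ?(ltW u8)// ltW.
  apply: (@le_trans _ _ (Q%:R * (2 ^+ Q * expR (u / 8 * L) ^+ Q))).
    by rewrite ler_wpM2l// -exprMn lerXn2r ?nnegrE// mulr_ge0 ?expR_ge0.
  rewrite mulrA ler_pM ?mulr_ge0 ?exprn_ge0 ?expR_ge0//.
    by rewrite -[X in expR X]mul1r hL3.
  rewrite -expRM_natl ler_expR mulrA ler_wpM2r//.
  have : Q%:R * (u / 8) <= (8 / u + 1) * (u / 8) by rewrite ler_wpM2r// ltW.
  have -> : (8 / u + 1) * (u / 8) = 1 + u / 8 by field; rewrite gt_eqF.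
  lra.
rewrite -!expRD ler_expR.
have : 34 <= u ^+ 2 * L by rewrite mulrC -ler_pdivrMr.
move=> h; have := ler_wpM2r L_0 h; nra.
Qed.

End tail_bound.

(** * Transfer to a reference realisation *)

Section standardization.
Variables (R : realType) (gamma : R).

Lemma bm_standardize alpha d (T : measurableType d) (P : probability T R)
    (Z : R -> T -> R * R) (eps : R) : 0 < alpha -> 0 < eps ->
  mated_crt_brownian_motion gamma alpha P Z ->
  exists2 k, 0 < k & mated_crt_brownian_motion gamma 1 P
    (fun t w => rescale_path k eps (Z ^~ w) t : R * R).
Proof.
move=> a0 e0 bmZ; exists (Num.sqrt (eps * alpha)^-1).
  by rewrite sqrtr_gt0 invr_gt0 mulr_gt0.
have := @bm_affine R gamma alpha d T P Z bmZ 0 eps (Num.sqrt (eps * alpha)^-1) e0.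
rewrite sqr_sqrtr; last by rewrite invr_ge0 mulr_ge0// ltW.
by rewrite -mulrA mulVf ?mulf_neq0 ?gt_eqF.
Qed.

Variables (d : measure_display) (T : measurableType d).
Variables (P : probability T R) (Z : R -> T -> R * R).
Hypothesis bmZ : mated_crt_brownian_motion gamma 1 P Z.
Notation pr := (path_prob P Z).

(** Rescaling brings every realisation, for every alpha and eps, to the law of the reference one;
    the bounds thereby become uniform over all realisations. *)
Lemma path_prob_transfer alpha d' (T' : measurableType d') (P' : probability T' R)
    (Z' : R -> T' -> R * R) (eps : R) : 0 < alpha -> 0 < eps ->
  mated_crt_brownian_motion gamma alpha P' Z' ->
  exists2 k, 0 < k & forall a b E, path_sigma a b E ->
    measurable [set w | E (rescale_path k eps (Z' ^~ w))] /\
    P' [set w | E (rescale_path k eps (Z' ^~ w))] = (pr E)%:E.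
Proof.
move=> a0 e0 bmZ'; have [k k0 bmk] := bm_standardize a0 e0 bmZ'.
exists k => // a b E sE; split; first exact: (bm_measurable_event bmk sE).
rewrite /path_prob -PrE; last exact: measurable_event bmZ _ _ _ sE.
exact: (bm_law bmk bmZ sE).
Qed.

Lemma diam_tail0 N : (1 < N)%N -> diam_tail P Z N 0 = 1.
Proof.
move=> N1; rewrite /diam_tail /path_prob -(Pr_setT P); congr (Pr P _).
apply/seteqP; split => w //= _; apply/negP => /diam_leP/(_ 0%N 1%N).
by rewrite /= N1 (ltnW N1) => /(_ isT isT).
Qed.

Notation mean := (mean_diam (diam_tail P Z)).

Lemma mean_diam_ge1 N : (1 < N)%N -> 1 <= mean N.
Proof.
move=> N1.
have := markov_diam (diam_tail_ge0 P Z) (diam_tail_le bmZ) (diam_tail_eq0 P Z) N 0.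
by rewrite mul1r diam_tail0.
Qed.

Lemma integral_graph_diam alpha d' (T' : measurableType d') (P' : probability T' R)
    (Z' : R -> T' -> R * R) (eps : R) : 0 < alpha -> 0 < eps <= 1 ->
  mated_crt_brownian_motion gamma alpha P' Z' ->
  (\int[P']_w graph_diam R (mated_crt_map01 (Z' ^~ w) eps) =
   (mean (Num.truncn eps^-1))%:E)%E.
Proof.
move=> a0 /andP[e0 e1] bmZ'; have [k k0 hk] := path_prob_transfer a0 e0 bmZ'.
set N := Num.truncn _.
have N0 : (0 < N)%N.
  by rewrite truncn_gt0 invf_ge1.
pose F n : set (planar_path R) := [set z | ~~ path_diam_le z 0 N n].
pose G n := [set w | F n (rescale_path k eps (Z' ^~ w))].
have [mG PG] : (forall n, measurable (G n)) /\ (forall n, P' (G n) = (diam_tail P Z N n)%:E).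
  by split => n; have [] := hk 0%N N (F n) (path_sigma_diam_gt n (leqnn 0) (leqnn N)).
transitivity (\int[P']_w (\sum_(n <- index_iota 0 N) (\1_(G n) w)%:E))%E.
  apply: eq_integral => w _.
  have cz : continuous (Z' ^~ w) by exact: (bm_continuous bmZ').
  rewrite (graph_diam_sum cz k0 e0)// -/N.
  rewrite sumEFin big_mkord; congr (_%:E); apply: eq_bigr => n _.
  rewrite indicE; congr (nat_of_bool _)%:R.
  by apply/idP/idP; rewrite inE.
rewrite ge0_integral_sum//.
  by rewrite /mean_diam -sumEFin big_mkord; apply: eq_bigr => n _; rewrite integral_indic// setIT; exact: PG.
move=> n; apply/measurable_EFinP; exact: measurable_indic.
Qed.

Variable chi : R.
Hypothesis hchi : is_distance_exponent gamma chi.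

Lemma cvg_mean_diam :
  ln (mean n.+2) / ln n.+2%:R @[n --> \oo] --> chi.
Proof.
have := hchi ltr01 bmZ; move=> /fine_cvgP[_ /cvg_at_rightP h].
(* Along eps = 1 / (n + 2) there are exactly n + 2 blocks. Starting at 2 keeps the logarithm of 1 /
   eps positive and the mean diameter at least 1. *)
have := h (fun n => n.+2%:R^-1); rewrite /= => {}h.
have {}h : fine (lne (\int[P]_w graph_diam R (mated_crt_map01 (Z^~ w) n.+2%:R^-1)) /
    (ln n.+2%:R^-1^-1)%:E)%E @[n --> \oo] --> chi.
  apply: h; split; first by move=> n; rewrite invr_gt0.
  have : (harmonic n.+1 : R) @[n --> \oo] --> (0 : R).
    by rewrite (cvg_shiftS (@harmonic R)); exact: cvg_harmonic.
  by [].
apply: cvg_trans h; apply: near_eq_cvg; apply: nearW => n.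
rewrite (integral_graph_diam ltr01 _ bmZ); last first.
  by rewrite invr_gt0 ltr0n /= invf_le1// ler1n.
rewrite invrK natrK lne_EFin; last by rewrite (lt_le_trans ltr01)// mean_diam_ge1.
rewrite inver; case: eqP => [l0|_ //].
by have := @ln_gt0 R n.+2%:R; rewrite ltr1n l0 ltxx => /(_ isT).
Qed.

Lemma mean_diam_near (a : R) : 0 < a -> exists N0 : nat, forall N : nat, (N0 <= N)%N ->
  expR ((chi - a) * ln N%:R) <= mean N <= expR ((chi + a) * ln N%:R).
Proof.
move=> a0; have /cvgrPdist_le/(_ _ a0)[M _ hM] := cvg_mean_diam.
exists M.+2 => -[|[|N]]// hN; have := hM N.
rewrite /= => /(_ _)/wrap[]; first exact: hN.
have l0 : 0 < ln N.+2%:R :> R by rewrite ln_gt0// ltr1n.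
have m0 : 0 < mean N.+2 by rewrite (lt_le_trans ltr01)// mean_diam_ge1.
rewrite ler_distlC => /andP[h1 h2].
have -> : mean N.+2 = expR (ln (mean N.+2)) by rewrite lnK.
rewrite !ler_expR -(ler_pdivlMr _ _ l0) -(ler_pdivrMr _ _ l0).
by rewrite h1 h2.
Qed.

(** Two or more blocks have mean diameter at least 1, whereas a negative exponent would force it
    below 1. *)
Lemma distance_exponent_ge0 : 0 <= chi.
Proof.
rewrite leNgt; apply/negP => chi0.
have [N0 hN0] := @mean_diam_near (- chi / 2) ltac:(lra).
have := hN0 (N0 + 2)%N (leq_addr _ _) => /andP[_].
rewrite leNgt => /negP; apply; apply: (@lt_le_trans _ _ 1); last first.
  by apply: mean_diam_ge1; rewrite addn2.
have l0 : 0 < ln (N0 + 2)%:R :> R by rewrite ln_gt0// ltr1n addn2.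
rewrite -[ltRHS]expR0 ltr_expR pmulr_llt0//; lra.
Qed.

End standardization.

Section upper_bound.
Variables (R : realType) (gamma chi : R).
Variables (d : measure_display) (T : measurableType d).
Variables (P : probability T R) (Z : R -> T -> R * R).
Hypothesis bmZ : mated_crt_brownian_motion gamma 1 P Z.
Hypothesis hchi : is_distance_exponent gamma chi.
Notation p := (diam_tail P Z).

Lemma diam_tail_decay (u : R) : 0 < u ->
  exists N0 : nat, forall N : nat, (N0 <= N)%N -> forall l : nat,
    expR ((chi + u) * ln N%:R) < l.+1%:R ->
    p N l <= expR (- (u ^+ 2 / 16 * ln N%:R ^+ 2)).
Proof.
move=> u0; have chi0 := distance_exponent_ge0 bmZ hchi.
(* For u > 1 the threshold is beyond N, because chi >= 0, and there the tail vanishes. *)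
have [u1|u1] := leP u 1; last first.
  exists 1%N => N N1 l hl; rewrite diam_tail_eq0 ?expR_ge0//.
  rewrite -ltnS -(ltr_nat R); apply: le_lt_trans hl.
  rewrite -[leLHS](@expR_ln_nat R) // ler_expR ler_peMl ?ln_ge0 ?ler1n//.
  lra.
apply: (diam_tail_bound (diam_tail_ge0 P Z) (diam_tail_le1 bmZ) (diam_tail_le bmZ)
  (diam_tail_eq0 P Z) (diam_tail_rec bmZ) chi0); last by rewrite u0.
move=> a a0; have [N0 hN0] := mean_diam_near bmZ hchi a0.
by exists N0 => N /hN0/andP[].
Qed.

Lemma powR_eps (eps a : R) : 0 < eps -> eps `^ (- a) = expR (a * ln eps^-1).
Proof. by move=> e0; rewrite /powR gt_eqF// lnV// mulrN mulNr. Qed.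

(** Comparing N with the square root of 1 / eps halves the logarithm at worst, which turns the rate
    1/16 into 1/64. *)
Lemma truncn_inv_bounds (eps : R) : 0 < eps <= 1 / 4 ->
  [/\ (0 < Num.truncn eps^-1)%N, ln (Num.truncn eps^-1)%:R <= ln eps^-1 &
      ln eps^-1 / 2 <= ln (Num.truncn eps^-1)%:R].
Proof.
move=> /andP[e0 e4]; set N := Num.truncn _.
have x4 : 4 <= eps^-1 by rewrite -[4]invrK lef_pV2 ?posrE ?invr_gt0//; lra.
have x0 : 0 < eps^-1 by rewrite invr_gt0.
have /andP[N1 N2] := truncn_itv (ltW x0); rewrite -/N in N1 N2.
have N0 : (0 < N)%N by rewrite truncn_gt0; lra.
split => //; first by rewrite ler_ln ?posrE ?ltr0n.
have -> : ln eps^-1 / 2 = ln (Num.sqrt eps^-1).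
  have : ln (Num.sqrt eps^-1 ^+ 2) = ln eps^-1 by rewrite sqr_sqrtr// ltW.
  by rewrite lnXn ?sqrtr_gt0// => <-; rewrite mulr2n; field.
rewrite ler_ln ?posrE ?sqrtr_gt0 ?ltr0n//.
have s2 : 2 <= Num.sqrt eps^-1.
  by rewrite -(ler_pXn2r (n := 2))// ?nnegrE ?sqrtr_ge0// sqr_sqrtr ?(ltW x0)// expr2; lra.
have := sqr_sqrtr (ltW x0); rewrite expr2; rewrite -natr1 in N2; nra.
Qed.

Lemma graph_diam_upper_bound (u : R) : 0 < u ->
  exists eps0 : R, 0 < eps0 /\
    forall (alpha : R) (d' : measure_display) (T' : measurableType d')
      (P' : probability T' R) (Z' : R -> T' -> R * R),
    0 < alpha -> mated_crt_brownian_motion gamma alpha P' Z' ->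
    forall eps : R, 0 < eps <= eps0 ->
      ((1 - 1 * expR (- (1 / 64) * u ^+ 2 * ln (eps^-1) ^+ 2))%:E
        <= P' [set w | (graph_diam R (mated_crt_map01 (Z' ^~ w) eps)
                        <= (eps `^ (- chi - u))%:E)%E])%E.
Proof.
move=> u0; have [N0 hN0] := diam_tail_decay u0.
have chi0 := distance_exponent_ge0 bmZ hchi.
exists (Num.min (1 / 4) N0.+1%:R^-1); split; first by rewrite lt_min invr_gt0 ltr0n andbT; lra.
move=> alpha d' T' P' Z' a0 bmZ' eps /andP[e0]; rewrite le_min => /andP[e4 eN].
have [Npos NL LN] := @truncn_inv_bounds eps ltac:(by rewrite e0).
set N := Num.truncn _ in Npos NL LN; set L := ln eps^-1 in NL LN *.
have N0N : (N0 <= N)%N.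
  rewrite truncn_ge_nat ?invr_ge0 ?(ltW e0)//.
  apply: (@le_trans _ _ N0.+1%:R); first by rewrite ler_nat.
  by rewrite -[leLHS]invrK lef_pV2 ?posrE ?invr_gt0.
have [k k0 hk] := path_prob_transfer bmZ a0 e0 bmZ'.
have -> : eps `^ (- chi - u) = expR ((chi + u) * L) by rewrite -opprD powR_eps.
set lam := expR ((chi + u) * L); pose l := Num.truncn lam.
have /andP[l1 l2] : l%:R <= lam < l.+1%:R := truncn_itv (expR_ge0 _).
pose E := [set z : planar_path R | path_diam_le z 0 N l].
have [mE PE] := hk 0%N N E (path_sigma_diam l (leqnn 0) (leqnn N)).
have -> : [set w | (graph_diam R (mated_crt_map01 (Z'^~ w) eps) <= lam%:E)%E] =
    [set w | E (rescale_path k eps (Z'^~ w))].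
  apply/funext => w; rewrite /mkset; apply/propext.
  have cz : continuous (Z' ^~ w) by exact: (bm_continuous bmZ').
  rewrite (graph_diam_le cz k0 e0 (expR_ge0 _)) -/N; split; last by move=> h; exists l.
  move=> [n nlam]; apply: diam_le_leq.
  by rewrite -ltnS -(ltr_nat R) (le_lt_trans nlam).
rewrite PE lee_fin mul1r.
have sE' : path_sigma 0 N [set z : planar_path R | ~~ path_diam_le z 0 N l].
  exact: path_sigma_diam_gt.
have -> : path_prob P Z E = 1 - p N l.
  rewrite /diam_tail /path_prob -Pr_setC; last exact: (measurable_event bmZ sE').
  by congr (Pr P _); apply/seteqP; split => w /=; [move=> ->|move=> /negP; rewrite negbK].
rewrite lerD2l lerN2.
have lN0 : 0 <= ln N%:R :> R by rewrite ln_ge0// ler1n.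
apply: le_trans (hN0 N N0N l _) _.
  by apply: le_lt_trans l2; rewrite ler_expR ler_wpM2l// addr_ge0// ltW.
rewrite ler_expR.
have L0 : 0 <= L / 2.
  rewrite divr_ge0// ln_ge0// invf_ge1//; lra.
have sq : (L / 2) ^+ 2 <= ln N%:R ^+ 2 by rewrite lerXn2r ?nnegrE.
have := ler_wpM2l (sqr_ge0 u) sq; lra.
Qed.

End upper_bound.

(** * Pinching estimates for Brownian motion *)

Section normal_estimates.
Variable R : realType.
Notation mu := (@lebesgue_measure R).
Implicit Types (s K : R) (A : set (measurableTypeR R)).

Lemma measurable_EFin_normal_pdf s A :
  measurable_fun A (fun x => (normal_pdf 0 s x)%:E).
Proof. by apply/measurable_funTS/measurable_EFinP; exact: measurable_normal_pdf. Qed.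

(** Outside (-K, K) the ratio of the two densities is largest at distance K from 0. It yields the
    tail bound for a unit step as well as the comparison of linear combinations in
    [quadrant_gt0]. *)
Lemma normal_prob_compare s1 s2 K A : 0 < s2 < s1 -> 0 <= K -> measurable A ->
  (forall x, A x -> K <= `|x|) ->
  (normal_prob 0 s2 A <=
   (s1 / s2 * expR (- (K ^+ 2 / 2 * ((s2 ^+ 2)^-1 - (s1 ^+ 2)^-1))))%:E *
     normal_prob 0 s1 A)%E.
Proof.
move=> /andP[s20 s12] K0 mA AK; have s10 : 0 < s1 by exact: lt_trans s12.
rewrite /normal_prob -ge0_integralZl_EFin//; first last.
- by rewrite mulr_ge0 ?expR_ge0// divr_ge0 ?(ltW s10) ?(ltW s20).
- exact: measurable_EFin_normal_pdf.
- by move=> x _; rewrite lee_fin normal_pdf_ge0.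
apply: ge0_le_integral => //.
- by move=> x _; rewrite lee_fin normal_pdf_ge0.
- exact: measurable_EFin_normal_pdf.
- by apply/measurable_EFinP; apply: measurable_funM => //; apply/measurable_funTS; exact: measurable_normal_pdf.
move=> x Ax; rewrite -EFinM lee_fin !normal_pdfE ?gt_eqF//.
have pk : normal_peak s2 = s1 / s2 * normal_peak s1.
  have sq s : 0 < s -> normal_peak s = s^-1 * (Num.sqrt (pi *+ 2))^-1.
    move=> s0; rewrite /normal_peak -mulrnAr sqrtrM ?sqr_ge0// sqrtr_sqr.
    by rewrite gtr0_norm// invfM.
  by rewrite !sq// mulrAC mulrA divff ?gt_eqF// mul1r mulrC.
rewrite {1}pk -!mulrA ler_wpM2l ?(ltW s10)//.
rewrite ler_wpM2l ?invr_ge0 ?(ltW s20)// [leRHS]mulrCA ler_wpM2l ?normal_peak_ge0//.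
rewrite /normal_fun -expRD ler_expR subr0.
set a := (s2 ^+ 2)^-1; set b := (s1 ^+ 2)^-1.
have -> : - x ^+ 2 / (s2 ^+ 2 *+ 2) = - (x ^+ 2 / 2 * a).
  by rewrite -mulr_natr invfM /a; ring.
have -> : - x ^+ 2 / (s1 ^+ 2 *+ 2) = - (x ^+ 2 / 2 * b).
  by rewrite -mulr_natr invfM /b; ring.
have ab : 0 <= a - b.
  by rewrite subr_ge0 lef_pV2 ?posrE ?exprn_gt0// lerXn2r ?nnegrE ?ltW.
have Kx : K ^+ 2 <= x ^+ 2.
  by rewrite -[leRHS]real_normK ?num_real// lerXn2r ?nnegrE//; exact: AK.
have := ler_wpM2r ab Kx; lra.
Qed.

Lemma normal_prob_ball s (a : R) : 0 < s -> 0 <= a ->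
  (normal_prob 0 s `[(- a)%R, a]%classic <= (2 * a / s)%:E)%E.
Proof.
move=> s0 a0; apply: (@le_trans _ _ (\int[mu]_(x in `[(- a)%R, a]) (s^-1)%:E))%E.
  apply: ge0_le_integral => //.
  - by move=> x _; rewrite lee_fin normal_pdf_ge0.
  - exact: measurable_EFin_normal_pdf.
  move=> x _; rewrite lee_fin; apply: le_trans (normal_pdf_ub _ _ _) _; first by rewrite gt_eqF.
  rewrite /normal_peak lef_pV2 ?posrE//; last first.
    by rewrite sqrtr_gt0 mulrn_wgt0// mulr_gt0 ?pi_gt0// exprn_gt0.
  rewrite -[leLHS](gtr0_norm s0) -sqrtr_sqr ler_sqrt; last first.
    by rewrite mulrn_wge0// mulr_ge0 ?pi_ge0// sqr_ge0.
  rewrite -mulrnAr ler_peMr ?sqr_ge0// mulr2n; have := pi_ge2 R; lra.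
rewrite integral_cst//= lebesgue_measure_itv/= lte_fin.
case: ltP => h; last by rewrite mule0 lee_fin mulr_ge0 ?invr_ge0 ?mulr_ge0// ltW.
by rewrite -EFinB -EFinM lee_fin; lra.
Qed.

Lemma normal_prob_ray_gt0 s K : 0 < s -> 0 <= K ->
  (0 < normal_prob 0 s `]K, +oo[%classic)%E.
Proof.
move=> s0 K0; apply: (@lt_le_trans _ _ (normal_prob 0 s `]K, K + 1]%classic)); last first.
  apply: le_measure; rewrite ?inE//.
  by move=> x /=; rewrite !in_itv/= andbT => /andP[].
apply: (@lt_le_trans _ _ (\int[mu]_(x in `]K, (K + 1)%R]) (normal_pdf 0 s (K + 1))%:E))%E.
  rewrite integral_cst//= lebesgue_measure_itv/= lte_fin ltrDl ltr01.
  rewrite -EFinB -EFinM lte_fin addrAC subrr add0r mulr1 normal_pdfE ?gt_eqF//.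
  by rewrite mulr_gt0 ?expR_gt0// normal_peak_gt0 ?gt_eqF.
apply: ge0_le_integral => //.
- by move=> x _; rewrite lee_fin normal_pdf_ge0.
- exact: measurable_EFin_normal_pdf.
move=> x /=; rewrite in_itv/= => /andP[x1 x2]; rewrite lee_fin !normal_pdfE ?gt_eqF//.
rewrite ler_wpM2l ?normal_peak_ge0// ler_expR !subr0 !mulNr lerN2.
rewrite ler_wpM2r ?invr_ge0 ?mulrn_wge0 ?sqr_ge0//.
by rewrite lerXn2r ?nnegrE//; lra.
Qed.

End normal_estimates.

Section gaussian_increments.
Variables (R : realType) (gamma : R).
Variables (d : measure_display) (T : measurableType d).
Variables (P : probability T R) (Z : R -> T -> R * R).
Hypothesis bmZ : mated_crt_brownian_motion gamma 1 P Z.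

Definition is_coord (co : R * R -> R) := co = fst \/ co = snd.

Lemma is_coordB co (x y : R * R) : is_coord co -> co (x - y) = co x - co y.
Proof. by move=> [] ->. Qed.

Lemma measurable_lin_increment (a b s t : R) (A : set (measurableTypeR R)) :
  measurable A -> measurable [set w | A (a * (increment Z s t w).1 + b * (increment Z s t w).2)].
Proof.
move=> mA; have := measurableT_comp (measurable_lin_form a b) (bm_measurable_increment bmZ s t).
by move=> /(_ measurableT _ mA); rewrite setTI.
Qed.

Lemma measurable_coord_increment co s t (A : set (measurableTypeR R)) :
  is_coord co -> measurable A -> measurable [set w | A (co (increment Z s t w))].
Proof.
move=> [] -> mA.
  have := measurable_lin_increment 1 0 s t mA; congr measurable.
  by apply/funext => w; rewrite /mkset mul1r mul0r addr0.
have := measurable_lin_increment 0 1 s t mA; congr measurable.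
by apply/funext => w; rewrite /mkset mul1r mul0r add0r.
Qed.

Lemma coord_increment_law co s t (A : set (measurableTypeR R)) : is_coord co ->
  s < t -> measurable A ->
  P [set w | A (co (increment Z s t w))] = normal_prob 0 (Num.sqrt (t - s)) A.
Proof.
move=> hco st mA; have ts : t - s != 0 by rewrite subr_eq0 gt_eqF.
case: hco => ->.
  have /(_ 1 0 A mA) := bm_gaussian bmZ (ltW st).
  rewrite /centered_normal expr1n expr0n/= !mul1r mul0r mulr0 mul0r !addr0.
  rewrite (negbTE ts) => <-; congr (P _).
  by apply/funext => w; rewrite /mkset mul1r mul0r addr0.
have /(_ 0 1 A mA) := bm_gaussian bmZ (ltW st).
rewrite /centered_normal expr1n expr0n/= !mul1r !mulr0 !mul0r add0r addr0.
rewrite (negbTE ts) => <-; congr (P _).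
by apply/funext => w; rewrite /mkset mul1r mul0r add0r.
Qed.

Lemma coord_increment_opp co s t (A : set (measurableTypeR R)) : is_coord co ->
  s < t -> measurable A ->
  P [set w | A (- co (increment Z s t w))] = normal_prob 0 (Num.sqrt (t - s)) A.
Proof.
move=> hco st mA; have ts : t - s != 0 by rewrite subr_eq0 gt_eqF.
case: hco => ->.
  have /(_ (-1) 0 A mA) := bm_gaussian bmZ (ltW st).
  rewrite /centered_normal sqrrN expr1n expr0n/= !mul1r !mul0r !mulr0 !mul0r !addr0.
  rewrite (negbTE ts) => <-; congr (P _).
  by apply/funext => w; rewrite /mkset mulN1r mul0r addr0.
have /(_ 0 (-1) A mA) := bm_gaussian bmZ (ltW st).
rewrite /centered_normal sqrrN expr1n expr0n/= !mul1r !mulr0 !mul0r add0r addr0.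
rewrite (negbTE ts) => <-; congr (P _).
by apply/funext => w; rewrite /mkset mulN1r mul0r add0r.
Qed.

Lemma coord_increment_lt0 co s t : is_coord co -> s <= t ->
  Pr P [set w | co (increment Z s t w) < 0] <= 1 / 2.
Proof.
move=> hco; rewrite le_eqVlt => /orP[/eqP <-|st].
  rewrite (_ : [set _ | _] = set0) ?Pr_set0 ?divr_ge0//.
  apply/seteqP; split => w //=; rewrite /increment subrr.
  by case: hco => -> /=; rewrite ltxx.
have m1 := measurable_coord_increment s t hco (@measurable_lt_set R 0).
have m2 := measurable_coord_increment s t hco (@measurable_itv R `]0, +oo[).
have e : Pr P [set w | co (increment Z s t w) < 0] =
    Pr P [set w | `]0, +oo[%classic (co (increment Z s t w))].
  congr fine; rewrite (coord_increment_law hco st (@measurable_itv R `]0, +oo[)).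
  rewrite -(coord_increment_opp hco st (@measurable_itv R `]0, +oo[)); congr (P _).
  by apply/funext => w; rewrite /mkset /= in_itv/= andbT oppr_gt0.
suff : Pr P [set w | co (increment Z s t w) < 0] +
    Pr P [set w | `]0, +oo[%classic (co (increment Z s t w))] <= 1 by rewrite -e; lra.
rewrite -lerBrDl -(Pr_setC P m1); apply: le_Pr => //; first exact: measurableC.
by move=> w /=; rewrite in_itv/= andbT => h; apply/negP; rewrite -leNgt ltW.
Qed.

Lemma coord_increment_ball co s t (a : R) : is_coord co -> s < t -> 0 <= a ->
  Pr P [set w | `[- a, a]%classic (co (increment Z s t w))] <= 2 * a / Num.sqrt (t - s).
Proof.
move=> hco st a0; have mi := @measurable_itv R `[- a, a].
rewrite -lee_fin -PrE; last exact: measurable_coord_increment.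
rewrite coord_increment_law//; apply: normal_prob_ball => //.
by rewrite sqrtr_gt0 subr_gt0.
Qed.

Lemma coord_increment_unit_tail co (t h : R) : is_coord co -> 0 <= h ->
  Pr P [set w | co (increment Z t (t + 1) w) < - h] <= 2 * expR (- (h ^+ 2 / 4)).
Proof.
move=> hco h0; have t1 : t < t + 1 by rewrite ltrDl.
rewrite -lee_fin -PrE; last first.
  exact: (measurable_coord_increment t (t + 1) hco (measurable_lt_set (- h))).
rewrite (coord_increment_law hco t1 (measurable_lt_set (- h))).
rewrite addrAC subrr add0r sqrtr1.
(* Comparison with the normal law of variance 2, bounded by its total mass: the exponent becomes
   (h^2 / 2) (1 - 1/2) and the prefactor sqrt 2 is at most 2. *)
have s21 : 1 < Num.sqrt 2 :> R by rewrite -{1}sqrtr1 ltr_sqrt ?ltr1n.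
have K x : [set x : measurableTypeR R | x < - h] x -> h <= `|x|.
  by move=> /= xh; rewrite ler0_norm; lra.
have := normal_prob_compare (s1 := Num.sqrt 2) (s2 := 1) _ h0 (measurable_lt_set (- h)) K.
rewrite ltr01 s21 => /(_ isT) /le_trans; apply.
rewrite sqr_sqrtr// expr1n invr1 mulr1.
have -> : h ^+ 2 / 2 * (1 - 2^-1) = h ^+ 2 / 4 by field.
apply: (@le_trans _ _ ((Num.sqrt 2 * expR (- (h ^+ 2 / 4)))%:E * 1))%E.
  apply: lee_wpmul2l; first by rewrite lee_fin mulr_ge0 ?expR_ge0.
  exact: (@probability_le1 _ _ _ (normal_prob 0 (Num.sqrt 2)) _ (measurable_lt_set (- h))).
rewrite mule1 lee_fin ler_wpM2r ?expR_ge0//.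
by rewrite -(ler_pXn2r (n := 2))// ?nnegrE// sqr_sqrtr// expr2; lra.
Qed.

Hypothesis hgamma : 0 < gamma < 2.

Let c : R := - cos (pi * gamma ^+ 2 / 4).

Lemma correlation_bounds : -1 < c < 1.
Proof.
have /andP[g0 g2] := hgamma; have pi0 := pi_gt0 R.
have g4 : gamma ^+ 2 < 4 by rewrite expr2; nra.
have gg : 0 < gamma ^+ 2 by rewrite exprn_gt0.
have x0 : 0 < pi * gamma ^+ 2 / 4 by rewrite divr_gt0// mulr_gt0.
have xpi : pi * gamma ^+ 2 / 4 < pi.
  by rewrite -mulrA gtr_pMr//; lra.
have sin0 := @sin_gt0_pi R (pi * gamma ^+ 2 / 4).
rewrite x0 xpi in sin0; have {sin0}s0 := sin0 isT.
have := cos2Dsin2 (pi * gamma ^+ 2 / 4).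
have : 0 < sin (pi * gamma ^+ 2 / 4) ^+ 2 by rewrite exprn_gt0.
rewrite /c; set x := cos _; set y := sin _ ^+ 2 => y0 xy.
have x2 : x ^+ 2 < 1 by lra.
rewrite ltrNl opprK; apply/andP; split; nra.
Qed.

Lemma lin_increment_law (a b v : R) (A : set (measurableTypeR R)) : measurable A ->
  v = a ^+ 2 + b ^+ 2 + 2 * a * b * c -> 0 < v ->
  P [set w | A (a * (increment Z 0 1 w).1 + b * (increment Z 0 1 w).2)] =
  normal_prob 0 (Num.sqrt v) A.
Proof.
move=> mA vE v0; have /(_ a b A mA) := bm_gaussian bmZ ler01.
rewrite subr0 !mulr1 mulN1r -/c -vE => ->.
by rewrite /centered_normal gt_eqF.
Qed.

(* If one coordinate is nonpositive while the sum exceeds K, then so does a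
   linear combination of smaller variance, which is much less likely. *)
Lemma quadrant_gt0 : exists2 r : R, 0 < r &
  0 < Pr P [set w | r <= (increment Z 0 1 w).1 /\ r <= (increment Z 0 1 w).2].
Proof.
have /andP[c1 c2] := correlation_bounds.
(* With X and Y the coordinates of the increment, v1 is the variance of X + Y, and v2 that of X - c
   Y and of Y - c X. That v2 < v1 is (1 + c) (1 - c) < 2 (1 + c). *)
pose v1 := 2 + 2 * c; pose v2 := 1 - c ^+ 2.
have v20 : 0 < v2 by rewrite /v2 subr_gt0 expr2; nra.
have v12 : v2 < v1 by rewrite /v1 /v2 expr2; nra.
have v10 : 0 < v1 by exact: lt_trans v12.
pose s1 := Num.sqrt v1; pose s2 := Num.sqrt v2.
have s20 : 0 < s2 by rewrite sqrtr_gt0.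
have s12 : s2 < s1 by rewrite ltr_sqrt.
pose del := v2^-1 - v1^-1.
have del0 : 0 < del by rewrite subr_gt0 ltf_pV2 ?posrE.
have [K [K0 hK]] := @exp_ge_cst R (del / 2) (4 * (s1 / s2)) ltac:(lra).
pose K1 := K + 1.
pose A : set (measurableTypeR R) := `]K1, +oo[%classic.
have mA : measurable A by exact: measurable_itv.
(* The ratio 1/4 is chosen because two exceptional events have to be removed from S, which leaves
   half of its mass. *)
have rat : s1 / s2 * expR (- (K1 ^+ 2 / 2 * ((s2 ^+ 2)^-1 - (s1 ^+ 2)^-1))) <= 1 / 4.
  rewrite !sqr_sqrtr ?(ltW v10) ?(ltW v20)// -/del expRN.
  rewrite ler_pdivrMr ?expR_gt0//.
  have : 4 * (s1 / s2) <= expR (K1 ^+ 2 / 2 * del).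
    apply: le_trans (hK K (lexx K)) _; rewrite ler_expR /K1 expr2; nra.
  lra.
have AK x : A x -> K1 <= `|x|.
  rewrite /A /= in_itv/= andbT => h; apply: le_trans (ltW h) _; exact: ler_norm.
have K10 : 0 <= K1 by rewrite addr_ge0.
have n21 : (normal_prob 0 s2 A <= (1 / 4)%:E * normal_prob 0 s1 A)%E.
  apply: le_trans (@normal_prob_compare R s1 s2 K1 A _ K10 mA AK) _; first by rewrite s20.
  by apply: lee_wpmul2r => //; rewrite lee_fin.
have n10 : (0 < normal_prob 0 s1 A)%E by apply: normal_prob_ray_gt0; rewrite ?sqrtr_gt0.
pose X w := (increment Z 0 1 w).1; pose Y w := (increment Z 0 1 w).2.
pose S := [set w | A (1 * X w + 1 * Y w)].
pose B1 := [set w | A (1 * X w + (- c) * Y w)].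
pose B2 := [set w | A ((- c) * X w + 1 * Y w)].
have mS : measurable S by exact: measurable_lin_increment.
have mB1 : measurable B1 by exact: measurable_lin_increment.
have mB2 : measurable B2 by exact: measurable_lin_increment.
have PS : P S = normal_prob 0 s1 A.
  by apply: lin_increment_law => //; rewrite /v1; ring.
have PB1 : P B1 = normal_prob 0 s2 A.
  by apply: lin_increment_law => //; rewrite /v2; ring.
have PB2 : P B2 = normal_prob 0 s2 A.
  by apply: lin_increment_law => //; rewrite /v2; ring.
pose Q r := [set w | r <= X w /\ r <= Y w].
have mge r : measurable [set x : measurableTypeR R | r <= x].
  have := measurableC (measurable_lt_set r); congr measurable.
  by apply/seteqP; split => x /=; rewrite leNgt => /negP.
have mQ r : measurable (Q r).
  apply: measurableI.
    exact: (measurable_coord_increment 0 1 (or_introl erefl) (mge r)).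
  exact: (measurable_coord_increment 0 1 (or_intror erefl) (mge r)).
apply: contrapT => hno.
have Q0 (n : nat) : P (Q n.+1%:R^-1) = 0%E.
  rewrite PrE//; congr (_%:E); apply/eqP; rewrite eq_le Pr_ge0 andbT leNgt.
  apply/negP => h; apply: hno; exists n.+1%:R^-1 => //; by rewrite invr_gt0.
have mU : measurable (\bigcup_n Q n.+1%:R^-1) by exact: bigcupT_measurable.
have U0 : P (\bigcup_n Q n.+1%:R^-1) = 0%E.
  apply/negligibleP => //; apply: negligible_bigcup => n.
  by apply/negligibleP; [exact: mQ|exact: Q0].
(* If Y <= 0 then X - c Y = (X + Y) - (1 + c) Y >= X + Y, and symmetrically for X. If both are
   positive, they exceed some 1 / (n + 1). *)
have sub : S `<=` \bigcup_n Q n.+1%:R^-1 `|` (B1 `|` B2).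
  move=> w; rewrite /S /B1 /B2 /A /= !in_itv/= !andbT !mul1r => hS.
  have [Y0|Y0] := leP (Y w) 0; first by right; left; nra.
  have [X0|X0] := leP (X w) 0; first by right; right; nra.
  left; have m0 : 0 < Num.min (X w) (Y w) by rewrite lt_min X0.
  exists (Num.truncn (Num.min (X w) (Y w))^-1) => //=.
  have : (Num.truncn (Num.min (X w) (Y w))^-1).+1%:R^-1 <= Num.min (X w) (Y w).
    by rewrite invf_ple ?posrE// ltW// truncnS_gt.
  by rewrite le_min => /andP.
have U0' : (P (\bigcup_n Q (n.+1%:R^-1)%R) <= 0)%E by rewrite U0.
have B1le : (P B1 <= (1 / 4)%:E * P S)%E by rewrite PB1 PS.
have B2le : (P B2 <= (1 / 4)%:E * P S)%E by rewrite PB2 PS.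
have : (P S <= 0 + ((1 / 4)%:E * P S + (1 / 4)%:E * P S))%E.
  apply: le_trans (le_measure P _ _ sub) _; rewrite ?inE//.
    by apply: measurableU => //; exact: measurableU.
  apply: le_trans (measureU2 P mU (measurableU _ _ mB1 mB2)) _.
  apply: leeD; first exact: U0'.
  apply: le_trans (measureU2 P mB1 mB2) _.
  by apply: leeD; [exact: B1le|exact: B2le].
have : (0 < P S)%E by rewrite PS.
rewrite (PrE P mS) add0e -EFinM -EFinD lee_fin lte_fin; lra.
Qed.

End gaussian_increments.

Section more_probability.
Variables (R : realType) (d : measure_display) (T : measurableType d).
Variable P : probability T R.

Lemma Pr_bigcup_sum n (A : nat -> set T) :
  (forall i, (i < n)%N -> measurable (A i)) ->
  Pr P (\bigcup_(i < n) A i) <= \sum_(i < n) Pr P (A i).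
Proof.
elim: n => [|n IH] h.
  rewrite big_ord0 (_ : \bigcup_(i < 0) A i = set0) ?Pr_set0//.
  by apply/seteqP; split => x // -[].
have -> : \bigcup_(i < n.+1) A i = \bigcup_(i < n) A i `|` A n.
  by rewrite !bigcup_mkord big_ord_recr.
have hn i : (i < n)%N -> measurable (A i) by move=> /ltnW; exact: h.
apply: le_trans (Pr_setU P (measurable_bigcup_lt hn) (h n (ltnSn n))) _.
by rewrite big_ord_recr /= lerD2r IH.
Qed.

Lemma Pr_setD_sub A B : measurable A -> measurable B -> B `<=` A ->
  Pr P (A `\` B) = Pr P A - Pr P B.
Proof.
move=> mA mB BA; apply/eqP; rewrite eq_le Pr_setD// andbT.
rewrite lerBrDr -lee_fin EFinD -!PrE//; last exact: measurableD.
rewrite -measureU//; last 2 first.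
- exact: measurableD.
- by rewrite setDE -setIA setICl setI0.
apply: le_measure; rewrite ?inE//.
  by apply: measurableU => //; exact: measurableD.
by move=> x [[]//|/BA].
Qed.

End more_probability.

(** * Probability of not dropping in a window *)

Section no_hit.
Variables (R : realType) (gamma : R).
Variables (d : measure_display) (T : measurableType d).
Variables (P : probability T R) (Z : R -> T -> R * R).
Hypothesis bmZ : mated_crt_brownian_motion gamma 1 P Z.
Notation pr := (path_prob P Z).

Lemma path_sigma_nat co a b i l (B : set (measurableTypeR R)) : is_coord co ->
  (a <= i <= b)%N -> (a <= l <= b)%N -> measurable B ->
  path_sigma a b [set z : planar_path R | B (co (z i%:R) - co (z l%:R))].
Proof.
have d0 k : dyadic R 0 k = k%:R by rewrite -[k in LHS]muln1 (dyadic_nat R 0).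
rewrite -!d0 => -[] -> hi hl mB.
  by apply: path_sigma_coord1; rewrite ?muln1.
by apply: path_sigma_coord2; rewrite ?muln1.
Qed.

Definition no_hit (co : R * R -> R) (h : R) (n : nat) : set (planar_path R) :=
  [set z | forall i, (i < n)%N -> - h < co (z i%:R) - co (z 0%:R)].

Lemma path_sigma_no_hit co h n m : is_coord co -> (n <= m.+1)%N ->
  path_sigma 0 m (no_hit co h n).
Proof.
move=> hco; elim: n => [|n IH] nm.
  by rewrite (_ : no_hit _ _ _ = setT); [exact: path_sigmaT|apply/seteqP; split].
rewrite (_ : no_hit _ _ _ = no_hit co h n `&`
   [set z | `](- h), +oo[%classic (co (z n%:R) - co (z 0%:R))]).
  apply: path_sigmaI; first by apply: IH; exact: ltnW.
  by apply: path_sigma_nat => //; exact: measurable_itv.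
apply/seteqP; split => z /=.
  by move=> h'; split; [move=> i ilt; apply: h'; exact: ltnW|rewrite in_itv/= andbT; exact: h'].
rewrite in_itv/= andbT => -[h1 h2] i; rewrite ltnS leq_eqVlt => /orP[/eqP ->//|].
exact: h1.
Qed.

(* The reflection principle for the walk of the integer times, up to the
   overshoot of a single step. *)
Lemma no_hit_prob co h m : is_coord co -> 0 < h -> (0 < m)%N ->
  pr (no_hit co h m.+1) <= 4 * h / Num.sqrt m%:R + 4 * m%:R * expR (- (h ^+ 2 / 4)).
Proof.
move=> hco h0 m0.
pose X : T -> planar_path R := fun w => Z ^~ w.
pose S k w := co (increment Z 0%:R k%:R w).
have S0 w : S 0 w = 0 by rewrite /S /increment subrr; case: hco => ->.
have SE k w : co (X w k%:R) - co (X w 0%:R) = S k w by rewrite -is_coordB.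
pose NH k := no_hit co h k.
have sNH k n : (k <= n.+1)%N -> path_sigma 0 n (NH k) := @path_sigma_no_hit co h k n hco.
have mNH k : measurable (X @^-1` NH k) := measurable_event bmZ (sNH k k (leqnSn k)).
pose A k := NH k `\` NH k.+1.
have NHS k : NH k.+1 `<=` NH k by move=> z hz i ik; apply: hz; exact: ltnW.
have sA k : path_sigma 0 k (A k).
  rewrite /A setDE; apply: path_sigmaI; first by apply: sNH; exact: leqnSn.
  by apply: path_sigmaC; exact: sNH.
have PA k : pr (A k) = pr (NH k) - pr (NH k.+1).
  rewrite /path_prob -[X @^-1` A k]/(X @^-1` NH k `\` X @^-1` NH k.+1).
  by rewrite Pr_setD_sub// => w /NHS.
pose D k : set (planar_path R) :=
  [set z | [set x : measurableTypeR R | x < 0] (co (z m%:R) - co (z k%:R))].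
have sD k : (k <= m)%N -> path_sigma k m (D k).
  by move=> km; apply: path_sigma_nat => //; [rewrite km leqnn|rewrite leqnn km|exact: measurable_lt_set].
have PD k : (k <= m)%N -> pr (D k) <= 1 / 2.
  move=> km; have km' : k%:R <= m%:R :> R by rewrite ler_nat.
  apply: le_trans (coord_increment_lt0 bmZ hco km').
  by rewrite le_eqVlt; apply/orP; left; apply/eqP; congr (Pr P _); apply/funext => w;
    rewrite /mkset /preimage /D /mkset -is_coordB.
pose O k := [set w | co (increment Z k%:R (k%:R + 1) w) < - h].
have mO k : measurable (O k).
  exact: (measurable_coord_increment bmZ _ _ hco (measurable_lt_set (- h))).
have PO k : Pr P (O k) <= 2 * expR (- (h ^+ 2 / 4)).
  exact: (coord_increment_unit_tail bmZ k%:R hco (ltW h0)).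
(* Let k be the first time at level -h or below. To end below -2 h, the walk must either arrive at
   time k by a step below -h, or decrease between k and m. The latter has probability at most 1/2,
   independently of the past. *)
pose B := [set w | S m w < - (2 * h)].
have mB : measurable B.
  exact: (measurable_coord_increment bmZ _ _ hco (measurable_lt_set (- (2 * h)))).
have mAD k : (k <= m)%N -> measurable (X @^-1` (A k `&` D k)).
  move=> km; apply: (measurable_event bmZ (a := 0%N) (b := m)); apply: path_sigmaI.
    by apply: (path_sigma_sub (leqnn 0) km).
  by apply: (path_sigma_sub (leq0n k) (leqnn m)); exact: sD.
have Bsub : B `<=` \bigcup_(k < m.+1) (X @^-1` (A k `&` D k)) `|` \bigcup_(k < m) O k.
  move=> w Bw.
  have exk : exists k, `[< S k w <= - h >].
    by exists m; apply/asboolP; move: Bw; rewrite /B /=; lra.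
  have [k /asboolP Sk kmin] := ex_minnP exk.
  have km : (k <= m)%N by apply: kmin; apply/asboolP; move: Bw; rewrite /B /=; lra.
  have NHk : NH k (X w).
    move=> i ik; rewrite SE ltNge; apply/negP => /asboolP/kmin.
    by rewrite leqNgt ik.
  case: k => [|k] in Sk kmin km NHk *; first by move: Sk; rewrite S0; lra.
  have Sk1 := NHk k (ltnSn k); rewrite SE in Sk1.
  have [Ok|nOk] := pselect (O k w); first by right; exists k.
  left; exists k.+1 => //; split.
    split=> //; move=> hz; have := hz k.+1 (ltnSn _); rewrite SE; lra.
  rewrite /D /mkset -is_coordB// -[_ - _]/(increment Z k.+1%:R m%:R w).
  have stepE : co (increment Z k%:R (k%:R + 1) w) = S k.+1 w - S k w.
    by rewrite /S /increment !is_coordB// natr1; ring.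
  have lastE : co (increment Z k.+1%:R m%:R w) = S m w - S k.+1 w.
    by rewrite /S /increment !is_coordB//; ring.
  rewrite lastE; move: Bw nOk; rewrite /B /O /= stepE => Bw /negP; rewrite -leNgt; lra.
have PB : Pr P B <= 1 / 2 * (1 - pr (NH m.+1)) + m%:R * (2 * expR (- (h ^+ 2 / 4))).
  have mU1 : measurable (\bigcup_(k < m.+1) (X @^-1` (A k `&` D k))).
    by apply: measurable_bigcup_lt => k; exact: mAD.
  have mU2 : measurable (\bigcup_(k < m) O k) by apply: measurable_bigcup_lt.
  apply: le_trans (le_Pr P mB (measurableU _ _ mU1 mU2) Bsub) _.
  apply: le_trans (Pr_setU P mU1 mU2) _; apply: lerD; last by apply: Pr_bigcup.
  apply: le_trans (Pr_bigcup_sum P (n := m.+1) mAD) _.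
  have -> : 1 - pr (NH m.+1) = \sum_(k < m.+1) pr (A k).
    have : pr (NH 0%N) = 1.
      rewrite /path_prob -(Pr_setT P); congr (Pr P _).
      by apply/seteqP; split.
    move=> <-; elim: (m.+1) => [|n IH]; first by rewrite big_ord0 subrr.
    by rewrite big_ord_recr /= -IH PA; lra.
  rewrite mulr_sumr; apply: ler_sum => k _.
  have km : (k <= m)%N by rewrite -ltnS.
  rewrite -/(pr _) (path_prob_indep bmZ _ (sA k) (sD k km)) ?km//.
  by rewrite mulrC ler_wpM2r ?PD// Pr_ge0.
have m0' : 0%:R < m%:R :> R by rewrite ltr_nat.
have h20 : 0 <= 2 * h by lra.
pose C := [set w | `](2 * h), +oo[%classic (S m w)].
pose Ba := [set w | `[(- (2 * h)), (2 * h)]%classic (S m w)].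
have mC : measurable C by exact: (measurable_coord_increment bmZ _ _ hco (measurable_itv _)).
have mBa : measurable Ba by exact: (measurable_coord_increment bmZ _ _ hco (measurable_itv _)).
have PC : Pr P C = Pr P B.
  congr fine; rewrite (coord_increment_law bmZ hco m0' (measurable_itv _)).
  rewrite -(coord_increment_opp bmZ hco m0' (measurable_itv _)); congr (P _).
  by apply/funext => w; rewrite /B /mkset /= in_itv/= andbT ltrNr.
have PBa : Pr P Ba <= 4 * h / Num.sqrt m%:R.
  have := coord_increment_ball bmZ hco m0' h20; rewrite subr0 => /le_trans; apply.
  by rewrite mulrA -natrM.
(* By symmetry S_m > 2 h is as likely as S_m < -2 h, and twice [PB] leaves the probability of not
   hitting on the right-hand side. *)
have : 1 <= Pr P Ba + (Pr P B + Pr P C).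
  rewrite -(Pr_setT P); apply: le_trans (le_trans (Pr_setU P mBa (measurableU _ _ mB mC)) _).
    apply: le_Pr => //; first by apply: measurableU => //; exact: measurableU.
    move=> w _; have [h1|h1] := ltP (S m w) (- (2 * h)); first by right; left.
    have [h2|h2] := leP (S m w) (2 * h); first by left; rewrite /Ba /= in_itv/= h1.
    by right; right; rewrite /C /= in_itv/= h2.
  by rewrite lerD2l; exact: Pr_setU.
rewrite PC => h1; move: PB PBa h1; set x := expR _; set y := Num.sqrt _.
rewrite -/(NH m.+1); set b := Pr P B; set nh := pr _; set ba := Pr P Ba.
by move=> *; lra.
Qed.

End no_hit.

(** * Staying above a level by a chain of climbs *)

Section stay_above.
Variable R : realType.

(* Dyadic times suffice for continuous paths, and make the event measurable. *)
Definition stay_above (a b r : nat) (h : R) : set (planar_path R) :=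
  [set z | forall j l, (a * 2 ^ j <= l <= b * 2 ^ j)%N ->
     - h <= coord1 z (dyadic R j l) - coord1 z r%:R /\
     - h <= coord2 z (dyadic R j l) - coord2 z r%:R].

Lemma path_sigma_stay_above a b r h : (a <= r <= b)%N ->
  path_sigma a b (stay_above a b r h).
Proof.
move=> hr; have d0 k : dyadic R 0 k = k%:R by rewrite -[k in LHS]muln1 (dyadic_nat R 0).
have mge : measurable [set x : measurableTypeR R | - h <= x].
  have := measurableC (measurable_lt_set (- h)); congr measurable.
  by apply/seteqP; split => x /=; rewrite leNgt => /negP.
rewrite (_ : stay_above _ _ _ _ = \bigcap_j \bigcap_l
  [set z | (a * 2 ^ j <= l <= b * 2 ^ j)%N ->
     ([set z | [set x : measurableTypeR R | - h <= x] (coord1 z (dyadic R j l) - coord1 z (dyadic R 0 r))] `&`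
      [set z | [set x : measurableTypeR R | - h <= x] (coord2 z (dyadic R j l) - coord2 z (dyadic R 0 r))]) z]).
  do 2!(apply: path_sigma_bigcap => ?); apply: path_sigma_cond => hl.
  apply: path_sigmaI; [apply: path_sigma_coord1|apply: path_sigma_coord2] => //;
    by rewrite !muln1.
apply/seteqP; split => z /=; first by move=> hz j _ l _ /hz; rewrite d0.
by move=> hz j l hl; have := hz j I l I hl; rewrite /= d0.
Qed.

Lemma dyadic_near_le (f : R -> R) (a b : nat) (x c : R) : continuous f ->
  a%:R <= x <= b%:R ->
  (forall j l, (a * 2 ^ j <= l <= b * 2 ^ j)%N -> c <= f (dyadic R j l)) -> c <= f x.
Proof.
move=> cf xab h; rewrite leNgt; apply/negP => fx.
have [j [l [hl]]] := dyadic_near cf xab fx.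
by rewrite ltNge h.
Qed.

Lemma stay_aboveP a b r h (z : R -> R * R) : continuous z ->
  stay_above a b r h z <-> forall t co, is_coord co -> a%:R <= t <= b%:R ->
    - h <= co (z t) - co (z r%:R).
Proof.
move=> cz; split => hz.
  move=> t co hco tab; rewrite lerBrDr.
  case: hco => ->.
    apply: (@dyadic_near_le (fun t => (z t).1) a b) => //; first exact: continuous_path1.
    by move=> j l /hz[+ _]; rewrite /coord1 lerBrDr.
  apply: (@dyadic_near_le (fun t => (z t).2) a b) => //; first exact: continuous_path2.
  by move=> j l /hz[_]; rewrite /coord2 lerBrDr.
move=> j l /dyadic_itv hl; split.
  exact: (hz _ fst (or_introl erefl) (hl R)).
exact: (hz _ snd (or_intror erefl) (hl R)).
Qed.

(* Consecutive climbs at geometrically growing scales [s] keep the path above a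
   fixed level for ever at a cost logarithmic in the time. *)
Definition climb (rho r : R) (t s : nat) : set (planar_path R) :=
  stay_above t (t + s ^ 2) t (rho * s%:R) `&`
  [set z | r * s%:R <= coord1 z (t + s ^ 2)%:R - coord1 z t%:R /\
           r * s%:R <= coord2 z (t + s ^ 2)%:R - coord2 z t%:R].

Lemma path_sigma_climb rho r t s : path_sigma t (t + s ^ 2) (climb rho r t s).
Proof.
apply: path_sigmaI; first by apply: path_sigma_stay_above; rewrite leqnn leq_addr.
have mge : measurable [set x : measurableTypeR R | r * s%:R <= x].
  have := measurableC (measurable_lt_set (r * s%:R)); congr measurable.
  by apply/seteqP; split => x /=; rewrite leNgt => /negP.
apply: path_sigmaI.
  by apply: (path_sigma_nat (co := fst)) (mge) => //; [left|rewrite leq_addr leqnn|rewrite leqnn leq_addr].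
by apply: (path_sigma_nat (co := snd)) (mge) => //; [right|rewrite leq_addr leqnn|rewrite leqnn leq_addr].
Qed.

Lemma climbP rho r t s (z : R -> R * R) : continuous z ->
  climb rho r t s z <->
  (forall x co, is_coord co -> t%:R <= x <= (t + s ^ 2)%:R ->
     - (rho * s%:R) <= co (z x) - co (z t%:R)) /\
  (forall co, is_coord co -> r * s%:R <= co (z (t + s ^ 2)%:R) - co (z t%:R)).
Proof.
move=> cz; split.
  move=> [/(stay_aboveP _ _ _ _ cz) h1 [h2 h3]]; split => //.
  by move=> co [] ->.
move=> [h1 h2]; split; first exact/(stay_aboveP _ _ _ _ cz).
by split; [exact: (h2 fst (or_introl erefl))|exact: (h2 snd (or_intror erefl))].
Qed.

Section lengths.
Local Open Scope nat_scope.
Variables (S J : nat).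
Hypotheses (S0 : 0 < S) (J0 : 0 < J).

(** The sum of the scales of the first i climbs, so that r times it is a height already gained. The
    next scale is S plus a J-th part of this sum: as rho <= r J, the gained height pays for the next
    dip, except for rho S. The scales still grow geometrically. *)
Fixpoint climbed (i : nat) : nat :=
  if i is i'.+1 then climbed i' + (S + climbed i' %/ J) else 0.

Definition climb_len i := S + climbed i %/ J.

Fixpoint climb_time (i : nat) : nat :=
  if i is i'.+1 then climb_time i' + climb_len i' ^ 2 else 0.

Lemma climbed_mono i j : i <= j -> climbed i <= climbed j.
Proof.
by move=> /subnK <-; elim: (j - i) => // n IH; rewrite addSn (leq_trans IH)//= leq_addr.
Qed.

Lemma climbed_add i j : climbed i + j * climb_len i <= climbed (i + j).
Proof.
elim: j => [|j IH]; first by rewrite mul0n !addn0.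
rewrite addnS /= mulSnr addnA; apply: leq_add => //.
by rewrite leq_add2l leq_div2r// climbed_mono// leq_addr.
Qed.

Lemma climbed_lenJ i : climbed i <= J * climb_len i.
Proof.
rewrite /climb_len mulnDr; have := divn_eq (climbed i) J; have := ltn_pmod (climbed i) J0.
have : J <= J * S by rewrite leq_pmulr.
by move: (climbed i %/ J) (climbed i %% J) => q m; rewrite [q * J]mulnC; lia.
Qed.

Lemma climbed_double i : 2 * climbed i <= climbed (i + J).
Proof.
apply: leq_trans (climbed_add i J); have := climbed_lenJ i; lia.
Qed.

Lemma climbed_geometric k : 2 ^ k * S <= climbed (k * J).+1.
Proof.
elim: k => [|k IH]; first by rewrite mul0n /= div0n !addn0 add0n mul1n.
rewrite expnS -mulnA [(k.+1 * J)%N]mulSn [(J + _)%N]addnC -addSn.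
by apply: leq_trans (climbed_double _); rewrite leq_mul2l IH orbT.
Qed.

(** The last climb alone lasts long enough: its scale is at least the J-th part of the sum of all
    previous scales, and its duration is the square of the scale. *)
Lemma climb_time_ge k N : N * J ^ 2 <= (2 ^ k * S) ^ 2 ->
  N <= climb_time (k * J).+2.
Proof.
move=> h; rewrite /=; apply: leq_trans (leq_addl _ _).
have J2 : 0 < J ^ 2 by rewrite expn_gt0 J0.
rewrite -(leq_pmul2r J2); apply: leq_trans h _.
rewrite -expnMn leq_exp2r//; apply: leq_trans (climbed_geometric k) _.
by rewrite [leqRHS]mulnC; exact: (climbed_lenJ (k * J).+1).
Qed.

End lengths.

Lemma climb_chain (rho r : R) (S J n : nat) (z : R -> R * R) :
  (0 < S)%N -> (0 < J)%N -> 0 <= r -> rho <= r * J%:R -> 0 <= rho -> continuous z ->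
  (forall i, (i < n)%N -> climb rho r (climb_time S J i) (climb_len S J i) z) ->
  (forall x co, is_coord co -> 0 <= x <= (climb_time S J n)%:R ->
     - (rho * S%:R) <= co (z x) - co (z 0)) /\
  (forall co, is_coord co -> r * (climbed S J n)%:R <= co (z (climb_time S J n)%:R) - co (z 0)).
Proof.
move=> S0 J0 r0 rJ rho0 cz; elim: n => [|n IH] h.
  have e x : 0 <= x <= 0%:R -> x = 0 :> R by move=> h0; apply/eqP; rewrite eq_le andbC.
  split => [x co hco /e ->|co hco].
    by rewrite subrr oppr_le0 mulr_ge0.
  by rewrite /= mulr0 subrr.
have [h1 h2] := IH (fun i im => h i (ltnW im)).
have /(climbP _ _ _ _ cz)[h3 h4] := h n (ltnSn n).
split=> [x co hco /andP[x0 x1]|co hco].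
  have [xn|xn] := leP x (climb_time S J n)%:R; first by apply: h1 => //; rewrite x0.
  have := h3 x co hco; rewrite (ltW xn) x1 => /(_ isT) h3x.
  have h2n := h2 co hco.
  have : rho * (climb_len S J n)%:R <= rho * S%:R + r * (climbed S J n)%:R.
    rewrite /climb_len natrD mulrDr lerD2l.
    apply: (@le_trans _ _ (r * J%:R * (climbed S J n %/ J)%N%:R)).
      by rewrite ler_wpM2r.
    by rewrite -mulrA ler_wpM2l// -natrM ler_nat mulnC leq_divM.
  lra.
have -> : r * (climbed S J n.+1)%:R = r * (climbed S J n)%:R + r * (climb_len S J n)%:R.
  by rewrite -mulrDr -natrD.
have := h4 co hco; have := h2 co hco; rewrite [climb_time _ _ n.+1]/=; lra.
Qed.

End stay_above.

Section pinch_probability.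
Variables (R : realType) (gamma : R).
Variables (d : measure_display) (T : measurableType d).
Variables (P : probability T R) (Z : R -> T -> R * R).
Hypothesis bmZ : mated_crt_brownian_motion gamma 1 P Z.
Hypothesis hgamma : 0 < gamma < 2.
Notation pr := (path_prob P Z).

(** A continuous path is bounded below on [0, 1], so the events decrease to the empty set as rho
    grows. *)
Lemma bm_bounded_below (e : R) : 0 < e -> exists2 rho : R, 0 <= rho &
  pr (~` stay_above 0 1 0 rho) < e.
Proof.
move=> e0; pose X : T -> planar_path R := fun w => Z ^~ w.
pose F n := X @^-1` ~` stay_above 0 1 0 (n%:R : R).
have mF n : measurable (F n).
  by apply: (measurable_event bmZ (a := 0%N) (b := 1%N)); apply: path_sigmaC; apply: path_sigma_stay_above.
have ndF : nonincreasing_seq F.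
  move=> m n mn; apply/subsetPset => w; apply: contra_not => hw j l hl.
  have mn' : m%:R <= n%:R :> R by rewrite ler_nat.
  by have [h1 h2] := hw j l hl; split; lra.
have F0 : \bigcap_n F n = set0.
  apply/seteqP; split => w //= hw.
  have cz : continuous (Z ^~ w) by exact: (bm_continuous bmZ).
  have lb (f : R -> R) : continuous f -> exists M, forall x, 0 <= x <= 1 -> M <= f x.
    move=> cf; have [|c _ hc] := @EVT_min R f 0 1 ler01; first exact: continuous_subspaceT.
    by exists (f c) => x x01; apply: hc; rewrite in_itv.
  have [M1 hM1] := lb _ (continuous_path1 cz).
  have [M2 hM2] := lb _ (continuous_path2 cz).
  pose B := `|M1 - (Z 0%:R w).1| + `|M2 - (Z 0%:R w).2|.
  apply: (hw (Num.truncn B).+1 I) => /=; apply/(stay_aboveP _ _ _ _ cz) => t co hco t01.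
  have BB := truncnS_gt B.
  have n1 := ler_normlW (lexx `|M1 - (Z 0%:R w).1|).
  have := ler_norm (- (M1 - (Z 0%:R w).1)); have := ler_norm (- (M2 - (Z 0%:R w).2)).
  rewrite !normrN => a1 a2.
  have b1 := normr_ge0 (M1 - (Z 0%:R w).1); have b2 := normr_ge0 (M2 - (Z 0%:R w).2).
  move: BB; rewrite /B => BB.
  by case: hco => ->; [have := hM1 t t01|have := hM2 t t01]; lra.
have cvg0 : P (F n) @[n --> \oo] --> 0%E.
  rewrite -(measure0 P) -F0; apply: nonincreasing_cvg_mu => //.
  - exact: le_lt_trans (probability_le1 P (mF 0%N)) (ltry 1).
  - by rewrite F0.
have /fine_cvgP[_ /cvgrPdist_lt/(_ _ e0)[N _ hN]] := cvg0.
exists N%:R => //; have := hN N (leqnn N); rewrite /= sub0r normrN.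
by apply: le_lt_trans; rewrite /path_prob /Pr; exact: ler_norm.
Qed.

Lemma path_prob_rescale (t s : nat) (E : set (planar_path R)) a b : (0 < s)%N ->
  path_sigma a b E ->
  pr [set z | E (fun x => pair_scale s%:R^-1 (z (t%:R + (s ^ 2)%:R * x) - z t%:R))] = pr E.
Proof.
move=> s0 sE.
have s2 : 0 < (s ^ 2)%:R :> R by rewrite ltr0n expn_gt0 s0.
have := @bm_affine R gamma 1 d T P Z bmZ t%:R (s ^ 2)%:R s%:R^-1 s2.
rewrite mulr1 natrX -exprMn mulVf ?pnatr_eq0 -?lt0n// expr1n => bm'.
by rewrite /path_prob /Pr (bm_law bmZ bm' sE).
Qed.

Lemma climb_prob (rho r : R) (t s : nat) : (0 < s)%N ->
  pr (climb rho r t s) = pr (climb rho r 0 1).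
Proof.
move=> s0; rewrite -(path_prob_rescale t s0 (@path_sigma_climb R rho r 0 1)).
congr (Pr P _); apply/funext => w; rewrite /preimage /mkset; apply/propext.
have cz : continuous (Z ^~ w) by exact: (bm_continuous bmZ).
have s0' : 0 < s%:R :> R by rewrite ltr0n.
have s20 : 0 < (s ^ 2)%:R :> R by rewrite ltr0n expn_gt0 s0.
pose z' : R -> R * R := fun x => pair_scale s%:R^-1 (Z (t%:R + (s ^ 2)%:R * x) w - Z t%:R w).
have cz' : continuous z'.
  have cZ : continuous (fun x : R => Z (t%:R + (s ^ 2)%:R * x) w).
    move=> x; apply: (@continuous_comp _ _ _ (fun x : R => t%:R + (s ^ 2)%:R * x) (fun x => Z x w)); last exact: cz.
    by apply: cvgD; [exact: cvg_cst|apply: cvgM; [exact: cvg_cst|exact: cvg_id]].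
  apply: continuous_pair => x; apply: cvgM; try exact: cvg_cst.
    by apply: cvgB; [exact: continuous_path1 cZ x|exact: cvg_cst].
  by apply: cvgB; [exact: continuous_path2 cZ x|exact: cvg_cst].
have coE co x : is_coord co -> co (z' x) - co (z' 0%:R) =
    (co (Z (t%:R + (s ^ 2)%:R * x) w) - co (Z t%:R w)) / s%:R.
  by case=> -> /=; rewrite mulr0 addr0 subrr mulr0 subr0 mulrC.
rewrite -/z' (climbP _ _ _ _ cz) (climbP _ _ _ _ cz'); split => -[h1 h2]; split.
- move=> x co hco; rewrite add0n => /andP[x0 x1]; rewrite coE//.
  rewrite mulr1 ler_pdivlMr// mulNr; apply: h1 => //.
  by rewrite lerDl natrD lerD2l ler_piMr ?mulr_ge0 ?(ltW s20).
- move=> co hco; rewrite coE// mulr1 ler_pdivlMr//.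
  by have := h2 co hco; rewrite natrD mulr1.
- move=> x co hco /andP[x0 x1].
  have := h1 ((x - t%:R) / (s ^ 2)%:R) co hco; rewrite coE// mulr1.
  have -> : (s ^ 2)%:R * ((x - t%:R) / (s ^ 2)%:R) = x - t%:R.
    by rewrite mulrC divfK ?gt_eqF.
  rewrite subrKC => H; rewrite -mulNr -ler_pdivlMr//; apply: H.
  rewrite divr_ge0 ?subr_ge0 ?(ltW s20)//= ler_pdivrMr// mul1r.
  by rewrite lerBlDl -natrD.
- move=> co hco; have := h2 co hco.
  by rewrite coE// (_ : (0 + 1 ^ 2)%:R = 1)// !mulr1 -natrD ler_pdivlMr.
Qed.

(** By Brownian scaling each climb has the same probability pi1, and climbs over successive
    intervals are independent. Their number is logarithmic in sqrt N / S, so the cost is a fixed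
    power of this ratio. *)
Lemma stay_above_prob : exists (pi1 rho : R) (J : nat),
  [/\ 0 < pi1 <= 1, 0 <= rho, (0 < J)%N &
    forall (S N k : nat), (0 < S)%N -> (N * J ^ 2 <= (2 ^ k * S) ^ 2)%N ->
      pi1 ^+ (k * J).+2 <= pr (stay_above 0 N 0 (rho * S%:R))].
Proof.
have [r r0 quad] := quadrant_gt0 bmZ hgamma.
(* With this rho, a dip below -rho is less likely than a rise of both coordinates by r, so a rise
   without such a dip has positive probability. *)
set q := Pr P _ in quad; have [rho rho0 hrho] := bm_bounded_below quad.
pose J := (Num.truncn (rho / r)).+1.
have rJ : rho <= r * J%:R.
  by rewrite mulrC -ler_pdivrMr// ltW// truncnS_gt.
pose pi1 := pr (climb rho r 0 1).
have mc := measurable_event bmZ (@path_sigma_climb R rho r 0 1).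
have pi10 : 0 < pi1.
  have mquad : measurable [set w | r <= (increment Z 0 1 w).1 /\ r <= (increment Z 0 1 w).2].
    have mge : measurable [set x : measurableTypeR R | r <= x].
      have := measurableC (measurable_lt_set r); congr measurable.
      by apply/seteqP; split => x /=; rewrite leNgt => /negP.
    apply: measurableI.
      exact: (measurable_coord_increment bmZ 0 1 (or_introl erefl) mge).
    exact: (measurable_coord_increment bmZ 0 1 (or_intror erefl) mge).
  have sst : path_sigma 0 1 (~` stay_above 0 1 0 rho).
    by apply: path_sigmaC; apply: path_sigma_stay_above.
  have := Pr_setD P mquad (measurable_event bmZ sst).
  have : 0 < q - pr (~` stay_above 0 1 0 rho) by lra.
  move=> /lt_le_trans h /h /lt_le_trans; apply; apply: le_Pr => //.
    by apply: measurableD => //; exact: (measurable_event bmZ sst).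
  move=> w [[/= h1 h2] /contrapT hs]; split; first by rewrite mulr1.
  by rewrite /= mulr1; split.
exists pi1, rho, J; split => //.
  by rewrite pi10; exact: Pr_le1.
move=> S N k S0 hN.
pose n := (k * J).+2.
pose U m : set (planar_path R) := [set z | forall i, (i < m)%N ->
   climb rho r (climb_time S J i) (climb_len S J i) z].
have tmono i : (climb_time S J i <= climb_time S J i.+1)%N by rewrite /= leq_addr.
have US m : U m.+1 = U m `&` climb rho r (climb_time S J m) (climb_len S J m).
  apply/seteqP; split => z /=.
    by move=> h; split; [move=> i im; apply: h; exact: ltnW|exact: h].
  move=> [h1 h2] i; rewrite ltnS leq_eqVlt => /orP[/eqP -> //|]; exact: h1.
have sU m : path_sigma 0 (climb_time S J m) (U m).
  elim: m => [|m IH].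
    by rewrite (_ : U 0%N = setT); [exact: path_sigmaT|apply/seteqP; split].
  rewrite US; apply: path_sigmaI; first by apply: (path_sigma_sub (leqnn 0) (tmono m)).
  by apply: (path_sigma_sub (leq0n _) (leqnn _)); exact: path_sigma_climb.
have PU m : pr (U m) = pi1 ^+ m.
  elim: m => [|m IH].
    rewrite expr0 /path_prob -(Pr_setT P); congr (Pr P _).
    by apply/seteqP; split.
  rewrite US (path_prob_indep bmZ _ (@sU m) (@path_sigma_climb R _ _ _ _)) ?tmono//.
  by rewrite IH climb_prob ?exprSr// /climb_len ltn_addr.
have J0 : (0 < J)%N by [].
have NT : (N <= climb_time S J n)%N by exact: climb_time_ge.
rewrite -[(k * J).+2]/n -PU; apply: le_Pr.
- exact: (measurable_event bmZ (@sU n)).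
- by apply: (measurable_event bmZ (a := 0%N) (b := N)); exact: path_sigma_stay_above.
move=> w hw; have cz : continuous (Z ^~ w) by exact: (bm_continuous bmZ).
have [h _] := climb_chain S0 J0 (ltW r0) rJ rho0 cz hw.
apply/(stay_aboveP _ _ _ _ cz) => t co hco /andP[t0 tN]; apply: h => //.
by rewrite t0 (le_trans tN)// ler_nat.
Qed.

Lemma stay_above_shift (a N : nat) (h : R) :
  pr (stay_above a (a + N) a h) = pr (stay_above 0 N 0 h).
Proof.
have s0 : path_sigma 0 N (stay_above 0 N 0 h) by exact: path_sigma_stay_above.
rewrite -(path_prob_shift bmZ a s0); congr (Pr P _); apply/funext => w.
rewrite /preimage /mkset; apply/propext.
have cz : continuous (Z ^~ w) by exact: (bm_continuous bmZ).
have cz' : continuous (fun t : R => Z (a%:R + t) w - Z a%:R w : R * R).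
  exact: (bm_continuous (bm_shift bmZ a)).
rewrite (stay_aboveP _ _ _ _ cz) (stay_aboveP _ _ _ _ cz'); split => hz t co hco /andP[t0 tN].
  have := hz (a%:R + t) co hco; rewrite natrD lerDl lerD2l t0 tN => /(_ isT).
  by case: hco => -> /=; rewrite addr0 subrr subr0.
have tN' : t - a%:R <= N%:R by rewrite lerBlDl -natrD.
have := hz (t - a%:R) co hco; rewrite subrKC subr_ge0 t0 tN' => /(_ isT).
by case: hco => -> /=; rewrite addr0 subrr subr0.
Qed.

Lemma stay_above_reverse (a : nat) (h : R) :
  pr (stay_above 0 a a h) = pr (stay_above 0 a 0 h).
Proof.
have s0 : path_sigma 0 a (stay_above 0 a 0 h) by exact: path_sigma_stay_above.
have bm' := @bm_affine R gamma 1 d T P _ (bm_opp bmZ) (- a%:R) 1 1 ltr01.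
rewrite !mulr1 expr1n in bm'.
rewrite {2}/path_prob /Pr (bm_law bmZ bm' s0); congr (Pr P _); apply/funext => w.
rewrite /preimage /mkset; apply/propext.
have cz : continuous (Z ^~ w) by exact: (bm_continuous bmZ).
rewrite (stay_aboveP _ _ _ _ cz) (stay_aboveP _ _ _ _ _); last exact: (bm_continuous bm').
have E t co : is_coord co ->
  co (pair_scale 1 (increment (fun t w => Z (- t) w) (- a%:R) (- a%:R + 1 * t) w)) =
  co (Z (a%:R - t) w) - co (Z a%:R w).
  by case=> -> /=; rewrite mul1r opprK mul1r opprD opprK.
split => hz t co hco /andP[t0 tN].
  rewrite !E// subr0 subrr subr0; apply: hz => //.
  by rewrite subr_ge0 tN lerBlDr lerDl.
have := hz (a%:R - t) co hco.
rewrite !E// subr0 subrr subr0 subKr; apply.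
by rewrite subr_ge0 tN lerBlDr lerDl.
Qed.

End pinch_probability.

(** * The lower bound *)

Section separation.
Variables (R : realType) (gamma : R).
Variables (d : measure_display) (T : measurableType d).
Variables (P : probability T R) (Z : R -> T -> R * R).
Hypothesis bmZ : mated_crt_brownian_motion gamma 1 P Z.
Notation pr := (path_prob P Z).
Notation p := (diam_tail P Z).

Definition end_tail (n l : nat) : R :=
  pr [set z | ~~ path_reach z 0 n l 0 n.-1].

Lemma path_sigma_reach_gt a b l x y : (a <= x < b)%N ->
  path_sigma a b [set z : planar_path R | ~~ path_reach z a b l x y].
Proof. by move=> hx; apply: path_sigmaCb; exact: path_sigma_reach. Qed.

Lemma end_tail_shift a n l : (0 < n)%N ->
  pr [set z | ~~ path_reach z a (a + n) l a (a + n).-1] = end_tail n l.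
Proof.
move=> n0; have s0 : path_sigma 0 n [set z : planar_path R | ~~ path_reach z 0 n l 0 n.-1].
  exact: path_sigma_reach_gt.
rewrite /end_tail -(path_prob_shift bmZ a s0); congr (Pr P _).
apply/funext => w; rewrite /mkset /preimage /mkset.
have cz : continuous (Z ^~ w) by exact: (bm_continuous bmZ).
have -> := path_reach_shift a (Z a%:R w) 0 n l 0 n.-1 cz.
by rewrite addn0 -subn1 -addnBA// subn1.
Qed.

(* Otherwise 0 is close to all the multiples of M, hence to all the vertices. *)
Lemma end_tail_pigeonhole (M K D l : nat) (r : R) : (0 < M)%N -> 0 <= r ->
  K%:R * (p M D + r) < p (K * M) ((l + D) + (l + D)) ->
  exists2 i, (0 < i < K)%N & r < end_tail (i * M).+1 l.
Proof.
move=> M0 r0; set n := (K * M)%N.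
pose X : T -> planar_path R := fun w => Z ^~ w.
pose F i : set (planar_path R) := [set z | ~~ path_diam_le z (i * M) (i * M + M) D].
pose G i : set (planar_path R) := [set z | ~~ path_reach z 0 (i * M).+1 l 0 (i * M)].
have iM i : (i < K)%N -> (i * M + M <= n)%N by move=> iK; rewrite -mulSnr leq_mul2r iK orbT.
have sF i : (i < K)%N -> path_sigma 0 n (F i).
  by move=> /iM h; apply: path_sigma_diam_gt.
have sG i : (i < K)%N -> path_sigma 0 n (G i).
  move=> /iM h; apply: path_sigmaCb; apply: path_sigma_reach; lia.
have mF i : (i < K)%N -> measurable (X @^-1` F i) by move=> /sF/(measurable_event bmZ).
have mG i : (i < K)%N -> measurable (X @^-1` G i) by move=> /sG/(measurable_event bmZ).
have mbad : measurable (X @^-1` [set z | ~~ path_diam_le z 0 n (l + D + (l + D))]).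
  exact: (measurable_event bmZ (path_sigma_diam_gt _ (leqnn 0) (leqnn n))).
have sub : X @^-1` [set z | ~~ path_diam_le z 0 n (l + D + (l + D))] `<=`
    \bigcup_(i < K) (X @^-1` F i) `|` \bigcup_(i < K) (X @^-1` G i).
  move=> w; apply: contraPP => /not_orP[nF nG]; apply/negP; rewrite negbK.
  have hF i : (i < K)%N -> path_diam_le (X w) (i * M) (i * M + M) D.
    by move=> iK; apply: contrapT => /negP h; apply: nF; exists i.
  have hG i : (i < K)%N -> path_reach (X w) 0 (i * M).+1 l 0 (i * M).
    by move=> iK; apply: contrapT => /negP h; apply: nG; exists i.
  have h0 x : (x < n)%N -> path_reach (X w) 0 n (l + D) 0 x.
    move=> xn; have xK : (x %/ M < K)%N by rewrite ltn_divLR.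
    have h := iM _ xK.
    apply: (@reach_trans _ _ _ _ _ _ _ (x %/ M * M)).
      by apply: (@reach_sub _ _ 0 (x %/ M * M).+1) (hG _ xK) => //; lia.
    apply: (@reach_sub _ _ (x %/ M * M) (x %/ M * M + M)) => //.
    move/diam_leP : (hF _ xK); apply; first by lia.
    by have := divn_eq x M; have := ltn_pmod x M0; lia.
  apply/diam_leP => x y /= xn yn; apply: (reach_trans _ (h0 y yn)).
  by apply: reach_sym (h0 x xn); rewrite /=; case: (n) xn.
have PF i : (i < K)%N -> measurable (X @^-1` F i) /\ Pr P (X @^-1` F i) <= p M D.
  by move=> iK; split; [exact: mF|rewrite -/(pr _) (diam_tail_shift bmZ)].
have mUF := measurable_bigcup_lt mF; have mUG := measurable_bigcup_lt mG.
have := le_Pr P mbad (measurableU _ _ mUF mUG) sub.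
rewrite -/(pr _) -/(p _ _) => h1 h2.
have h3 := Pr_setU P mUF mUG; have h4 := Pr_bigcup PF.
have : K%:R * r < Pr P (\bigcup_(i < K) (X @^-1` G i)).
  move: h1 h2 h3 h4; rewrite mulrDr.
  set u1 := Pr P _; set u2 := p _ _; set u3 := Pr P _; set u4 := Pr P _; lra.
move=> /(Pr_pigeonhole mG)[i iK hi]; have [i0|i_gt0] := posnP i; last first.
  by exists i; [rewrite i_gt0|].
suff G0 : X @^-1` G 0%N = set0.
  by move: hi; rewrite i0 G0 Pr_set0 ltNge r0.
by apply/seteqP; split => w //=; rewrite /G /= mul0n /path_reach reach_refl.
Qed.

Definition no_hit_left (co : R * R -> R) (h : R) (a n : nat) : set (planar_path R) :=
  [set z | forall i, (i < n)%N -> - h < co (z (a + i)%:R) - co (z a%:R)].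

Definition no_hit_right (co : R * R -> R) (h : R) (b n : nat) : set (planar_path R) :=
  [set z | forall i, (i < n)%N -> - h < co (z (b - i)%:R) - co (z b%:R)].

Lemma path_sigma_no_hit_left co h a n b : is_coord co -> (a + n <= b.+1)%N ->
  path_sigma a b (no_hit_left co h a n).
Proof.
move=> hco hn; rewrite (_ : no_hit_left _ _ _ _ = \bigcap_i
  [set z | (i < n)%N -> [set z | `](- h), +oo[%classic (co (z (a + i)%:R) - co (z a%:R))] z]).
  apply: path_sigma_bigcap => i; apply: path_sigma_cond => ni.
  by apply: path_sigma_nat => //; solve [exact: measurable_itv|lia].
apply/seteqP; split => z /= hz i; first by move=> _ /hz; rewrite in_itv/= andbT.
by move=> /(hz i I); rewrite in_itv/= andbT.
Qed.

Lemma path_sigma_no_hit_right co h a n b : is_coord co -> (a + n <= b.+1)%N ->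
  path_sigma a b (no_hit_right co h b n).
Proof.
move=> hco hn; rewrite (_ : no_hit_right _ _ _ _ = \bigcap_i
  [set z | (i < n)%N -> [set z | `](- h), +oo[%classic (co (z (b - i)%:R) - co (z b%:R))] z]).
  apply: path_sigma_bigcap => i; apply: path_sigma_cond => ni.
  by apply: path_sigma_nat => //; solve [exact: measurable_itv|lia].
apply/seteqP; split => z /= hz i; first by move=> _ /hz; rewrite in_itv/= andbT.
by move=> /(hz i I); rewrite in_itv/= andbT.
Qed.

Lemma no_hit_left_prob co h a m : is_coord co ->
  pr (no_hit_left co h a m.+1) = pr (no_hit co h m.+1).
Proof.
move=> hco; have s0 : path_sigma 0 m (no_hit co h m.+1) by exact: path_sigma_no_hit.
rewrite -(path_prob_shift bmZ a s0); congr (Pr P _); apply/funext => w.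
have E i : co (Z (a%:R + i%:R) w - Z a%:R w) - co (Z (a%:R + 0%:R) w - Z a%:R w) =
    co (Z (a + i)%:R w) - co (Z a%:R w).
  by case: hco => -> /=; rewrite natrD addr0 subrr subr0.
by rewrite /preimage /mkset; apply/propext; split => hz i im;
  have := hz i im; rewrite E.
Qed.

Lemma no_hit_right_prob co h b m : is_coord co -> (m <= b)%N ->
  pr (no_hit_right co h b m.+1) = pr (no_hit co h m.+1).
Proof.
move=> hco mb; have s0 : path_sigma 0 m (no_hit co h m.+1) by exact: path_sigma_no_hit.
have bm' := @bm_affine R gamma 1 d T P _ (bm_opp bmZ) (- b%:R) 1 1 ltr01.
rewrite !mulr1 expr1n in bm'.
rewrite [RHS]/path_prob /Pr (bm_law bmZ bm' s0); congr (Pr P _); apply/funext => w.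
have E t : co (pair_scale 1 (increment (fun t w => Z (- t) w) (- b%:R) (- b%:R + 1 * t) w)) =
  co (Z (b%:R - t) w) - co (Z b%:R w).
  by case: hco => -> /=; rewrite mul1r opprK mul1r opprD opprK.
rewrite /preimage /mkset; apply/propext; split => hz i im.
  by have := hz i im; rewrite !E subr0 subrr subr0 natrB//; lia.
by have := hz i im; rewrite !E subr0 subrr subr0 natrB//; lia.
Qed.

Lemma block_le_cut (f : R -> R) (u k : nat) (lo x : R) : continuous f ->
  (forall t, u%:R <= t <= u.+1%:R -> lo <= f t) -> k%:R <= x <= k.+1%:R ->
  f x < lo -> ~~ block_le f u k.
Proof.
move=> cf hlo hx fx; apply/negP => /(block_leP _ _ cf) h.
have [|y yu] := h x (lo - f x) hx; first by rewrite subr_gt0.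
by rewrite subrKC ltNge hlo.
Qed.

Lemma separation (N a n W l D x y : nat) (h h' : R) :
  (x < a)%N -> (a + n <= y)%N -> (a + n <= N)%N -> (1 < W <= n)%N -> 0 < h' < h ->
  pr (stay_above 0 a a h') * pr (stay_above (a + n) N (a + n) h') *
    (end_tail n (l + D + D) - 2 * p W D - 4 * (4 * h / Num.sqrt W.-1%:R +
      4 * W.-1%:R * expR (- (h ^+ 2 / 4)))) <=
  pr [set z | ~~ path_reach z 0 N l x y].
Proof.
move=> xa bly bN /andP[W1 Wn] /andP[h'0 h'h]; set b := (a + n)%N in bly bN *.
pose X : T -> planar_path R := fun w => Z ^~ w.
set nu := 4 * h / _ + _.
have h0 : 0 < h by exact: lt_trans h'h.
pose SL := stay_above 0 a a h' : set (planar_path R).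
pose SR := stay_above b N b h' : set (planar_path R).
pose F : set (planar_path R) := [set z | ~~ path_reach z a b (l + D + D) a b.-1].
pose B1 : set (planar_path R) := [set z | ~~ path_diam_le z a (a + W) D].
pose B2 : set (planar_path R) := [set z | ~~ path_diam_le z (b - W) b D].
pose C (i : nat) : set (planar_path R) :=
  if i == 0%N then no_hit_left fst h a W else
  if i == 1%N then no_hit_left snd h a W else
  if i == 2%N then no_hit_right fst h b W else no_hit_right snd h b W.
have sSL : path_sigma 0 a SL by apply: path_sigma_stay_above; rewrite leqnn.
have sSR : path_sigma b N SR by apply: path_sigma_stay_above; rewrite leqnn.
have sF : path_sigma a b F by apply: path_sigma_reach_gt; rewrite /b; lia.
have sB1 : path_sigma a b B1 by apply: path_sigma_diam_gt; rewrite /b; lia.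
have sB2 : path_sigma a b B2 by apply: path_sigma_diam_gt; rewrite /b; lia.
have sC i : path_sigma a b (C i).
  case: i => [|[|[|i]]]; rewrite /C /=.
  - by apply: path_sigma_no_hit_left; [left|rewrite /b; lia].
  - by apply: path_sigma_no_hit_left; [right|rewrite /b; lia].
  - by apply: path_sigma_no_hit_right; [left|rewrite /b; lia].
  - by apply: path_sigma_no_hit_right; [right|rewrite /b; lia].
have mC i : measurable (X @^-1` C i) by exact: (measurable_event bmZ (sC i)).
have PB1 : pr B1 = p W D by exact: (diam_tail_shift bmZ).
have PB2 : pr B2 = p W D.
  have bW : (b - W + W = b)%N by rewrite subnK// /b; lia.
  by rewrite -(diam_tail_shift bmZ (b - W)) bW.
have PF : pr F = end_tail n (l + D + D).
  by rewrite -(end_tail_shift a)//; lia.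
have PC i : pr (C i) <= nu.
  have W' : W = W.-1.+1 by lia.
  have hW0 : (0 < W.-1)%N by lia.
  have Wb : (W.-1 <= b)%N by rewrite /b; lia.
  have left1 : is_coord (@fst R R) by left.
  have right1 : is_coord (@snd R R) by right.
  case: i => [|[|[|i]]]; rewrite /C /= W'.
  - by rewrite no_hit_left_prob//; exact: (no_hit_prob bmZ left1 h0 hW0).
  - by rewrite no_hit_left_prob//; exact: (no_hit_prob bmZ right1 h0 hW0).
  - by rewrite no_hit_right_prob//; exact: (no_hit_prob bmZ left1 h0 hW0).
  - by rewrite no_hit_right_prob//; exact: (no_hit_prob bmZ right1 h0 hW0).
pose M := F `\` (B1 `|` B2 `|` \bigcup_(i < 4) C i).
have sU : path_sigma a b (B1 `|` B2 `|` \bigcup_(i < 4) C i).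
  apply: path_sigmaU; first by apply: path_sigmaU.
  exact: (@measurable_bigcup_lt _ (path_type R a b) 4 C (fun i _ => sC i)).
have sM : path_sigma a b M.
  by rewrite /M setDE; apply: path_sigmaI => //; exact: path_sigmaC.
have mF := measurable_event bmZ sF; have mU := measurable_event bmZ sU.
have mB1 := measurable_event bmZ sB1; have mB2 := measurable_event bmZ sB2.
have PM : end_tail n (l + D + D) - 2 * p W D - 4 * nu <= pr M.
  have h1 := Pr_setD P mF mU.
  have h2 : Pr P (X @^-1` (B1 `|` B2 `|` \bigcup_(i < 4) C i)) <= 2 * p W D + 4 * nu.
    have mB := measurableU _ _ mB1 mB2.
    have mCC : measurable (\bigcup_(i < 4) (X @^-1` C i)).
      by apply: measurable_bigcup_lt => i _; exact: mC.
    rewrite !preimage_setU preimage_bigcup; apply: le_trans (Pr_setU P mB mCC) _.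
    apply: lerD; last by apply: Pr_bigcup => i _; split; [exact: mC|exact: PC].
    apply: le_trans (Pr_setU P mB1 mB2) _.
    by rewrite -/(pr _) -/(pr _) PB1 PB2; lra.
  move: h1 h2; rewrite -/(pr _) PF -/(pr _).
  rewrite -[pr M]/(Pr P (X @^-1` F `\` X @^-1` (B1 `|` B2 `|` \bigcup_(i < 4) C i))).
  set u := Pr P (_ `\` _); set v := pr (_ `|` _); lra.
have ab : (a <= b)%N by rewrite /b; lia.
apply: (@le_trans _ _ (pr (SL `&` (M `&` SR)))).
  have sMR : path_sigma a N (M `&` SR).
    apply: path_sigmaI; first by apply: (path_sigma_sub (leqnn a) bN).
    by apply: (path_sigma_sub ab (leqnn N)).
  rewrite (path_prob_indep bmZ _ sSL sMR); last by rewrite (leq_trans ab bN).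
  rewrite (path_prob_indep bmZ _ sM sSR); last by rewrite ab bN.
  rewrite [pr M * _]mulrC mulrA; apply: ler_wpM2l => //.
  by rewrite mulr_ge0// Pr_ge0.
apply: le_Pr.
- apply: (measurable_event bmZ (a := 0%N) (b := N)); apply: path_sigmaI.
    by apply: (path_sigma_sub (leqnn 0) (leq_trans ab bN)).
  apply: path_sigmaI; first by apply: (path_sigma_sub (leq0n a) bN).
  by apply: (path_sigma_sub (leq0n b) (leqnn N)).
- by apply: (measurable_event bmZ (a := 0%N) (b := N)); apply: path_sigma_reach_gt; lia.
move=> w [hSL [[hF hU] hSR]].
have cz : continuous (Z ^~ w) by exact: (bm_continuous bmZ).
have {}hSL := (stay_aboveP _ _ _ _ cz).1 hSL.
have {}hSR := (stay_aboveP _ _ _ _ cz).1 hSR.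
have /not_orP[/not_orP[hB1 hB2] hC] := hU.
have {}hB1 : path_diam_le (X w) a (a + W) D by apply: contrapT => /negP h1; exact: hB1.
have {}hB2 : path_diam_le (X w) (b - W) b D by apply: contrapT => /negP h1; exact: hB2.
have hitL co : is_coord co -> exists2 i, (i < W)%N & co (Z (a + i)%:R w) - co (Z a%:R w) <= - h.
  move=> hco; apply: contrapT => hno; apply: hC.
  have hit i : (i < W)%N -> - h < co (Z (a + i)%:R w) - co (Z a%:R w).
    by move=> iW; rewrite ltNge; apply/negP => h1; apply: hno; exists i.
  by case: hco hit {hno} => ->; [exists 0%N|exists 1%N].
have hitR co : is_coord co -> exists2 i, (i < W)%N & co (Z (b - i)%:R w) - co (Z b%:R w) <= - h.
  move=> hco; apply: contrapT => hno; apply: hC.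
  have hit i : (i < W)%N -> - h < co (Z (b - i)%:R w) - co (Z b%:R w).
    by move=> iW; rewrite ltNge; apply/negP => h1; apply: hno; exists i.
  by case: hco hit {hno} => ->; [exists 2%N|exists 3%N].
have left_cut co u : is_coord co -> (u < a)%N ->
    exists2 k, (a <= k < a + W)%N & ~~ block_le (fun t => co (Z t w)) u k.
  move=> hco ua; have [i iW hi] := hitL co hco; exists (a + i)%N; first by lia.
  have cf : continuous (fun t => co (Z t w)).
    by case: (hco) => ->; [exact: continuous_path1|exact: continuous_path2].
  apply: (@block_le_cut _ _ _ (co (Z a%:R w) - h') (a + i)%:R cf); last by lra.
    move=> t /andP[t1 t2]; have := hSL t co hco.
    rewrite (le_trans _ t1) ?ler0n// (le_trans t2) ?ler_nat//= => /(_ isT); lra.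
  by rewrite lexx ler_nat leqnSn.
have right_cut co v : is_coord co -> (b <= v)%N -> (v < N)%N ->
    exists2 k, (b - W <= k < b)%N & ~~ block_le (fun t => co (Z t w)) v k.
  move=> hco bv vN; have [i iW hi] := hitR co hco.
  (* The drop cannot occur at b itself, so the block starting at b - i lies to the left of b. *)
  have i0 : (0 < i)%N.
    by case: (i) hi => // ; rewrite subn0 subrr oppr_ge0 leNgt h0.
  exists (b - i)%N; first by rewrite /b; lia.
  have cf : continuous (fun t => co (Z t w)).
    by case: (hco) => ->; [exact: continuous_path1|exact: continuous_path2].
  apply: (@block_le_cut _ _ _ (co (Z b%:R w) - h') (b - i)%:R cf); last by lra.
    move=> t /andP[t1 t2]; have := hSR t co hco.
    rewrite (le_trans _ t1) ?ler_nat// (le_trans t2) ?ler_nat//= => /(_ isT); lra.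
  by rewrite lexx ler_nat leqnSn.
rewrite /=; apply/negP => hreach; move: hF => /negP; apply.
apply: (reach_pinched (N := N) (w := W) _ bN _ _ hB1 hB2 xa bly hreach).
- by rewrite /b leq_add2l.
- move=> u v ua av.
  have [k1 hk1 n1] := left_cut fst u (or_introl erefl) ua.
  have [k2 hk2 n2] := left_cut snd u (or_intror erefl) ua.
  apply: (@block_adj_cut _ _ u v k1 k2);
    [clear - ua av hk1 hk2; lia|clear - ua av hk1 hk2; lia| |]; rewrite negb_and.
    by rewrite n1.
  by rewrite n2.
- move=> u v ub /andP[bv vN].
  have [k1 hk1 n1] := right_cut fst v (or_introl erefl) bv vN.
  have [k2 hk2 n2] := right_cut snd v (or_intror erefl) bv vN.
  apply: (@block_adj_cut _ _ u v k1 k2);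
    [clear - ub bv hk1 hk2; lia|clear - ub bv hk1 hk2; lia| |]; rewrite negb_and.
    by rewrite n1 orbT.
  by rewrite n2 orbT.
Qed.

End separation.

Lemma sum_leq_count (n B : nat) : (\sum_(k < n) (k <= B : nat) <= B.+1)%N.
Proof.
suff : (\sum_(k < n) (k <= B : nat) <= minn n B.+1)%N by lia.
elim: n => [|n IH]; first by rewrite big_ord0.
rewrite big_ord_recr /=; apply: leq_trans (leq_add IH (leqnn _)) _.
by case: (leqP n B) => /= h; lia.
Qed.

Lemma ln_natX (R : realType) (m Q : nat) : (0 < m)%N -> ln (m ^ Q)%:R = Q%:R * ln m%:R :> R.
Proof. by move=> m0; rewrite natrX lnXn ?ltr0n// mulr_natl. Qed.

(** * Lower tail of the diameter and cost of the pinching *)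

Section lower_bound.
Variables (R : realType) (gamma chi : R).
Variables (d : measure_display) (T : measurableType d).
Variables (P : probability T R) (Z : R -> T -> R * R).
Hypothesis bmZ : mated_crt_brownian_motion gamma 1 P Z.
Hypothesis hchi : is_distance_exponent gamma chi.
Notation pr := (path_prob P Z).
Notation p := (diam_tail P Z).

(** Tails up to l are at most 1, those from there up to B at most [p n l], and the remaining ones at
    most [p n B]. *)
Lemma mean_diam_split n l B :
  mean_diam p n <= l.+1%:R + B.+1%:R * p n l + n%:R * p n B.
Proof.
have pt k : p n k <= (k <= l)%N%:R + (k <= B)%N%:R * p n l + p n B.
  have h1 := diam_tail_le1 bmZ n k; have h2 := diam_tail_ge0 P Z n l.
  have h3 := diam_tail_ge0 P Z n B.
  have [kl|lk] := leqP k l => /=.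
    have h5 : 0 <= (k <= B)%N%:R * p n l by rewrite mulr_ge0.
    by rewrite mulr1n in h5 *; lra.
  have h4 := diam_tail_le bmZ n (ltnW lk).
  have [kB|Bk] := leqP k B => /=; first by lra.
  by have h5 := diam_tail_le bmZ n (ltnW Bk); lra.
rewrite /mean_diam; apply: (@le_trans _ _
  (\sum_(k < n) ((k <= l)%N%:R + (k <= B)%N%:R * p n l + p n B))).
  by apply: ler_sum => k _; exact: pt.
rewrite 2!big_split /= sumr_const card_ord -[p n B *+ n]mulr_natl lerD2r.
rewrite -mulr_suml -!natr_sum; apply: lerD; first by rewrite ler_nat sum_leq_count.
by rewrite ler_wpM2r ?diam_tail_ge0// ler_nat sum_leq_count.
Qed.

Lemma diam_tail_lower (a : R) : 0 < a < chi -> exists n0 : nat, forall n : nat,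
  (n0 <= n)%N -> forall l : nat, l.+1%:R <= expR ((chi - a) * ln n%:R) / 4 ->
  expR (- (2 * a * ln n%:R)) / 8 <= p n l.
Proof.
move=> /andP[a0 achi]; have [n1 h1] := mean_diam_near bmZ hchi a0.
have [n2 h2] := diam_tail_decay bmZ hchi a0.
have a20 : 0 < a ^+ 2 by rewrite exprn_gt0.
have ca : 0 < chi - a by lra.
have [L1 [_ hL1]] := @exp_ge_cst R (chi - a) 4 ca.
have [n3 [n30 h3]] := @ln_nat_ge R (Num.max L1 (16 / a ^+ 2)).
exists (n1 + n2 + n3)%N => n hn l hl.
have [hn1 hn2 hn3 n0] : [/\ n1 <= n, n2 <= n, n3 <= n & 0 < n]%N.
  by clear - hn n30; split; lia.
have := h3 n hn3; rewrite ge_max => /andP[L1n Ln].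
have /andP[e1 e2] := h1 n hn1.
move: hl e1 e2 Ln L1n (h2 n hn2).
set L := ln n%:R => hl e1 e2 Ln L1n hdecay.
have L0 : 0 < L by apply: lt_le_trans Ln; rewrite divr_gt0.
(* Beyond n^(chi + a) the tails decay faster than any power of n and contribute at most 1 to the
   mean. The mean, at least n^(chi - a), must then come mostly from the values between l and B. *)
pose B := Num.truncn (expR ((chi + a) * L)).
have [B1 B2] := truncn_exp ((chi + a) * L); rewrite -/B in B1 B2.
have pB := hdecay B B1.
have npB : n%:R * p n B <= 1.
  rewrite -(expR_ln_nat R n0) -/L.
  apply: (@le_trans _ _ (expR L * expR (- (a ^+ 2 / 16 * L ^+ 2)))).
    by rewrite ler_wpM2l ?expR_ge0.
  rewrite -expRD -[leRHS]expR0 ler_expR.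
  have : 16 <= a ^+ 2 * L by rewrite mulrC -ler_pdivrMr.
  move=> /(ler_wpM2r (ltW L0)); nra.
have B2' : B.+1%:R <= 2 * expR ((chi + a) * L).
  apply: le_trans B2 _; rewrite [leRHS]mulr_natl mulr2n lerD2l.
  by apply: expR_ge1; rewrite mulr_ge0// ?(ltW L0)//; lra.
have X4 := hL1 L L1n; set x := expR ((chi - a) * L) in hl e1 X4 *.
have := mean_diam_split n l B; have pl0 := diam_tail_ge0 P Z n l.
have Bp : B.+1%:R * p n l <= 2 * expR ((chi + a) * L) * p n l by rewrite ler_wpM2r.
move=> hsplit.
have {Bp hsplit e1}key : x / 4 <= 2 * expR ((chi + a) * L) * p n l by lra.
have E : expR (- (2 * a * L)) * expR ((chi + a) * L) = x.
  by rewrite -expRD /x; congr expR; ring.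
rewrite -E in key; have Y0 := expR_gt0 ((chi + a) * L).
rewrite -(ler_pM2r Y0); lra.
Qed.

Hypothesis hgamma : 0 < gamma < 2.

(** A time of order m^(2 q) has diffusive scale m^q, only m^5 times the allowed height m^(q - 5).
    The number of climbs depends on this ratio alone, which is why Theta does not depend on q. *)
Lemma pinch_lower : exists (Theta rho : R), [/\ 0 <= Theta, 0 <= rho &
  forall q C0 : nat, (5 <= q)%N -> exists m0 : nat, forall m : nat, (m0 <= m)%N ->
    forall N : nat, (N <= C0 * m ^ (2 * q))%N ->
    expR (- (Theta * ln m%:R)) <=
      pr (stay_above 0 N 0 ((rho + 1) * (m ^ (q - 5))%:R))].
Proof.
have [pi1 [rho [J [/andP[pi0 pi1le] rho0 J0 hstay]]]] := stay_above_prob bmZ hgamma.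
pose beta := - ln pi1.
have beta0 : 0 <= beta by rewrite oppr_ge0 ln_le0.
(* Since ln 2 >= 1/2, one has k <= 2 (ln C1 + 5 ln m), and there are k J + 2 climbs of cost beta
   each. This gives the slope 10 J; the final 1 absorbs the terms without ln m once m is large. *)
exists (beta * (10 * J%:R) + 1), rho; split => //.
  by rewrite addr_ge0// mulr_ge0// mulr_ge0.
move=> q C0 q5; pose C1 := (2 * (J * C0.+1))%N.
have [m0 [m00 hm0]] := @ln_nat_ge R (beta * (2 * J%:R * ln C1%:R + 2)).
exists m0 => m hm N hN; have m_gt0 : (0 < m)%N by lia.
have {}hm0 := hm0 m hm; set L := ln m%:R in hm0 *.
(* X dominates J sqrt N / S for S = m^(q - 5) and N <= C0 m^(2 q), so k doublings of S suffice. *)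
pose X := (J * C0.+1 * m ^ 5)%N.
have X0 : (0 < X)%N by rewrite /X 2!muln_gt0 J0 expn_gt0 m_gt0.
have C1_gt0 : (0 < C1)%N by rewrite /C1 !muln_gt0 J0.
pose k := (trunc_log 2 X).+1.
have [k1 k2] : (2 ^ k.-1 <= X)%N /\ (X < 2 ^ k)%N.
  by have /andP[] := trunc_log_bounds (isT : (1 < 2)%N) X0.
have S0 : (0 < m ^ (q - 5))%N by rewrite expn_gt0 m_gt0.
have hNJ : (N * J ^ 2 <= (2 ^ k * m ^ (q - 5)) ^ 2)%N.
  apply: (@leq_trans ((X * m ^ (q - 5)) ^ 2)); last first.
    by rewrite leq_exp2r// leq_mul2r ltnW ?orbT.
  have -> : (X * m ^ (q - 5) = J * C0.+1 * m ^ q)%N.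
    by rewrite /X -mulnA -expnD subnKC.
  rewrite !expnMn -expnM [(q * 2)%N]mulnC [(J ^ 2 * _)%N]mulnC -mulnA [(J ^ 2 * _)%N]mulnC mulnA.
  rewrite leq_mul2r; apply/orP; right; apply: leq_trans hN _.
  by rewrite leq_mul2r; apply/orP; right; rewrite expnS expn1; lia.
have hle : pi1 ^+ (k * J).+2 <= pr (stay_above 0 N 0 ((rho + 1) * (m ^ (q - 5))%:R)).
  apply: le_trans (hstay (m ^ (q - 5))%N N k S0 hNJ) _; apply: le_Pr.
  - by apply: (measurable_event bmZ (a := 0%N) (b := N)); exact: path_sigma_stay_above.
  - by apply: (measurable_event bmZ (a := 0%N) (b := N)); exact: path_sigma_stay_above.
  move=> w hw j i hi; have [h1 h2] := hw j i hi.
  have : 0 <= (m ^ (q - 5))%:R :> R by [].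
  by split; lra.
apply: le_trans hle.
have -> : pi1 = expR (- beta) by rewrite opprK lnK.
rewrite -expRM_natl ler_expR mulrN lerN2.
have ln2 : 1 / 2 <= ln 2 :> R.
  have := @le_ln1Dx R (- (1 / 2)) ltac:(lra).
  have -> : 1 + - (1 / 2) = 2^-1 :> R by field.
  by rewrite lnV ?posrE//; lra.
have kln : k%:R <= 2 * (ln C1%:R + 5 * L).
  have : (2 ^ k <= C1 * m ^ 5)%N.
    by rewrite /k expnS /C1 -mulnA leq_mul2l; exact: k1.
  rewrite -(ler_nat R) => h.
  have : ln (2 ^ k)%:R <= ln (C1 * m ^ 5)%:R :> R.
    rewrite ler_ln ?posrE ?ltr0n ?expn_gt0//.
    by rewrite muln_gt0 C1_gt0 expn_gt0 m_gt0.
  rewrite natrM lnM ?posrE ?ltr0n ?expn_gt0 ?m_gt0//.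
  rewrite !ln_natX// -/L => h'.
  have : k%:R * (1 / 2) <= k%:R * ln 2 :> R by rewrite ler_wpM2l.
  lra.
have L0 : 0 <= L by rewrite ln_ge0// ler1n.
have : (k * J).+2%:R <= 2 * (ln C1%:R + 5 * L) * J%:R + 2.
  rewrite -addn2 natrD natrM lerD2r.
  by rewrite ler_wpM2r.
move=> /(ler_wpM2l beta0); rewrite [beta * _.+2%:R]mulrC => /le_trans; apply.
lra.
Qed.

End lower_bound.

(** A window of length m^(2 q - 2) has diffusive scale m^(q - 1), which exceeds the height of order
    m^(q - 5) by a factor m^4. The main term is then of order m^(-4), and the overshoot term is at
    most a power of m times e^(-m). *)
Lemma no_hit_small (R : realType) (rho : R) (q : nat) : 0 <= rho -> (6 <= q)%N ->
  exists m0 : nat, forall m : nat, (m0 <= m)%N ->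
  4 * (4 * (2 * ((rho + 1) * (m ^ (q - 5))%:R)) / Num.sqrt (m ^ (2 * q - 2)).-1%:R +
    4 * (m ^ (2 * q - 2)).-1%:R * expR (- ((2 * ((rho + 1) * (m ^ (q - 5))%:R)) ^+ 2 / 4)))
  <= expR (- (2 * ln m%:R)) / 4.
Proof.
move=> rho0 q6.
have qW : (2 * q - 2 = (q - 1) + (q - 1))%N by lia.
have qS : (q - 1 = (q - 5) + 4)%N by lia.
have q1 : (1 <= q - 1)%N by lia.
have q5 : (1 <= q - 5)%N by lia.
have q2 : (2 * q - 2 <= 2 * q)%N by lia.
(* Ensures m >= 2 q L + 2 L + 512 for L = ln m, hence m^(2 q) e^(-m) <= m^(-2) e^(-512). *)
have [L1 [L1_0 hL1]] := @poly_le_exp R 1 ((2 * q)%:R + 2 + 512) 1 ltr01.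
have [L2 [L2_0 hL2]] := @exp_ge_cst R 2 (1024 * (rho + 1)) ltac:(lra).
have [m0 [m00 hm0]] := @ln_nat_ge R (L1 + L2 + 1).
exists m0 => m hm; have m_gt0 : (0 < m)%N by lia.
have {}hm0 := hm0 m hm; have mE := expR_ln_nat R m_gt0.
set L := ln m%:R in hm0 mE *.
have LL1 : L1 <= L by lra. have LL2 : L2 <= L by lra.
have L0 : 1 <= L by lra.
set W := (m ^ (2 * q - 2))%N; set S := (m ^ (q - 5))%N.
have m1 : 1 <= m%:R :> R by rewrite ler1n.
have m2 : (2 <= m)%N.
  rewrite ltnNge; apply/negP => m1'; have : m%:R <= 1 :> R by rewrite lern1.
  by rewrite -mE leNgt -[ltLHS]expR0 ltr_expR; lra.
have WE : W = (m ^ (q - 1) * m ^ (q - 1))%N by rewrite -expnD /W qW.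
have SE : (m ^ (q - 1) = S * m ^ 4)%N by rewrite -expnD -qS.
have S1 : (0 < S)%N by rewrite expn_gt0 m_gt0.
have V1 : (2 <= m ^ (q - 1))%N.
  by rewrite (leq_trans m2)// -[leqLHS]expn1; exact: leq_pexp2l.
have sqW : (m ^ (q - 1))%:R / 2 <= Num.sqrt W.-1%:R :> R.
  rewrite -[leLHS]ger0_norm ?divr_ge0// -sqrtr_sqr ler_sqrt//.
  have W1 : W.-1%:R = (m ^ (q - 1))%:R * (m ^ (q - 1))%:R - 1 :> R.
    by rewrite -natrM -WE -subn1 natrB// WE muln_gt0 !expn_gt0 m_gt0.
  have V2 : 2 <= (m ^ (q - 1))%:R :> R by rewrite ler_nat.
  by rewrite W1 expr2; nra.
have e2 : expR (- (2 * L)) = (m%:R ^+ 2)^-1.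
  by rewrite expRN -[2 * L]/(2%:R * L) expRM_natl mE.
have M2 : 0 < m%:R ^+ 2 :> R by rewrite exprn_gt0// ltr0n.
have S0 : 0 < S%:R :> R by rewrite ltr0n.
have first : 4 * (2 * ((rho + 1) * S%:R)) / Num.sqrt W.-1%:R <= expR (- (2 * L)) / 64.
  have den : 0 < (m ^ (q - 1))%:R / 2 :> R by rewrite divr_gt0// ltr0n expn_gt0 m_gt0.
  apply: (@le_trans _ _ (4 * (2 * ((rho + 1) * S%:R)) / ((m ^ (q - 1))%:R / 2))).
    rewrite ler_wpM2l ?lef_pV2 ?posrE ?(lt_le_trans den)//.
    by rewrite !mulr_ge0// addr_ge0.
  have -> : 4 * (2 * ((rho + 1) * S%:R)) / ((m ^ (q - 1))%:R / 2) =
      16 * (rho + 1) / (m%:R ^+ 2 * m%:R ^+ 2).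
    rewrite SE natrM natrX; field.
    by rewrite !pnatr_eq0 -!lt0n S1 m_gt0.
  rewrite e2 invfM mulrA [leRHS]mulrC ler_wpM2r ?invr_ge0 ?(ltW M2)//.
  rewrite ler_pdivrMr//; have := hL2 L LL2.
  rewrite -[2 * L]/(2%:R * L) expRM_natl mE; lra.
have second : 4 * W.-1%:R * expR (- ((2 * ((rho + 1) * S%:R)) ^+ 2 / 4)) <=
    expR (- (2 * L)) / 64.
  have -> : (2 * ((rho + 1) * S%:R)) ^+ 2 / 4 = (rho + 1) ^+ 2 * S%:R ^+ 2 by field.
  have mS : m%:R <= (rho + 1) ^+ 2 * S%:R ^+ 2.
    have mS' : m%:R <= S%:R :> R.
      by rewrite ler_nat -[leqLHS]expn1; exact: leq_pexp2l.
    have : 1 <= (rho + 1) ^+ 2 by rewrite exprn_ege1//; lra.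
    have S2 : S%:R <= S%:R ^+ 2 :> R by rewrite expr2 ler_peMl// ?(ltW S0)// ler1n.
    move=> h1; apply: le_trans mS' _; apply: le_trans S2 _.
    by rewrite ler_peMl// sqr_ge0.
  have WL : W.-1%:R <= expR ((2 * q)%:R * L).
    rewrite expRM_natl mE -natrX ler_nat; apply: leq_trans (leq_pred _) _.
    exact: leq_pexp2l.
  apply: (@le_trans _ _ (4 * (expR ((2 * q)%:R * L) * expR (- m%:R)))).
    by rewrite -mulrA ler_wpM2l// ler_pM ?expR_ge0// ler_expR lerN2.
  have hexp := hL1 L LL1; rewrite expr1 mul1r mE in hexp.
  have e256 : 1 + 512 <= expR 512 :> R by exact: expR_ge1Dx.
  apply: (@le_trans _ _ (4 * expR (- (2 * L) - 512))).
    have q0 : 0 <= (2 * q)%:R :> R by [].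
    rewrite ler_wpM2l// -expRD ler_expR; nra.
  rewrite expRD; have := expR_gt0 (- (2 * L)).
  have := expRxMexpNx_1 (512 : R); have := expR_gt0 (- 512 : R).
  set y := expR (- 512); set x := expR (- _); set w := expR 512 in e256 *; nra.
have := expR_gt0 (- (2 * L)); move: first second.
set A := _ / Num.sqrt _; set B := _ * expR _; set e := expR _; lra.
Qed.

Section diameter_decay.
Variables (R : realType) (gamma chi : R).
Variables (d : measure_display) (T : measurableType d).
Variables (P : probability T R) (Z : R -> T -> R * R).
Hypothesis bmZ : mated_crt_brownian_motion gamma 1 P Z.
Hypothesis hchi : is_distance_exponent gamma chi.
Notation p := (diam_tail P Z).

(** Decay in the square of ln m beats every power of m. The power 4 leaves room in the pigeonhole
    step, which multiplies by m and keeps a probability m^(-2). *)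
Lemma diam_tail_decay_pow (a : R) (b c : nat) : 0 < a -> (0 < b <= c)%N ->
  exists m0 : nat, forall m : nat, (m0 <= m)%N -> forall D : nat,
    expR ((chi + a) * (c%:R * ln m%:R)) < D.+1%:R ->
    p (m ^ b) D <= expR (- (4 * ln m%:R)).
Proof.
move=> a0 /andP[b0 bc]; have chi0 := distance_exponent_ge0 bmZ hchi.
have [n0 hn0] := diam_tail_decay bmZ hchi a0.
have a2 : 0 < a ^+ 2 by rewrite exprn_gt0.
have [n1 [n10 hn1]] := @ln_nat_ge R (64 / a ^+ 2).
exists (n0 + n1)%N => m hm D hD.
have [hm0 hm1 m0] : [/\ n0 <= m, n1 <= m & 0 < m]%N by clear - hm n10; split; lia.
have {}hn1 := hn1 m hm1; have lnb := ln_natX R b m0.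
set L := ln m%:R in hD hn1 lnb *.
have L0 : 0 <= L by rewrite ln_ge0// ler1n.
have mb : (n0 <= m ^ b)%N.
  by apply: leq_trans hm0 _; rewrite -[leqLHS]expn1 leq_pexp2l.
have b1 : 1 <= b%:R :> R by rewrite ler1n.
have bcR : b%:R <= c%:R :> R by rewrite ler_nat.
apply: le_trans (hn0 _ mb D _) _; rewrite lnb.
  by apply: le_lt_trans hD; rewrite ler_expR ler_wpM2l ?addr_ge0 ?(ltW a0)// ler_wpM2r.
rewrite ler_expR lerN2.
have h1 : 64 <= a ^+ 2 * L by rewrite mulrC -ler_pdivrMr.
have h2 : L ^+ 2 <= (b%:R * L) ^+ 2.
  by rewrite lerXn2r ?nnegrE ?mulr_ge0// ler_peMl.
have h3 := ler_wpM2l (ltW a2) h2.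
have h4 := ler_wpM2r L0 h1.
rewrite expr2 in h3; nra.
Qed.

End diameter_decay.

Lemma dist_tail_lower (R : realType) (gamma chi : R) (d : measure_display)
    (T : measurableType d) (P : probability T R) (Z : R -> T -> R * R) (u zeta : R) :
  mated_crt_brownian_motion gamma 1 P Z -> is_distance_exponent gamma chi ->
  0 < gamma < 2 -> 0 < u < chi -> 0 < zeta ->
  exists2 Q : nat, (0 < Q)%N & forall C0 : nat, (0 < C0)%N ->
  exists m0 : nat, forall m : nat, (m0 <= m)%N -> forall N x y : nat,
    (N <= C0 * m ^ Q)%N -> (x + m ^ Q < y)%N -> (y < N)%N ->
  exists2 l : nat, expR ((chi - u) * ln (C0 * m ^ Q)%:R) <= l.+1%:R &
    expR (- (zeta * ln (m ^ Q)%:R)) <=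
      path_prob P Z [set z | ~~ path_reach z 0 N l x y].
Proof.
move=> bmZ hchi hgamma /andP[u0 uchi] zeta0; have chi0 : 0 < chi by exact: lt_trans uchi.
have [Th [rho [Th0 rho0 hpinch]]] := pinch_lower bmZ hgamma.
(* The bound reached at the end is m^(-(2 Th + 3)): Th for each outer side and 3 for the middle.
   This q makes it at least (m^Q)^(-zeta). *)
pose q := (6 + (Num.truncn ((2 * Th + 3) / zeta)).+1)%N.
have q6 : (6 <= q)%N by rewrite /q leq_addr.
have q5 : (5 <= q)%N by exact: ltnW.
pose Q := (2 * q)%N.
have Qz : 2 * Th + 3 <= zeta * Q%:R.
  rewrite [leRHS]mulrC -ler_pdivrMr//; apply: (@le_trans _ _ q%:R); last first.
    by rewrite ler_nat /Q leq_pmull.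
  by rewrite ltW// (lt_le_trans (truncnS_gt _))// ler_nat /q leq_addl.
have Q0 : (0 < Q)%N by rewrite /Q; clear - q6; lia.
have Q1 : 1 <= Q%:R :> R by rewrite ler1n.
have QR0 : 0 < Q%:R :> R by rewrite ltr0n.
(* The first term leaves room in the exponent chi - u. The second makes D, of order m^((chi + a) (Q
   - 1)), negligible against m^((chi - a) Q). The third keeps the probability m^(-2 a Q) above
   m^(-1/2). *)
pose a := Num.min (u / 4) (Num.min (chi / (4 * Q%:R)) (1 / (8 * Q%:R))).
have a0 : 0 < a.
  by rewrite !lt_min !divr_gt0// mulr_gt0.
have [a1 a2 a3] : [/\ 4 * a <= u, 4 * a * Q%:R <= chi & 8 * a * Q%:R <= 1].
  split.
  - by rewrite mulrC -ler_pdivlMr// ge_min lexx.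
  - by rewrite mulrAC mulrC -ler_pdivlMr ?mulr_gt0// !ge_min lexx orbT.
  - by rewrite mulrAC mulrC -ler_pdivlMr ?mulr_gt0// !ge_min lexx !orbT.
have achi : 0 < a < chi.
  by rewrite a0; apply: lt_le_trans a2; have := ler_wpM2l (ltW a0) Q1; lra.
have aQ := ler_peMr (ltW a0) Q1.
exists Q => // C0 C00.
have [n1 h1] := diam_tail_lower bmZ hchi achi.
have hb2 : (0 < Q.-1 <= Q.-1)%N by rewrite /Q; clear - q6; lia.
have hb3 : (0 < 2 * q - 2 <= Q.-1)%N by rewrite /Q; clear - q6; lia.
have [n2 h2] := diam_tail_decay_pow bmZ hchi a0 hb2.
have [n3 h3] := diam_tail_decay_pow bmZ hchi a0 hb3.
have [n4 h4] := hpinch q C0 q5.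
have [n5 h5] := no_hit_small rho0 q6.
(* All gaps between exponents of m that are used below are at least c, so each of them gains a
   factor 64. *)
pose c := Num.min a (1 / 2).
have c0 : 0 < c by rewrite lt_min a0; lra.
have [L1 [L1_0 hL1]] := @exp_ge_cst R c 64 c0.
(* The second term absorbs the power of C0 into the gap between the exponents chi - u and chi - 2
   a. *)
have [n6 [n60 h6]] := @ln_nat_ge R (L1 + `|2 * chi * ln C0%:R / u|).
exists (n1 + n2 + n3 + n4 + n5 + n6)%N => m hm N x y hN hxy hy.
have [[hm1 hm2 hm3] [hm4 hm5 hm6] m_gt0] : [/\ [/\ n1 <= m, n2 <= m & n3 <= m],
    [/\ n4 <= m, n5 <= m & n6 <= m] & 0 < m]%N.
  by clear - hm n60; split; [split; lia|split; lia|lia].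
have {}h1 := h1 (m ^ Q)%N; have {}h2 := h2 m hm2; have {}h3 := h3 m hm3.
have {}h4 := h4 m hm4; have {}h5 := h5 m hm5; have {}h6 := h6 m hm6.
have lnQ := ln_natX R Q m_gt0; have mE := expR_ln_nat R m_gt0.
have mQ : (m <= m ^ Q)%N by rewrite -[leqLHS]expn1 leq_pexp2l.
have {}h1 := h1 (leq_trans hm1 mQ); rewrite lnQ in h1.
have lnCQ : ln (C0 * m ^ Q)%:R = ln C0%:R + Q%:R * ln m%:R :> R.
  by rewrite natrM lnM ?posrE ?ltr0n ?expn_gt0 ?m_gt0// lnQ.
rewrite lnCQ lnQ.
set L := ln m%:R in h1 h2 h3 h4 h5 h6 mE *.
have LL1 : L1 <= L by have h := normr_ge0 (2 * chi * ln C0%:R / u); clear - h h6; lra.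
have L0 : 0 <= L by exact: le_trans LL1.
have big (e : R) : c <= e -> 64 <= expR (e * L).
  by move=> ce; apply: le_trans (hL1 L LL1) _; rewrite ler_expR ler_wpM2r.
have ca : c <= a by rewrite ge_min lexx.
have c2 : c <= 1 / 2 by rewrite ge_min lexx orbT.
pose D := Num.truncn (expR ((chi + a) * (Q.-1%:R * L))).
have [D1 _] := truncn_exp ((chi + a) * (Q.-1%:R * L)); rewrite -/D in D1.
have D2 : D%:R <= expR ((chi + a) * (Q.-1%:R * L)) by rewrite truncn_le// expR_ge0.
pose l := Num.truncn (expR ((chi - 2 * a) * (Q%:R * L))).
have [l1 _] := truncn_exp ((chi - 2 * a) * (Q%:R * L)); rewrite -/l in l1.
have l2 : l%:R <= expR ((chi - 2 * a) * (Q%:R * L)) by rewrite truncn_le// expR_ge0.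
have pM := h2 D D1; have pW := h3 D D1.
have QL : L <= Q%:R * L by rewrite ler_peMl.
exists l.
  apply: ltW; apply: le_lt_trans l1; rewrite ler_expR.
  have LC : 2 * chi * ln C0%:R / u <= L.
    by apply: le_trans (ler_norm _) _; clear - h6 L1_0; lra.
  rewrite ler_pdivrMr// in LC.
  have lnC0 : 0 <= ln C0%:R :> R by rewrite ln_ge0// ler1n.
  have h7 : (u - 2 * a) * L <= (u - 2 * a) * (Q%:R * L).
    by rewrite ler_wpM2l//; clear - a0 a1 u0; lra.
  have h8 := ler_wpM2r L0 a1; have h9 := mulr_ge0 (ltW u0) lnC0.
  clear - LC h7 h8 h9; lra.
set x0 := expR ((chi - a) * (Q%:R * L)) in h1.
have x0_64 : 64 <= x0.
  rewrite /x0 mulrA; apply: big; apply: le_trans ca _.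
  apply: (@le_trans _ _ (chi - a)); first by clear - a0 a2 aQ; lra.
  by rewrite ler_peMr//; clear - a0 a2 aQ; lra.
have lx0 : expR ((chi - 2 * a) * (Q%:R * L)) * 64 <= x0.
  have := big (a * Q%:R) (le_trans ca _).
  rewrite ler_peMr ?(ltW a0)// => /(_ isT) h.
  apply: (@le_trans _ _ (expR ((chi - 2 * a) * (Q%:R * L)) * expR (a * Q%:R * L))).
    by rewrite ler_wpM2l ?expR_ge0.
  by rewrite -expRD /x0 ler_expR; clear - L; lra.
have QE : Q%:R = Q.-1%:R + 1 :> R by rewrite natr1 prednK.
have Dx0 : expR ((chi + a) * (Q.-1%:R * L)) * 64 <= x0.
  have hc : c <= chi - a * (2 * Q%:R - 1).
    by apply: le_trans ca _; clear - a0 a2 aQ; lra.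
  apply: (@le_trans _ _ (expR ((chi + a) * (Q.-1%:R * L)) *
      expR ((chi - a * (2 * Q%:R - 1)) * L))).
    by rewrite ler_wpM2l ?expR_ge0// big.
  rewrite -expRD /x0 ler_expR QE; clear - L; lra.
(* The two terms D are spent in the two windows by [separation]; the pigeonhole step adds one more
   to reach an arbitrary vertex from a multiple of M. *)
pose l' := (l + D + D)%N.
have hl0 : ((l' + D) + (l' + D)).+1%:R <= x0 / 4.
  rewrite /l' -natr1 !natrD; clear - l2 D2 lx0 Dx0 x0_64; lra.
have plow := h1 _ hl0.
pose M := (m ^ Q.-1)%N.
have M0 : (0 < M)%N by rewrite expn_gt0 m_gt0.
have mM : (m * M = m ^ Q)%N by rewrite -expnS prednK.
pose y0 := expR (- L).
have y0_gt0 : 0 < y0 by exact: expR_gt0.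
have yE k : expR (- (k%:R * L)) = y0 ^+ k by rewrite -mulrN expRM_natl.
have y0E : y0 * m%:R = 1 by rewrite -mE -expRD addNr expR0.
have y0_64 : y0 * 64 <= 1.
  have m64 : 64 <= m%:R :> R by have := big 1; rewrite mul1r mE; apply; clear - c2; lra.
  by have := ler_wpM2l (ltW y0_gt0) m64; rewrite y0E.
(* The left-hand side is at most m (m^(-4) + m^(-2)), of order 1 / m, whereas the tail on the right
   is at least m^(-1/2) / 8. *)
have pig : m%:R * (diam_tail P Z M D + y0 ^+ 2) < diam_tail P Z (m * M) ((l' + D) + (l' + D)).
  apply: lt_le_trans; last by rewrite mM; exact: plow.
  rewrite -/M yE in pM.
  have s0 : 64 <= expR (1 / 2 * L) by apply: big.
  pose w := expR (- (1 / 2 * L)).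
  have w0 : 0 < w by exact: expR_gt0.
  have wE : w * expR (1 / 2 * L) = 1 by rewrite -expRD addNr expR0.
  have w64 : w * 64 <= 1 by have := ler_wpM2l (ltW w0) s0; rewrite wE.
  have w2 : w ^+ 2 = y0 by rewrite -expRM_natl /y0; congr expR; clear - L; lra.
  have h : w <= expR (- (2 * a * (Q%:R * L))).
    have h := ler_wpM2r L0 a3; rewrite /w ler_expR; clear - h L0; lra.
  apply: (@lt_le_trans _ _ (w / 8)); last by clear - h; lra.
  apply: (@le_lt_trans _ _ (m%:R * (y0 ^+ 4 + y0 ^+ 2))).
    by rewrite ler_wpM2l// lerD2r.
  have -> : m%:R * (y0 ^+ 4 + y0 ^+ 2) = (y0 * m%:R) * (y0 ^+ 3 + y0) by ring.
  rewrite y0E mul1r.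
  rewrite -w2; clear - w0 w64.
  have v0 : 0 <= w ^+ 2 by exact: sqr_ge0.
  have v1 : w ^+ 2 <= w / 64 by rewrite expr2; nra.
  have v3 : (w ^+ 2) ^+ 3 <= w ^+ 2.
    by rewrite exprS ler_piMr// exprn_ile1//; lra.
  lra.
have [i /andP[i0 im] hend] := end_tail_pigeonhole bmZ M0 (exprn_ge0 2 (ltW y0_gt0)) pig.
pose n := (i * M).+1.
pose W := (m ^ (2 * q - 2))%N.
have nmQ : (n <= m ^ Q)%N.
  by rewrite -mM /n (leq_ltn_trans _ (_ : i * M < m * M)%N)// ltn_pmul2r.
have WM : (W <= M)%N by rewrite leq_pexp2l//; case/andP: hb3.
have Wn : (W <= n)%N.
  by rewrite /n (leq_trans WM)// leqW// leq_pmull.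
have m2 : (1 < m)%N.
  rewrite ltnNge; apply/negP => m1; have : m%:R <= 1 :> R by rewrite lern1.
  move=> hm1'; have h := ler_wpM2l (ltW y0_gt0) hm1'.
  rewrite y0E mulr1 in h; clear - h y0_64 y0_gt0; lra.
have W1 : (1 < W)%N.
  by rewrite (leq_trans m2)// -[leqLHS]expn1 leq_pexp2l//; case/andP: hb3.
(* The pinched interval is [x + 1, x + 1 + n): it starts just after x, and n <= m^Q makes it end
   before y. *)
have bly : (x.+1 + n <= y)%N.
  by rewrite addSn (leq_ltn_trans _ hxy)// leq_add2l.
have bN : (x.+1 + n <= N)%N by rewrite (leq_trans bly)// ltnW.
pose h' := (rho + 1) * (m ^ (q - 5))%:R.
have h'0 : 0 < h' by rewrite mulr_gt0 ?ltr0n ?expn_gt0 ?m_gt0// ltr_wpDl.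
have hh : 0 < h' < 2 * h' by rewrite h'0; clear - h'0; lra.
have WnW : (1 < W <= n)%N by rewrite W1.
have := separation bmZ l D (ltnSn x) bly bN WnW hh.
apply: le_trans.
have aN : (x.+1 <= C0 * m ^ Q)%N by rewrite (leq_trans _ hN)// (leq_trans _ bN)// leq_addr.
have bN' : (N - (x.+1 + n) <= C0 * m ^ Q)%N by rewrite (leq_trans (leq_subr _ _)).
have pl := h4 _ aN; have pr' := h4 _ bN'.
rewrite -(stay_above_reverse bmZ) in pl.
rewrite -(stay_above_shift bmZ (x.+1 + n)) subnKC// in pr'.
have brk : y0 ^+ 3 <= end_tail P Z n (l + D + D) - 2 * diam_tail P Z W D -
    4 * (4 * (2 * h') / Num.sqrt W.-1%:R + 4 * W.-1%:R * expR (- ((2 * h') ^+ 2 / 4))).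
  move: h5 pW hend; rewrite -/W -/h' !yE -/n -/l'.
  set nu := 4 * (_ + _); set et := end_tail _ _ _ _; set pw := diam_tail P Z W D => h5 pW hend.
  clearbody nu et pw; clear - h5 pW hend y0_gt0 y0_64.
  have y2 := exprn_gt0 2 y0_gt0; have y3 := exprn_gt0 3 y0_gt0.
  have e3 : y0 ^+ 3 <= y0 ^+ 2 / 64 by rewrite exprS; nra.
  have e4 : y0 ^+ 4 <= y0 ^+ 3 / 64 by rewrite exprS; nra.
  lra.
apply: (@le_trans _ _ (expR (- (Th * L)) * expR (- (Th * L)) * y0 ^+ 3)).
  rewrite -yE -!expRD ler_expR.
  have h := ler_wpM2r L0 Qz; clear - h; lra.
apply: ler_pM => //; first by rewrite exprn_ge0// ltW.
by apply: ler_pM; rewrite ?expR_ge0.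
Qed.

Lemma nat_root (Q Y : nat) : (0 < Q)%N -> exists m : nat, (m ^ Q <= Y < m.+1 ^ Q)%N.
Proof.
move=> Q0; elim: Y => [|Y [m /andP[h1 h2]]]; first by exists 0%N; rewrite exp0n// exp1n.
have [h|h] := leqP (m.+1 ^ Q) Y.+1.
  by exists m.+1; rewrite h (leq_ltn_trans h2)// ltn_exp2r.
by exists m; rewrite h (leq_trans h1).
Qed.

(** * From numbers of blocks back to the mesh eps *)

Section lower_bound.
Variables (R : realType) (gamma chi : R).
Variables (d : measure_display) (T : measurableType d).
Variables (P : probability T R) (Z : R -> T -> R * R).
Hypothesis bmZ : mated_crt_brownian_motion gamma 1 P Z.
Hypothesis hchi : is_distance_exponent gamma chi.
Hypothesis hgamma : 0 < gamma < 2.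
Notation pr := (path_prob P Z).

Lemma dist_tail_lower_eps (delta u zeta : R) : 0 < delta -> 0 < u -> 0 < zeta ->
  exists2 eps1 : R, 0 < eps1 & forall eps : R, 0 < eps <= eps1 ->
  forall i j : nat, (j < Num.truncn eps^-1)%N -> i%:R * eps + delta < j%:R * eps ->
  exists2 l : nat, expR ((chi - u) * ln eps^-1) <= l.+1%:R &
    expR (- (zeta * ln eps^-1)) <=
      pr [set z | ~~ path_reach z 0 (Num.truncn eps^-1) l i j].
Proof.
move=> delta0 u0 zeta0.
(* For u >= chi the threshold is at most 1, and distinct vertices are never joined by a walk of
   length 0. *)
have [uchi|uchi] := leP chi u.
  exists 1 => // eps /andP[e0 e1] i j jN ij; have L0 : 0 <= ln eps^-1.
    by rewrite ln_ge0// invf_ge1.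
  exists 0%N; first by rewrite -[leRHS]expR0 ler_expR; nra.
  have -> : [set z : planar_path R | ~~ path_reach z 0 (Num.truncn eps^-1) 0 i j] = setT.
    apply/seteqP; split => // z _ /=.
    rewrite orbF; apply/eqP => ijE; move: ij; rewrite ijE; lra.
  rewrite /path_prob preimage_setT Pr_setT -[leRHS]expR0 ler_expR oppr_le0.
  by rewrite mulr_ge0// ltW.
have hu : 0 < u < chi by rewrite u0.
have [Q Q0 hQ] := dist_tail_lower bmZ hchi hgamma hu zeta0.
(* With m the integer Q-th root of delta / eps, one has delta / eps < (m + 1)^Q <= (2 m)^Q, hence 1
   / eps <= C0 m^Q. *)
pose C0 := (Num.truncn (2 ^+ Q / delta)).+1.
have [m0 hm0] := hQ C0 isT.
exists (Num.min 1 (delta / (m0.+1 ^ Q)%:R)).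
  by rewrite lt_min ltr01 divr_gt0// ltr0n expn_gt0.
move=> eps /andP[e0]; rewrite le_min => /andP[e1 em] i j jN ij.
set X := eps^-1 in jN *; have X0 : 0 < X by rewrite invr_gt0.
have XE : X * eps = 1 by rewrite mulVf// gt_eqF.
have X1 : 1 <= X by rewrite invf_ge1.
pose Y := Num.truncn (delta * X).
have /andP[Y1 Y2] := truncn_itv (ltW (mulr_gt0 delta0 X0)); rewrite -/Y in Y1 Y2.
have mY : (m0.+1 ^ Q <= Y)%N.
  rewrite truncn_ge_nat ?mulr_ge0 ?(ltW delta0) ?(ltW X0)//.
  by move: em; rewrite ler_pdivlMr ?ltr0n ?expn_gt0// mulrC -ler_pdivlMr.
have [m /andP[m1 m2]] := nat_root Y Q0.
have m0m : (m0 < m)%N.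
  by rewrite -ltnS -(ltn_exp2r _ _ Q0) (leq_ltn_trans mY).
have mQ : (m ^ Q)%:R <= delta * X by apply: le_trans Y1; rewrite ler_nat.
have XC : X <= (C0 * m ^ Q)%:R.
  have h : delta * X <= 2 ^+ Q * (m ^ Q)%:R.
    apply: (le_trans (ltW Y2)); rewrite -natrX -natrM ler_nat -expnMn (leq_trans m2)//.
    by rewrite leq_exp2r// mul2n -addnn -addn1 leq_add2l (leq_ltn_trans _ m0m).
  have hC : 2 ^+ Q / delta <= C0%:R by exact/ltW/truncnS_gt.
  rewrite ler_pdivrMr// in hC.
  rewrite natrM -(ler_pM2l delta0) (le_trans h)// mulrA [delta * _]mulrC.
  by rewrite ler_wpM2r.
have NX : (Num.truncn X)%:R <= X by rewrite truncn_le// ltW.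
have [||l hl pl] := hm0 m (ltnW m0m) (Num.truncn X) i j _ _ jN.
- by rewrite -(ler_nat R) (le_trans NX).
- rewrite -(ltr_nat R) natrD -(ltr_pM2r e0) mulrDl (le_lt_trans _ ij)// lerD2l.
  by have := ler_wpM2r (ltW e0) mQ; rewrite -mulrA XE mulr1.
have LL : ln X <= ln (C0 * m ^ Q)%:R by rewrite ler_ln ?posrE// (lt_le_trans X0).
exists l.
  by apply: le_trans hl; rewrite ler_expR ler_wpM2l// subr_ge0 ltW.
apply: le_trans pl; rewrite ler_expR lerN2 ler_wpM2l ?(ltW zeta0)//.
rewrite ler_ln ?posrE ?ltr0n ?expn_gt0 ?(leq_ltn_trans _ m0m)// (le_trans mQ)//.
rewrite ler_piMl ?(ltW X0)//.
have : j%:R * eps <= X * eps by rewrite ler_wpM2r ?(ltW e0)// (le_trans _ NX)// ler_nat ltnW.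
have := mulr_ge0 (ler0n R i) (ltW e0); rewrite XE; lra.
Qed.

Lemma graph_dist_lower_bound (s t u zeta : R) : 0 <= s -> s < t -> t <= 1 ->
  0 < u -> 0 < zeta ->
  exists eps0 : R, 0 < eps0 /\
    forall (alpha : R) (d' : measure_display) (T' : measurableType d')
      (P' : probability T' R) (Z' : R -> T' -> R * R),
    0 < alpha -> mated_crt_brownian_motion gamma alpha P' Z' ->
    forall eps xs xt : R, 0 < eps <= eps0 ->
      closest_vertex eps s xs -> closest_vertex eps t xt ->
      ((eps `^ zeta)%:E
        <= P' [set w | ((eps `^ (- chi + u))%:E
                        <= graph_dist R (mated_crt_map01 (Z' ^~ w) eps) xs xt)%E])%E.
Proof.
move=> s0 st t1 u0 zeta0.
(* Both vertices are within eps <= (t - s) / 8 of their points, so they remain more than (t - s) / 2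
   apart. *)
have delta0 : 0 < (t - s) / 2 by lra.
have [eps1 eps10 heps] := dist_tail_lower_eps delta0 u0 zeta0.
exists (Num.min eps1 (Num.min 1 ((t - s) / 8))).
split; first by rewrite !lt_min eps10 ltr01; lra.
move=> alpha d' T' P' Z' a0 bmZ' eps xs xt /andP[e0].
rewrite !le_min => /and3P[ee1 e1 ets] cs ct.
have e01 : 0 < eps <= 1 by rewrite e0.
have [i [iN xsE si]] : exists i : nat, [/\ (i < Num.truncn eps^-1)%N, xs = i.+1%:R * eps & `|xs - s| <= eps].
  by apply: (closest_vertex_index e01 _ cs); lra.
have [j [jN xtE tj]] : exists i : nat, [/\ (i < Num.truncn eps^-1)%N, xt = i.+1%:R * eps & `|xt - t| <= eps].
  by apply: (closest_vertex_index e01 _ ct); lra.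
have ij : i%:R * eps + (t - s) / 2 < j%:R * eps.
  move: si tj; rewrite !ler_norml xsE xtE => /andP[_ h1] /andP[h2 _].
  rewrite -natr1 mulrDl mul1r in h1; rewrite -natr1 mulrDl mul1r in h2; lra.
have [l hl pl] := heps eps ltac:(by rewrite e0) i j jN ij.
set N := Num.truncn _ in iN jN hl pl.
have [k k0 hk] := path_prob_transfer bmZ a0 e0 bmZ'.
have -> : eps `^ (- chi + u) = expR ((chi - u) * ln eps^-1).
  by rewrite -powR_eps// opprB addrC.
have -> : eps `^ zeta = expR (- (zeta * ln eps^-1)).
  by rewrite -mulNr -powR_eps// opprK.
set lam := expR ((chi - u) * _) in hl *.
pose E := [set z : planar_path R | forall n : nat, n%:R < lam -> ~~ path_reach z 0 N n i j].
have sr n : path_sigma 0 N [set z : planar_path R | ~~ path_reach z 0 N n i j].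
  by apply: path_sigmaCb; apply: path_sigma_reach.
have sE : path_sigma 0 N E.
  have -> : E = \bigcap_n [set z : planar_path R | n%:R < lam -> ~~ path_reach z 0 N n i j].
    by apply/seteqP; split => z h n; [move=> _; exact: h|exact: h].
  by apply: path_sigma_bigcap => n; apply: path_sigma_cond => _; exact: sr.
have [mE PE] := hk 0%N N E sE.
have -> : [set w | (lam%:E <= graph_dist R (mated_crt_map01 (Z'^~ w) eps) xs xt)%E] =
    [set w | E (rescale_path k eps (Z'^~ w))].
  apply/funext => w; rewrite /mkset; apply/propext; rewrite xsE xtE.
  have cz : continuous (Z' ^~ w) by exact: (bm_continuous bmZ').
  exact: (graph_dist_ge cz k0 e0).
rewrite PE lee_fin; apply: (le_trans pl).
apply: le_Pr; [exact: (measurable_event bmZ (@sr l))|exact: (measurable_event bmZ sE)|].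
move=> w /= h n hn; apply: contra h; apply: reach_leq.
by rewrite -ltnS -(ltr_nat R) (lt_le_trans hn).
Qed.

End lower_bound.

Theorem theorem1p15 (R : realType) (gamma chi : R)
    (hgamma : 0 < gamma < 2) (hchi : is_distance_exponent gamma chi) :
  (exists2 c : R, 0 < c &
    forall u : R, 0 < u ->
    exists K eps0 : R, 0 < eps0 /\
      forall (alpha : R) (d : measure_display) (T : measurableType d)
        (P : probability T R) (Z : R -> T -> R * R),
      0 < alpha -> mated_crt_brownian_motion gamma alpha P Z ->
      forall eps : R, 0 < eps <= eps0 ->
        ((1 - K * expR (- c * u ^+ 2 * ln (eps^-1) ^+ 2))%:E
          <= P [set w | graph_diam R (mated_crt_map01 (Z ^~ w) eps)
                          <= (eps `^ (- chi - u))%:E])%E)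
  /\
  (forall s t : R, 0 <= s -> s < t -> t <= 1 ->
    forall u : R, 0 < u ->
    forall zeta : R, 0 < zeta ->
    exists eps0 : R, 0 < eps0 /\
      forall (alpha : R) (d : measure_display) (T : measurableType d)
        (P : probability T R) (Z : R -> T -> R * R),
      0 < alpha -> mated_crt_brownian_motion gamma alpha P Z ->
      forall eps xs xt : R, 0 < eps <= eps0 ->
        closest_vertex eps s xs -> closest_vertex eps t xt ->
        ((eps `^ zeta)%:E
          <= P [set w | (eps `^ (- chi + u))%:E
                          <= graph_dist R (mated_crt_map01 (Z ^~ w) eps) xs xt])%E).
Proof.
(* The constants have to be uniform over all realisations, so one of them is fixed as the reference.
   If there is none, both bounds hold vacuously. *)
have [[alpha [d [T [P [Z [a0 bmZ]]]]]]|nobm] := pselect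
    (exists (alpha : R) (d : measure_display) (T : measurableType d)
        (P : probability T R) (Z : R -> T -> R * R),
      0 < alpha /\ mated_crt_brownian_motion gamma alpha P Z); last first.
  split; first (exists 1 => // u u0; exists 1, 1); last (move=> s t _ _ _ u _ zeta _; exists 1);
    split => // alpha d T P Z a0 bmZ; exfalso; apply: nobm;
    by exists alpha, d, T, P, Z.
have [k _ bmZ1] := bm_standardize a0 ltr01 bmZ.
split.
  exists (1 / 64) => [|u u0]; first lra.
  by exists 1; exact: (graph_diam_upper_bound bmZ1 hchi u0).
move=> s t s0 st t1 u u0 zeta zeta0.
exact: (graph_dist_lower_bound bmZ1 hchi hgamma s0 st t1 u0 zeta0).
Qed.
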